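(* There is a constant $C>0$, independent of $t$ (and of the initial datum), such that the following holds. Let $u_0\in l^1(\mathbb{Z}^3)$ and let $u(\cdot,t)=e^{it\Delta_{\mathrm{disc}}}u_0$ be the solution of the discrete Schrödinger equation on the Layered King's Grid, $$\partial_t u(\mathbf{n},t)-i\Delta_{\mathrm{disc}}u(\mathbf{n},t)=0\ \text{ for } (\mathbf{n},t)\in\mathbb{Z}^3\times(0,\infty),\qquad u(\mathbf{n},0)=u_0(\mathbf{n}).$$ Then for all $t\ge 0$, $$\|u(\cdot,t)\|_{l^\infty(\mathbb{Z}^3)}\le C\,\langle t\rangle^{-13/12}\,\|u_0\|_{l^1(\mathbb{Z}^3)} .$$
   Context: $\langle t\rangle:=\sqrt{1+t^2}$. The Layered King's Grid (LKG) is the graph with vertex set $\mathbb{Z}^3$ in which $\mathbf{n}\sim \mathbf{m}$ are adjacent iff $\mathbf{n}-\mathbf{m}$ belongs to $\{(\pm1,0,0),(0,\pm1,0),(0,0,\pm1),(\pm1,\pm1,0)\}$ (all sign choices, so 10 neighbours per vertex). The discrete Laplacian is $\Delta_{\mathrm{disc}}f(\mathbf{n})=\sum_{\mathbf{m}\sim \mathbf{n}}(f(\mathbf{m})-f(\mathbf{n}))$, a bounded self-adjoint operator on $l^2(\mathbb{Z}^3)$, and $e^{it\Delta_{\mathrm{disc}}}$ is the unitary group it generates on $l^2(\mathbb{Z}^3)\supset l^1(\mathbb{Z}^3)$. On the Fourier side, $e^{it\Delta_{\mathrm{disc}}}$ is multiplication by $\exp\big(-it(10-2\cos x-2\cos y-2\cos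 z-2\cos(x+y)-2\cos(x-y))\big)$, $(x,y,z)\in[0,2\pi]^3$. *)

(* Defs.v *)
From Stdlib Require Import Reals ZArith List Lia.
From Coquelicot Require Import Coquelicot.
Import ListNotations.

Definition Z3 : Type := (Z * Z * Z)%type.

Definition Z3sub (n m : Z3) : Z3 :=
  let '(n1, n2, n3) := n in let '(m1, m2, m3) := m in
  (n1 - m1, n2 - m2, n3 - m3)%Z.

Definition lkg_steps : list Z3 :=
  [(1, 0, 0); (-1, 0, 0); (0, 1, 0); (0, -1, 0); (0, 0, 1); (0, 0, -1);
   (1, 1, 0); (1, -1, 0); (-1, 1, 0); (-1, -1, 0)]%Z.

Definition lkg_adj (n m : Z3) : Prop := In (Z3sub n m) lkg_steps.

Definition lkg_neighbours (n : Z3) : list Z3 := map (Z3sub n) lkg_steps.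

Lemma lkg_neighbours_spec (n m : Z3) : In m (lkg_neighbours n) <-> lkg_adj n m.
Proof.
  destruct n as [[n1 n2] n3], m as [[m1 m2] m3].
  unfold lkg_adj, lkg_neighbours, Z3; cbn -[Z.sub].
  rewrite !pair_equal_spec.
  assert (or_congr : forall P Q P' Q' : Prop,
    (P <-> P') -> (Q <-> Q') -> (P \/ Q <-> P' \/ Q')) by tauto.
  repeat (apply or_congr; [lia | ]); reflexivity.
Qed.

Lemma lkg_neighbours_NoDup (n : Z3) : NoDup (lkg_neighbours n).
Proof.
  destruct n as [[n1 n2] n3].
  unfold lkg_neighbours; cbn -[Z.sub].
  unfold Z3; repeat constructor; cbn -[Z.sub];
    rewrite ?pair_equal_spec; lia.
Qed.

(** By the two lemmas above, the list sum runs exactly once over each [m]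
    adjacent to [n]. *)
Definition lkg_lap (f : Z3 -> C) (n : Z3) : C :=
  fold_right Cplus (RtoC 0) (map (fun m => (f m - f n)%C) (lkg_neighbours n)).

Definition CSeries (a : nat -> C) : C :=
  (Series (fun k => Re (a k)), Series (fun k => Im (a k))).

(** The exponential series of the bounded operator [i t lkg_lap], evaluated site
    by site.  On [l^2] the series converges in operator norm, hence at each site;
    for bounded [f] it converges absolutely at each site, because the absolute
    value of [lkg_lap f] is at most 20 times the supremum of that of [f]. *)
Definition exp_it_lap (t : R) (f : Z3 -> C) (n : Z3) : C :=
  CSeries (fun k =>
    ((Ci * RtoC t) ^ k / RtoC (INR (fact k)) * Nat.iter k lkg_lap f n)%C).

(** Supremum of the sums over finite subsets of [Z3]. *)
Definition l1_norm (f : Z3 -> C) : Rbar :=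
  Lub_Rbar (fun s => exists F : list Z3,
    NoDup F /\ s = fold_right Rplus 0%R (map (fun n => Cmod (f n)) F)).

Definition linf_norm (f : Z3 -> C) : Rbar :=
  Lub_Rbar (fun s => exists n : Z3, s = Cmod (f n)).

Definition in_l1 (f : Z3 -> C) : Prop := is_finite (l1_norm f).

Definition japanese_bracket (t : R) : R := sqrt (1 + t ^ 2).

Definition solves_discrete_schrodinger (u0 : Z3 -> C) (u : R -> Z3 -> C) : Prop :=
  (forall (t : R) (n : Z3), (0 < t)%R ->
     exists du : C,
       is_derive (V := C_R_NormedModule) (fun s => u s n) t du /\
       (du - Ci * lkg_lap (u t) n)%C = RtoC 0) /\
  (forall n : Z3, u 0%R n = u0 n).

(* Main.v *)
Require Import Defs.
From Stdlib Require Import Reals ZArith Lra Lia Psatz Classical ClassicalEpsilon List.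
From Coquelicot Require Import Coquelicot.
Import ListNotations.
Open Scope R_scope.

(** The symbol of the Laplacian is [2 cos z + f x f y - 11] with [f = 1 + 2 cos],
    so the propagator kernel is a one-dimensional integral in [z], which is
    [O(t^(-1/3))] by van der Corput, times a planar integral with phase
    [f x f y - om1 x - om2 y], for which one needs [O(t^(-3/4))] uniformly in
    [om1], [om2].

    Near a point where the second derivative in [u] of the planar phase [Phi]
    does not vanish, take [s = Phi_u] as a coordinate instead of [u].  Then
    [d/ds] of [Phi - om1 u - om2 v] is [(s - om1) / Phi_uu], and its derivatives
    in [v] of order [j + 2 >= 2] are [L^j D - (s - om1) L^(j+1) B], where
    [B = Phi_uv / Phi_uu], [L = d_v - B d_u] and [D = Phi_vv - B Phi_uv].  If [D],
    [L D] or [L (L D)] is nonzero at the point, the van der Corput lemma in [v]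
    gives [t^(-1/4)] for each fixed [s], and an integration by parts in [s] gives
    the other [t^(-1/2)].  For [Phi = f x f y] one of the three is nonzero at every
    point, after exchanging or shearing the coordinates; the worst case, where
    only [L (L D)] survives, is [f x = 0], [sin y = 0].  Compactness of the torus
    makes the estimate uniform. *)

(** * The van der Corput lemma *)

(** Uniformity in the frequencies is built into these coordinates. Neither [om1] nor [om2] enters
    [Phi_uu], [B] or [D], and [om1] reaches the higher derivatives only through [s - om1]. If [om1]
    is close to the range of [s], the terms carrying [s - om1] are too small to cancel the surviving
    [L^j D]; otherwise the phase is nonstationary in [s] and one integration by parts gains [1 / t].
    Hence no normal form or unfolding of a singularity is invoked. [D] is the Hessian determinant
    divided by [Phi_uu], and the Hessian maps [(-B, 1)] to [(0, D)]. Where [D] vanishes the field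
    spans the kernel, so the order of vanishing of [D] along it separates nondegenerate, fold and
    cusp points. The cusp rate [1/2 + 1/4] is used for all of them, and [13/12 = 1/3 + 3/4]. On the
    lattice side the group is treated as a power series in [t]. Its value at a point mass is a
    Fourier integral over the torus, obtained from Taylor polynomials with a uniform remainder, and
    summable data are reached by finite approximation at fixed [t]. *)

(* [ring] fails when the equality is stated in a Coquelicot structure over [R]. *)
Ltac ring_R := match goal with |- @eq _ ?a ?b => change (@eq R a b) end; ring.

Lemma Rabs_plus_le a b A B : Rabs a <= A -> Rabs b <= B -> Rabs (a + b) <= A + B.
Proof. intros. eapply Rle_trans; [apply Rabs_triang | now apply Rplus_le_compat]. Qed.

Lemma Rabs_mult_le a b A B : Rabs a <= A -> Rabs b <= B -> Rabs (a * b) <= A * B.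
Proof. intros. rewrite Rabs_mult. apply Rmult_le_compat; auto; apply Rabs_pos. Qed.

Lemma is_derive_cst (c x : R) : is_derive (fun _ => c) x 0.
Proof. apply (is_derive_const (K := R_AbsRing) (V := R_NormedModule)). Qed.

Lemma is_derive_Rplus (f g : R -> R) (x df dg : R) :
  is_derive f x df -> is_derive g x dg -> is_derive (fun y => f y + g y) x (df + dg).
Proof. apply (is_derive_plus (V := R_NormedModule)). Qed.

Lemma is_derive_Rminus (f g : R -> R) (x df dg : R) :
  is_derive f x df -> is_derive g x dg -> is_derive (fun y => f y - g y) x (df - dg).
Proof. apply (is_derive_minus (V := R_NormedModule)). Qed.

Lemma is_derive_Rmult (f g : R -> R) (x df dg : R) :
  is_derive f x df -> is_derive g x dg ->
  is_derive (fun y => f y * g y) x (df * g x + f x * dg).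
Proof. intros Hf Hg. apply (is_derive_mult f g); auto. intros; apply Rmult_comm. Qed.

Lemma RInt_congr (f g : R -> R) (a b : R) :
  (forall x, f x = g x) -> RInt f a b = RInt g a b.
Proof. intros H. apply RInt_ext. intros x _. apply H. Qed.

Lemma RInt_zero (a b : R) : RInt (fun _ => 0) a b = 0.
Proof. rewrite (RInt_const (V := R_CompleteNormedModule)). apply Rmult_0_r. Qed.

Lemma ex_RInt_all (f : R -> R) (a b : R) : (forall x, continuous f x) -> ex_RInt f a b.
Proof. intros H. apply (ex_RInt_continuous (V := R_CompleteNormedModule)). auto. Qed.

Lemma RInt_Rscal (c : R) (f : R -> R) (a b : R) :
  ex_RInt f a b -> RInt (fun x => c * f x) a b = c * RInt f a b.
Proof. apply (RInt_scal (V := R_CompleteNormedModule)). Qed.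

Lemma RInt_Rplus (f g : R -> R) (a b : R) :
  ex_RInt f a b -> ex_RInt g a b -> RInt (fun x => f x + g x) a b = RInt f a b + RInt g a b.
Proof. apply (RInt_plus (V := R_CompleteNormedModule)). Qed.

Lemma RInt_Rminus (f g : R -> R) (a b : R) :
  ex_RInt f a b -> ex_RInt g a b -> RInt (fun x => f x - g x) a b = RInt f a b - RInt g a b.
Proof. apply (RInt_minus (V := R_CompleteNormedModule)). Qed.

Lemma RInt_shift (f : R -> R) (a b c : R) : (forall x, continuous f x) ->
  RInt (fun x => f (x + c)) a b = RInt f (a + c) (b + c).
Proof.
  intros H. replace (a + c) with (1 * a + c) by ring. replace (b + c) with (1 * b + c) by ring.
  rewrite <- (RInt_comp_lin (V := R_CompleteNormedModule) f 1 c) by now apply ex_RInt_all.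
  apply RInt_congr. intros x. change (f (x + c) = 1 * f (1 * x + c)). now rewrite !Rmult_1_l.
Qed.

Lemma ex_RInt_cont (f : R -> R) (a b : R) :
  a <= b -> (forall x, a <= x <= b -> continuous f x) -> ex_RInt f a b.
Proof.
  intros Hab H. apply (ex_RInt_continuous (V := R_CompleteNormedModule)).
  intros x. rewrite Rmin_left, Rmax_right by lra. apply H.
Qed.

Lemma RInt_derive_cont (f df : R -> R) (a b : R) :
  a <= b ->
  (forall x, a <= x <= b -> is_derive f x (df x)) ->
  (forall x, a <= x <= b -> continuous df x) ->
  RInt df a b = f b - f a.
Proof.
  intros Hab Hd Hc. apply is_RInt_unique.
  apply (is_RInt_derive (V := R_CompleteNormedModule) f df a b);
    intros x; rewrite Rmin_left, Rmax_right by lra; auto.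
Qed.

Lemma Rabs_RInt_le (f : R -> R) (g : R -> R) (a b : R) :
  a <= b -> (forall x, a <= x <= b -> continuous f x) ->
  (forall x, a <= x <= b -> continuous g x) ->
  (forall x, a <= x <= b -> Rabs (f x) <= g x) ->
  Rabs (RInt f a b) <= RInt g a b.
Proof.
  intros Hab Hf Hg H.
  apply (Rle_trans _ (RInt (fun x => Rabs (f x)) a b)).
  - apply abs_RInt_le; [lra | now apply ex_RInt_cont].
  - apply RInt_le; try lra.
    + apply ex_RInt_cont; [lra|]. intros x Hx.
      apply (continuous_comp f Rabs); [auto | apply continuous_Rabs].
    + now apply ex_RInt_cont.
    + intros x Hx. apply H. lra.
Qed.

Lemma Rabs_RInt_le_const (f : R -> R) (a b M : R) :
  a <= b -> (forall x, a <= x <= b -> continuous f x) ->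
  (forall x, a <= x <= b -> Rabs (f x) <= M) ->
  Rabs (RInt f a b) <= (b - a) * M.
Proof.
  intros Hab Hf H. apply abs_RInt_le_const; auto. now apply ex_RInt_cont.
Qed.

Lemma slope_lower_bound (f df : R -> R) (a b l : R) :
  (forall x, a <= x <= b -> is_derive f x (df x)) ->
  (forall x, a <= x <= b -> l <= df x) ->
  forall x y, a <= x -> x <= y -> y <= b -> l * (y - x) <= f y - f x.
Proof.
  intros Hd Hl x y Hx Hxy Hy.
  destruct (MVT_gen f x y df) as [c [Hc E]].
  - rewrite Rmin_left, Rmax_right by lra. intros z Hz. apply Hd. lra.
  - rewrite Rmin_left, Rmax_right by lra. intros z Hz.
    apply derivable_continuous_pt. exists (df z). apply is_derive_Reals, Hd. lra.
  - rewrite Rmin_left, Rmax_right in Hc by lra. rewrite E.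
    apply Rmult_le_compat_r; [lra|]. apply Hl. lra.
Qed.

(* [c] is the zero of [f], or the endpoint of [[a, b]] nearest to it. *)
Lemma linear_growth_center (f df : R -> R) (a b l : R) :
  a <= b -> 0 <= l ->
  (forall x, a <= x <= b -> is_derive f x (df x)) ->
  (forall x, a <= x <= b -> l <= df x) ->
  exists c, a <= c <= b /\
    (forall x, c < x <= b -> l * (x - c) <= f x) /\
    (forall x, a <= x < c -> f x <= - (l * (c - x))).
Proof.
  intros Hab Hl Hd Hdl.
  pose proof (slope_lower_bound f df a b l Hd Hdl) as Hs.
  set (E := fun x => a <= x <= b /\ (x = a \/ f x <= 0)).
  destruct (completeness E) as [c [Hub Hlub]].
  { exists b. intros x [Hx _]. lra. }
  { exists a. split; [lra | now left]. }
  assert (Hac : a <= c) by (apply Hub; split; [lra | now left]).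
  assert (Hcb : c <= b) by (apply Hlub; intros x [Hx _]; lra).
  exists c. split; [lra|]. split.
  - intros x Hx.
    apply Rnot_lt_le; intros Hlt.
    assert (Hp : forall y, c < y <= x -> 0 < f y).
    { intros y Hy. apply Rnot_le_lt; intros Hn.
      assert (y <= c) by (apply Hub; split; [lra | now right]). lra. }
    assert (Hfx : 0 < f x) by (apply Hp; lra).
    assert (Hl1 : 0 < l).
    { destruct (Req_dec l 0) as [->|]; [|lra]. exfalso. lra. }
    (* A point so close to [c] that the slope bound, run back from [x], gives [f y < 0], whereas [f]
       is positive on all of [(c, x]]. *)
    set (y := Rmin x (c + (l * (x - c) - f x) / (2 * l))).
    assert (Hy : c < y <= x).
    { unfold y; split; [|apply Rmin_l]. apply Rmin_glb_lt; [lra|].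
      enough (0 < (l * (x - c) - f x) / (2 * l)) by lra.
      apply Rdiv_lt_0_compat; lra. }
    assert (Hy2 : y <= c + (l * (x - c) - f x) / (2 * l)) by apply Rmin_r.
    assert (Hfy := Hp y Hy).
    assert (Hsl := Hs y x ltac:(lra) ltac:(lra) ltac:(lra)).
    assert (l * (y - c) <= (l * (x - c) - f x) / 2).
    { apply (Rmult_le_compat_l l) in Hy2; [|lra].
      replace (l * (c + (l * (x - c) - f x) / (2 * l)))
        with (l * c + (l * (x - c) - f x) / 2) in Hy2 by (field; lra). lra. }
    nra.
  - intros x Hx.
    apply Rnot_lt_le; intros Hlt.
    assert (Hy : forall y, x < y -> E y -> f x <= - (l * (y - x))).
    { intros y Hxy [Hy1 Hy2].
      assert (Hsl := Hs x y ltac:(lra) ltac:(lra) ltac:(lra)).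
      destruct Hy2; lra. }
    destruct (Req_dec l 0) as [->|Hl1].
    + assert (c <= x); [|lra]. apply Hlub. intros y Hy'.
      apply Rnot_lt_le; intros Hyx. specialize (Hy y Hyx Hy'). lra.
    + assert (Hc2 : c <= Rmax x (x + - f x / l)).
      { apply Hlub. intros y Hy'. destruct (Rle_lt_dec y x).
        - apply Rle_trans with x; [lra | apply Rmax_l].
        - apply Rle_trans with (x + - f x / l); [|apply Rmax_r].
          specialize (Hy y r Hy').
          enough (y - x <= - f x / l) by lra.
          apply Rle_div_r; lra. }
      assert (c - x <= Rmax 0 (- f x / l)).
      { unfold Rmax in *; destruct Rle_dec; destruct Rle_dec; lra. }
      unfold Rmax in H; destruct Rle_dec; [|lra].
      apply Rle_div_r in H; lra.
Qed.

Lemma RInt_split (f : R -> R) (a b c : R) :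
  a <= b -> b <= c -> (forall x, a <= x <= c -> continuous f x) ->
  RInt f a c = RInt f a b + RInt f b c.
Proof.
  intros Hab Hbc Hc. symmetry.
  apply (RInt_Chasles (V := R_CompleteNormedModule));
    apply ex_RInt_cont; auto; intros; apply Hc; lra.
Qed.

(** The inductive step of van der Corput: a window of half-width [eta] about [c] is estimated
    trivially and each side by [K]. Where the window sticks out of [[a, b]], the cut is clipped to
    the endpoint and that side is empty. *)
Lemma Rabs_RInt_split_center (f : R -> R) (a b c eta K : R) :
  a <= c <= b -> 0 < eta -> 0 <= K ->
  (forall x, a <= x <= b -> continuous f x) ->
  (forall x, a <= x <= b -> Rabs (f x) <= 1) ->
  (forall p q, a <= p -> p <= q -> q <= b -> q <= c - eta \/ c + eta <= p ->
     Rabs (RInt f p q) <= K) ->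
  Rabs (RInt f a b) <= 2 * K + 2 * eta.
Proof.
  intros Hc He HK Hf H1 H.
  set (p := Rmax a (c - eta)). set (q := Rmin b (c + eta)).
  assert (Hp : a <= p <= c) by (unfold p, Rmax; destruct Rle_dec; lra).
  assert (Hq : c <= q <= b) by (unfold q, Rmin; destruct Rle_dec; lra).
  rewrite (RInt_split f a p b), (RInt_split f p q b);
    try lra; try (intros; apply Hf; lra).
  assert (Rabs (RInt f a p) <= K).
  { unfold p, Rmax in *; destruct Rle_dec; [apply H; lra|].
    rewrite (RInt_point (V := R_CompleteNormedModule)).
    unfold zero; simpl. rewrite Rabs_R0. lra. }
  assert (Rabs (RInt f q b) <= K).
  { unfold q, Rmin in *; destruct Rle_dec; [|apply H; lra].
    rewrite (RInt_point (V := R_CompleteNormedModule)).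
    unfold zero; simpl. rewrite Rabs_R0. lra. }
  assert (Rabs (RInt f p q) <= (q - p) * 1).
  { apply Rabs_RInt_le_const; try lra; intros; [apply Hf | apply H1]; lra. }
  assert (q - p <= 2 * eta).
  { assert (c - eta <= p) by apply Rmax_r. assert (q <= c + eta) by apply Rmin_r. lra. }
  eapply Rle_trans; [apply Rabs_triang|].
  eapply Rle_trans; [apply Rplus_le_compat_l, Rabs_triang|]. lra.
Qed.

Lemma continuous_cos_comp (f : R -> R) (x : R) :
  continuous f x -> continuous (fun y => cos (f y)) x.
Proof. intros H. apply (continuous_comp f cos); [auto | apply continuous_cos]. Qed.

Lemma continuous_sin_comp (f : R -> R) (x : R) :
  continuous f x -> continuous (fun y => sin (f y)) x.
Proof. intros H. apply (continuous_comp f sin); [auto | apply continuous_sin]. Qed.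

Lemma is_derive_cont (f : R -> R) (x l : R) : is_derive f x l -> continuous f x.
Proof.
  intros H. apply (ex_derive_continuous (K := R_AbsRing) (V := R_NormedModule)).
  now exists l.
Qed.

Lemma Rabs_cos_le (x : R) : Rabs (cos x) <= 1.
Proof. apply Rabs_le, COS_bound. Qed.

Lemma Rabs_sin_le (x : R) : Rabs (sin x) <= 1.
Proof. apply Rabs_le, SIN_bound. Qed.

Lemma continuous_div (f g : R -> R) (x : R) :
  continuous f x -> continuous g x -> g x <> 0 -> continuous (fun y => f y / g y) x.
Proof.
  intros Hf Hg Hx. apply (continuous_mult f (fun y => / g y)); [auto|].
  now apply continuous_Rinv_comp.
Qed.

(** Integration by parts through [sin phi / phi1]. Since [phi2 >= 0], the error term is dominated by
    the integral of [phi2 / phi1^2], the exact variation of [- / phi1], which is at most [2 * eta];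
    the boundary terms give another [2 * eta]. *)
Lemma van_der_corput_1 (phi phi1 phi2 : R -> R) (a b eta : R) :
  a <= b -> 0 < eta ->
  (forall x, a <= x <= b -> is_derive phi x (phi1 x)) ->
  (forall x, a <= x <= b -> is_derive phi1 x (phi2 x)) ->
  (forall x, a <= x <= b -> continuous phi2 x) ->
  (forall x, a <= x <= b -> 0 <= phi2 x) ->
  (forall x, a <= x <= b -> 1 <= eta * Rabs (phi1 x)) ->
  Rabs (RInt (fun x => cos (phi x)) a b) <= 4 * eta.
Proof.
  intros Hab He H1 H2 Hc2 Hp Hl.
  assert (Hnz : forall x, a <= x <= b -> phi1 x <> 0).
  { intros x Hx E. specialize (Hl x Hx). rewrite E, Rabs_R0 in Hl. lra. }
  assert (Hinv : forall x, a <= x <= b -> Rabs (/ phi1 x) <= eta).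
  { intros x Hx. specialize (Hl x Hx). specialize (Hnz x Hx).
    rewrite Rabs_inv. assert (0 < Rabs (phi1 x)) by now apply Rabs_pos_lt.
    apply (Rmult_le_reg_r (Rabs (phi1 x))); [lra|].
    rewrite Rinv_l; lra. }
  assert (Hq : forall x, a <= x <= b -> continuous (fun y => phi2 y / (phi1 y)^2) x).
  { intros x Hx. apply continuous_div; auto.
    - apply (continuous_comp phi1 (fun z => z ^ 2)); [eapply is_derive_cont; eauto|].
      apply (is_derive_cont _ _ (2 * phi1 x)). auto_derive; [easy | ring].
    - apply pow_nonzero; auto. }
  assert (Hphi : forall x, a <= x <= b -> continuous phi x)
    by (intros; eapply is_derive_cont; eauto).
  assert (Hsq : forall x, a <= x <= b ->
     continuous (fun y => sin (phi y) * (phi2 y / (phi1 y)^2)) x).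
  { intros x Hx. apply (continuous_mult (fun y => sin (phi y))); auto.
    now apply continuous_sin_comp, Hphi. }
  assert (HG : RInt (fun x => cos (phi x) - sin (phi x) * (phi2 x / (phi1 x)^2)) a b
     = sin (phi b) / phi1 b - sin (phi a) / phi1 a).
  { apply (RInt_derive_cont (fun x => sin (phi x) / phi1 x)); auto.
    - intros x Hx. specialize (H1 x Hx). specialize (H2 x Hx). specialize (Hnz x Hx).
      auto_derive.
      + repeat split; auto; eexists; eauto.
      + replace (Derive (fun x0 => phi x0) x) with (phi1 x) by (symmetry; now apply is_derive_unique).
        replace (Derive (fun x0 => phi1 x0) x) with (phi2 x) by (symmetry; now apply is_derive_unique).
        field; auto.
    - intros x Hx. apply (continuous_minus (fun y => cos (phi y))); auto.
      now apply continuous_cos_comp, Hphi. }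
  assert (HI : RInt (fun x => phi2 x / (phi1 x)^2) a b = - / phi1 b - - / phi1 a).
  { apply (RInt_derive_cont (fun x => - / phi1 x)); auto.
    intros x Hx. specialize (H2 x Hx). specialize (Hnz x Hx). auto_derive.
    + repeat split; auto; eexists; eauto.
    + replace (Derive (fun x0 => phi1 x0) x) with (phi2 x) by (symmetry; now apply is_derive_unique).
      field; auto. }
  assert (E : RInt (fun x => cos (phi x)) a b
    = RInt (fun x => cos (phi x) - sin (phi x) * (phi2 x / (phi1 x)^2)) a b
      + RInt (fun x => sin (phi x) * (phi2 x / (phi1 x)^2)) a b).
  { rewrite <- RInt_Rplus.
    - apply RInt_ext. intros x _. unfold plus; simpl. ring.
    - apply ex_RInt_cont; auto. intros x Hx.
      apply (continuous_minus (fun y => cos (phi y))); auto.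
      now apply continuous_cos_comp, Hphi.
    - apply ex_RInt_cont; auto. }
  assert (HJ : Rabs (RInt (fun x => sin (phi x) * (phi2 x / (phi1 x)^2)) a b)
     <= RInt (fun x => phi2 x / (phi1 x)^2) a b).
  { apply Rabs_RInt_le; auto. intros x Hx. rewrite Rabs_mult.
    assert (0 <= phi2 x / phi1 x ^ 2).
    { apply Rle_div_r; [|rewrite Rmult_0_l; auto].
      apply Rlt_gt. specialize (Hnz x Hx). rewrite <- Rsqr_pow2. now apply Rsqr_pos_lt. }
    rewrite (Rabs_right (phi2 x / phi1 x ^ 2)) by lra.
    pose proof (Rabs_sin_le (phi x)). nra. }
  rewrite E, HG. rewrite HI in HJ.
  pose proof (Hinv a ltac:(lra)) as Ia. pose proof (Hinv b ltac:(lra)) as Ib.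
  assert (Hs : forall x, a <= x <= b -> Rabs (sin (phi x) / phi1 x) <= eta).
  { intros x Hx. unfold Rdiv. rewrite Rabs_mult.
    pose proof (Rabs_sin_le (phi x)). pose proof (Hinv x Hx).
    pose proof (Rabs_pos (sin (phi x))). nra. }
  pose proof (Hs a ltac:(lra)) as Sa. pose proof (Hs b ltac:(lra)) as Sb.
  apply Rabs_le_between in Ia, Ib, Sa, Sb, HJ. apply Rabs_le. lra.
Qed.

(** The recursion is that of [Rabs_RInt_split_center]: two sides plus a window of length [2 * eta].
    The initial 10 is [2 * 4 + 2], with 4 from [van_der_corput_1]; index [k] belongs to the
    derivative of order [k + 2]. *)
Fixpoint vdc_const (k : nat) : R :=
  match k with O => 10 | S j => 2 * vdc_const j + 2 end.

Lemma vdc_const_pos k : 0 < vdc_const k.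
Proof. induction k; simpl; lra. Qed.

(* [eta] stands for [lambda^(-1/(k+2))], where [lambda] bounds the derivative of
   order [k + 2] from below. *)
Lemma van_der_corput (k : nat) (phi : nat -> R -> R) (a b eta : R) :
  a <= b -> 0 < eta ->
  (forall i x, (i < k + 2)%nat -> a <= x <= b -> is_derive (phi i) x (phi (S i) x)) ->
  (forall x, a <= x <= b -> continuous (phi (k + 2)%nat) x) ->
  (forall x, a <= x <= b -> 1 <= eta ^ (k + 2) * phi (k + 2)%nat x) ->
  Rabs (RInt (fun x => cos (phi O x)) a b) <= vdc_const k * eta.
Proof.
  intros Hab He.
  revert phi a b Hab. induction k as [|k IH]; intros phi a b Hab Hd Hc Hl.
  - simpl in Hc, Hl.
    destruct (linear_growth_center (phi 1%nat) (phi 2%nat) a b (/ eta ^ 2))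
      as [c [Hcab [Hr Hle]]]; [exact Hab | left | | |].
    { apply Rinv_0_lt_compat, pow_lt, He. }
    { intros x Hx. apply Hd; [lia | auto]. }
    { intros x Hx. specialize (Hl x Hx).
      apply (Rmult_le_reg_l (eta ^ 2)); [apply pow_lt, He|].
      rewrite Rinv_r; [simpl; lra | apply pow_nonzero; lra]. }
    replace (vdc_const 0 * eta) with (2 * (4 * eta) + 2 * eta) by (simpl; ring).
    apply (Rabs_RInt_split_center _ a b c); try lra.
    + intros x Hx. apply continuous_cos_comp. eapply is_derive_cont. apply Hd; [lia | auto].
    + intros; apply Rabs_cos_le.
    + intros p q Hp Hpq Hq Hside.
      apply (van_der_corput_1 _ (phi 1%nat) (phi 2%nat)); try lra.
      * intros; apply Hd; [lia | lra].
      * intros; apply Hd; [lia | lra].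
      * intros; apply Hc; lra.
      * intros x Hx. specialize (Hl x ltac:(lra)).
        nra.
      * intros x Hx.
        assert (Ee : eta * (/ eta ^ 2 * eta) = 1) by (field; lra).
        assert (Hi : 0 < / eta ^ 2) by (apply Rinv_0_lt_compat, pow_lt, He).
        destruct Hside as [Hs|Hs].
        -- specialize (Hle x ltac:(lra)).
           rewrite Rabs_left1 by nra. nra.
        -- specialize (Hr x ltac:(lra)).
           rewrite Rabs_right by nra. nra.
  - destruct (linear_growth_center (phi (k + 2)%nat) (phi (S k + 2)%nat) a b (/ eta ^ (S k + 2)))
      as [c [Hcab [Hr Hle]]]; [exact Hab | left | | |].
    { apply Rinv_0_lt_compat, pow_lt, He. }
    { intros x Hx. apply Hd; [lia | auto]. }
    { intros x Hx. specialize (Hl x Hx).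
      apply (Rmult_le_reg_l (eta ^ (S k + 2))); [apply pow_lt, He|].
      rewrite Rinv_r; [lra | apply pow_nonzero; lra]. }
    assert (Hi : 0 < / eta ^ (S k + 2)) by (apply Rinv_0_lt_compat, pow_lt, He).
    assert (Ee : eta ^ (k + 2) * (/ eta ^ (S k + 2) * eta) = 1).
    { simpl. field. split; [apply pow_nonzero|]; lra. }
    assert (Hpk : 0 < eta ^ (k + 2)) by now apply pow_lt.
    replace (vdc_const (S k) * eta) with (2 * (vdc_const k * eta) + 2 * eta) by (simpl; ring).
    pose proof (vdc_const_pos k) as HC.
    apply (Rabs_RInt_split_center _ a b c); try lra.
    + nra.
    + intros x Hx. apply continuous_cos_comp. eapply is_derive_cont. apply Hd; [lia | auto].
    + intros; apply Rabs_cos_le.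
    + intros p q Hp Hpq Hq [Hs|Hs].
      (* Left of [c] the derivative of order [k + 2] is negative. Cosine is even, so the induction
         hypothesis can be applied to [- phi]. *)
      * replace (RInt (fun x => cos (phi O x)) p q)
          with (RInt (fun x => cos (- phi O x)) p q)
          by (apply RInt_ext; intros; apply cos_neg).
        apply (IH (fun i x => - phi i x)); auto.
        -- intros i x Hi' Hx. apply (is_derive_opp (phi i)). apply Hd; [lia | lra].
        -- intros x Hx. apply (continuous_opp (phi (k + 2)%nat)).
           eapply is_derive_cont. apply Hd; [lia | lra].
        -- intros x Hx. specialize (Hle x ltac:(lra)).
           assert (/ eta ^ (S k + 2) * eta <= / eta ^ (S k + 2) * (c - x))
             by (apply Rmult_le_compat_l; lra).
           nra.
      * apply IH; auto.
        -- intros i x Hi' Hx. apply Hd; [lia | lra].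
        -- intros x Hx. eapply is_derive_cont. apply Hd; [lia | lra].
        -- intros x Hx. specialize (Hr x ltac:(lra)).
           assert (/ eta ^ (S k + 2) * eta <= / eta ^ (S k + 2) * (x - c))
             by (apply Rmult_le_compat_l; lra).
           nra.
Qed.

(** * Iterated integrals *)

(** Precomposition with this retraction extends a function continuous on a rectangle to the whole
    plane, so that parameter integrals and Fubini are proved once, for globally continuous
    functions. *)
Definition clamp (a b x : R) : R := Rmax a (Rmin b x).

Lemma clamp_id (a b x : R) : a <= x <= b -> clamp a b x = x.
Proof. intros H. unfold clamp. rewrite Rmin_right, Rmax_right; lra. Qed.

Lemma clamp_range (a b x : R) : a <= b -> a <= clamp a b x <= b.
Proof.
  intros H. unfold clamp. split; [apply Rmax_l|].
  apply Rmax_lub; [lra | apply Rmin_l].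
Qed.

Lemma clamp_lipschitz (a b x y : R) : Rabs (clamp a b x - clamp a b y) <= Rabs (x - y).
Proof.
  unfold clamp, Rmax, Rmin, Rabs.
  repeat (destruct Rle_dec || destruct Rcase_abs); lra.
Qed.

Lemma continuous_clamp (f : R -> R) (a b x : R) : a <= b ->
  (forall y, a <= y <= b -> continuous f y) ->
  continuous (fun y => f (clamp a b y)) x.
Proof.
  intros Hab Hf. apply (continuous_comp (clamp a b) f).
  - apply continuity_pt_filterlim. intros eps Heps. exists eps. split; [auto|].
    intros y [_ Hy]. eapply Rle_lt_trans; [apply clamp_lipschitz | exact Hy].
  - apply Hf, clamp_range, Hab.
Qed.

Lemma continuity_2d_pt_clamp (f : R -> R -> R) (a b c d x y : R) :
  a <= b -> c <= d ->
  (forall u v, a <= u <= b -> c <= v <= d -> continuity_2d_pt f u v) ->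
  continuity_2d_pt (fun u v => f (clamp a b u) (clamp c d v)) x y.
Proof.
  intros Hab Hcd Hf eps.
  destruct (Hf _ _ (clamp_range a b x Hab) (clamp_range c d y Hcd) eps) as [del Hdel].
  exists del. intros u v Hu Hv. apply Hdel.
  - eapply Rle_lt_trans; [apply clamp_lipschitz | exact Hu].
  - eapply Rle_lt_trans; [apply clamp_lipschitz | exact Hv].
Qed.

Lemma continuity_2d_pt_slice1 (f : R -> R -> R) (x y : R) :
  continuity_2d_pt f x y -> continuous (fun u => f u y) x.
Proof.
  intros H. apply continuity_pt_filterlim. intros eps Heps.
  destruct (H (mkposreal eps Heps)) as [del Hdel]. exists del. split; [apply cond_pos|].
  intros u [_ Hu]. apply Hdel; [exact Hu|].
  rewrite Rminus_diag, Rabs_R0. apply cond_pos.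
Qed.

Lemma continuity_2d_pt_slice2 (f : R -> R -> R) (x y : R) :
  continuity_2d_pt f x y -> continuous (fun v => f x v) y.
Proof.
  intros H. apply continuity_pt_filterlim. intros eps Heps.
  destruct (H (mkposreal eps Heps)) as [del Hdel]. exists del. split; [apply cond_pos|].
  intros u [_ Hu]. apply Hdel; [|exact Hu].
  rewrite Rminus_diag, Rabs_R0. apply cond_pos.
Qed.

Lemma continuity_2d_pt_swap (f : R -> R -> R) (x y : R) :
  continuity_2d_pt f x y -> continuity_2d_pt (fun u v => f v u) y x.
Proof. intros H eps. destruct (H eps) as [del Hdel]. exists del. intros; now apply Hdel. Qed.

(** Uniform continuity along the compact segment above [x0] makes the integrands uniformly close for
    [x] near [x0]. *)
Lemma continuous_RInt_param (f : R -> R -> R) (a b x0 : R) :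
  (forall x y, continuity_2d_pt f x y) ->
  continuous (fun x => RInt (fun y => f x y) a b) x0.
Proof.
  intros Hf. apply continuity_pt_filterlim. intros eps Heps.
  set (L := Rabs (b - a) + 1).
  assert (HL : 0 < L) by (unfold L; pose proof (Rabs_pos (b - a)); lra).
  assert (He2 : 0 < eps / L) by (apply Rdiv_lt_0_compat; lra).
  destruct (uniform_continuity_2d_1d' f (Rmin a b) (Rmax a b) x0
    (fun y _ => Hf x0 y) (mkposreal _ He2)) as [del Hdel].
  exists del. split; [apply cond_pos|].
  intros x [_ Hx]. simpl in Hx. unfold Rdist in Hx. simpl. unfold Rdist.
  assert (Hex : forall z, ex_RInt (fun y => f z y) a b).
  { intros z. apply ex_RInt_all. intros y. now apply (continuity_2d_pt_slice2 f z y). }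
  rewrite <- RInt_Rminus by auto.
  eapply Rle_lt_trans.
  - apply (norm_RInt_le_const_abs (V := R_NormedModule) (fun y => f x y - f x0 y) a b _ (eps / L)).
    2: { apply (RInt_correct (V := R_CompleteNormedModule)).
         apply (ex_RInt_minus (V := R_CompleteNormedModule)); auto. }
    intros y Hy. left.
    apply Rabs_def2 in Hx. simpl in Hy.
    apply (Hdel y x0 y x); try exact Hy; try lra.
    rewrite Rminus_diag, Rabs_R0. apply cond_pos.
  - assert (E : eps / L * L = eps) by (field; lra).
    unfold L at 2 in E. simpl in E. lra.
Qed.

(** The fundamental theorem of calculus in the upper limit [X]: differentiating the integral of
    [F X y] over [y] under the integral sign returns the inner integral of [f X y], and [F a]
    vanishes. *)
Lemma Fubini_global (f : R -> R -> R) (a b c d : R) :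
  a <= b -> c <= d -> (forall x y, continuity_2d_pt f x y) ->
  RInt (fun x => RInt (fun y => f x y) c d) a b
  = RInt (fun y => RInt (fun x => f x y) a b) c d.
Proof.
  intros Hab Hcd Hf.
  set (F := fun X y => RInt (fun x => f x y) a X).
  assert (HF : forall X y, is_derive (fun X => F X y) X (f X y)).
  { intros X y. unfold F.
    apply (is_derive_RInt (V := R_CompleteNormedModule) (fun x => f x y) _ a).
    - apply filter_forall. intros z.
      apply (RInt_correct (V := R_CompleteNormedModule)).
      apply ex_RInt_all.
      intros u. now apply (continuity_2d_pt_slice1 f u y).
    - now apply (continuity_2d_pt_slice1 f X y). }
  assert (HFy : forall X y, continuous (F X) y).
  { intros X y. apply (continuous_RInt_param (fun y x => f x y)).
    intros u v. apply (continuity_2d_pt_swap f), Hf. }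
  rewrite (RInt_derive_cont (fun X => RInt (fun y => F X y) c d)); auto.
  - assert (E : RInt (fun y => F a y) c d = 0).
    { unfold F. rewrite (RInt_ext _ (fun _ => 0)).
      - apply RInt_zero.
      - intros y _. apply (RInt_point (V := R_CompleteNormedModule)). }
    rewrite E. apply Rminus_0_r.
  - intros X _.
    replace (RInt (fun y => f X y) c d)
      with (RInt (fun y => Derive (fun u => F u y) X) c d)
      by (apply RInt_ext; intros y _; apply is_derive_unique, HF).
    apply is_derive_RInt_param.
    + apply filter_forall. intros z y _. eexists; apply HF.
    + intros y _. apply (continuity_2d_pt_ext f).
      * intros u v. symmetry. apply is_derive_unique, HF.
      * apply Hf.
    + apply filter_forall. intros z.
      apply ex_RInt_all. intros y. apply HFy.
  - intros X _. now apply continuous_RInt_param.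
Qed.

Lemma continuous_RInt_param_rect (f : R -> R -> R) (a b c d x0 : R) :
  a <= b -> c <= d ->
  (forall x y, a <= x <= b -> c <= y <= d -> continuity_2d_pt f x y) ->
  continuous (fun x => RInt (fun y => f (clamp a b x) y) c d) x0.
Proof.
  intros Hab Hcd Hf.
  apply (continuous_ext (fun x => RInt (fun y => f (clamp a b x) (clamp c d y)) c d)).
  - intros x. apply RInt_ext. intros y. rewrite Rmin_left, Rmax_right by lra.
    intros Hy. rewrite (clamp_id c d); [reflexivity|lra].
  - apply (continuous_RInt_param (fun x y => f (clamp a b x) (clamp c d y))).
    intros x y. now apply continuity_2d_pt_clamp.
Qed.

Lemma Fubini (f : R -> R -> R) (a b c d : R) :
  a <= b -> c <= d ->
  (forall x y, a <= x <= b -> c <= y <= d -> continuity_2d_pt f x y) ->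
  RInt (fun x => RInt (fun y => f x y) c d) a b
  = RInt (fun y => RInt (fun x => f x y) a b) c d.
Proof.
  intros Hab Hcd Hf.
  transitivity (RInt (fun x => RInt (fun y => f (clamp a b x) (clamp c d y)) c d) a b).
  { apply RInt_ext. intros x. rewrite Rmin_left, Rmax_right by lra. intros Hx.
    apply RInt_ext. intros y. rewrite Rmin_left, Rmax_right by lra. intros Hy.
    rewrite !clamp_id; auto; lra. }
  rewrite (Fubini_global (fun x y => f (clamp a b x) (clamp c d y)) a b c d Hab Hcd).
  2: { intros; now apply continuity_2d_pt_clamp. }
  apply RInt_ext. intros y. rewrite Rmin_left, Rmax_right by lra. intros Hy.
  apply RInt_ext. intros x. rewrite Rmin_left, Rmax_right by lra. intros Hx.
  rewrite !clamp_id; auto; lra.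
Qed.

Lemma Fubini_bound (f : R -> R -> R) (g : R -> R) (a b c d : R) :
  a <= b -> c <= d ->
  (forall x y, a <= x <= b -> c <= y <= d -> continuity_2d_pt f x y) ->
  (forall x, a <= x <= b -> continuous g x) ->
  (forall x, a <= x <= b -> Rabs (RInt (fun y => f x y) c d) <= g x) ->
  Rabs (RInt (fun y => RInt (fun x => f x y) a b) c d) <= RInt g a b.
Proof.
  intros Hab Hcd Hf Hg H. rewrite <- Fubini by auto.
  rewrite (RInt_ext _ (fun x => RInt (fun y => f (clamp a b x) y) c d)).
  - apply Rabs_RInt_le; auto.
    + intros x _. now apply continuous_RInt_param_rect.
    + intros x Hx. rewrite clamp_id; auto.
  - intros x. rewrite Rmin_left, Rmax_right by lra. intros Hx.
    rewrite clamp_id; [reflexivity | lra].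
Qed.

Lemma ex_RInt_RInt_param (f : R -> R -> R) (a b c d : R) :
  a <= b -> c <= d ->
  (forall x y, a <= x <= b -> c <= y <= d -> continuity_2d_pt f x y) ->
  ex_RInt (fun x => RInt (fun y => f x y) c d) a b.
Proof.
  intros Hab Hcd Hf.
  apply (ex_RInt_ext (fun x => RInt (fun y => f (clamp a b x) y) c d)).
  - intros x. rewrite Rmin_left, Rmax_right by lra. intros Hx.
    rewrite clamp_id; [reflexivity | lra].
  - apply ex_RInt_cont; auto. intros x _. now apply continuous_RInt_param_rect.
Qed.

(** The amplitude is removed by integrating by parts against the primitive [S] of the cosine. Van
    der Corput bounds [S] uniformly because its constant does not depend on the interval. *)
Lemma van_der_corput_amp (k : nat) (phi : nat -> R -> R) (B dB : R -> R) (a b eta M : R) :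
  a <= b -> 0 < eta ->
  (forall i x, (i < k + 2)%nat -> a <= x <= b -> is_derive (phi i) x (phi (S i) x)) ->
  (forall x, a <= x <= b -> continuous (phi (k + 2)%nat) x) ->
  (forall x, a <= x <= b -> 1 <= eta ^ (k + 2) * phi (k + 2)%nat x) \/
  (forall x, a <= x <= b -> 1 <= eta ^ (k + 2) * - phi (k + 2)%nat x) ->
  (forall x, a <= x <= b -> is_derive B x (dB x)) ->
  (forall x, a <= x <= b -> continuous dB x) ->
  (forall x, a <= x <= b -> Rabs (B x) <= M /\ Rabs (dB x) <= M) ->
  Rabs (RInt (fun x => B x * cos (phi O x)) a b) <= vdc_const k * eta * (M * (1 + (b - a))).
Proof.
  intros Hab He Hd Hc Hl HB HdB HM.
  assert (Hphi : forall x, a <= x <= b -> continuous (phi O) x).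
  { intros x Hx. eapply is_derive_cont. apply Hd; [lia | auto]. }
  assert (Hcos : forall x, a <= x <= b -> continuous (fun x => cos (phi O x)) x).
  { intros. now apply continuous_cos_comp, Hphi. }
  (* The clamped integrand makes [S] differentiable on the whole line, endpoints included. *)
  set (S := fun x => RInt (fun y => cos (phi O (clamp a b y))) a x).
  assert (HS : forall x, is_derive S x (cos (phi O (clamp a b x)))).
  { intros x. apply (is_derive_RInt (V := R_CompleteNormedModule)
      (fun y => cos (phi O (clamp a b y))) _ a).
    - apply filter_forall. intros z.
      apply (RInt_correct (V := R_CompleteNormedModule)).
      apply ex_RInt_all. intros y.
      now apply (continuous_clamp (fun y => cos (phi O y))).
    - now apply (continuous_clamp (fun y => cos (phi O y))). }
  assert (HSb : forall x, a <= x <= b -> Rabs (S x) <= vdc_const k * eta).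
  { intros x Hx. unfold S.
    rewrite (RInt_ext _ (fun y => cos (phi O y))).
    2: { intros y. rewrite Rmin_left, Rmax_right by lra. intros Hy.
         rewrite clamp_id; [reflexivity | lra]. }
    destruct Hl as [Hl|Hl].
    - apply van_der_corput; try lra; intros; [apply Hd | apply Hc | apply Hl]; auto; lra.
    - rewrite (RInt_ext _ (fun y => cos (- phi O y))) by (intros; symmetry; apply cos_neg).
      apply (van_der_corput k (fun i x => - phi i x)); try lra.
      + intros. apply (is_derive_opp (phi i)). apply Hd; auto; lra.
      + intros. apply (continuous_opp (phi (k + 2)%nat)). apply Hc; lra.
      + intros. apply Hl; lra. }
  assert (HSc : forall x, continuous S x) by (intros; eapply is_derive_cont, HS).
  assert (E : RInt (fun x => B x * cos (phi O x)) a b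
    = (B b * S b - B a * S a) - RInt (fun x => dB x * S x) a b).
  { rewrite <- (RInt_derive_cont (fun x => B x * S x)
      (fun x => B x * cos (phi O x) + dB x * S x)); auto.
    - rewrite <- RInt_Rminus.
      + apply RInt_ext. intros x _. unfold minus, plus, opp; simpl. ring.
      + apply ex_RInt_cont; auto. intros x Hx.
        apply (continuous_plus (fun x => B x * cos (phi O x))).
        * apply (continuous_mult B); [eapply is_derive_cont; eauto | auto].
        * apply (continuous_mult dB); auto.
      + apply ex_RInt_cont; auto. intros x Hx. apply (continuous_mult dB); auto.
    - intros x Hx.
      replace (B x * cos (phi O x) + dB x * S x)
        with (plus (mult (dB x) (S x)) (mult (B x) (cos (phi O (clamp a b x))))).
      + apply (is_derive_mult B S); auto. intros; apply Rmult_comm.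
      + rewrite clamp_id by auto. unfold plus, mult; simpl. ring.
    - intros x Hx.
      apply (continuous_plus (fun x => B x * cos (phi O x))).
      + apply (continuous_mult B); [eapply is_derive_cont; eauto | auto].
      + apply (continuous_mult dB); auto. }
  assert (E0 : S a = 0) by apply (RInt_point (V := R_CompleteNormedModule)).
  rewrite E, E0.
  assert (H1 : Rabs (B b * S b) <= M * (vdc_const k * eta)).
  { rewrite Rabs_mult. apply Rmult_le_compat; try apply Rabs_pos.
    - apply HM; lra. - apply HSb; lra. }
  assert (H2 : Rabs (RInt (fun x => dB x * S x) a b) <= (b - a) * (M * (vdc_const k * eta))).
  { apply Rabs_RInt_le_const; auto.
    - intros. apply (continuous_mult dB); auto.
    - intros x Hx. rewrite Rabs_mult. apply Rmult_le_compat; try apply Rabs_pos.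
      + apply HM; lra. + apply HSb; lra. }
  apply Rabs_le_between in H1, H2. apply Rabs_le. nra.
Qed.

(** * Smooth functions of two variables and the implicit function theorem *)

Definition open_2d (Omega : R -> R -> Prop) : Prop :=
  forall u v, Omega u v -> locally_2d Omega u v.

Definition box (u0 v0 r u v : R) : Prop := Rabs (u - u0) < r /\ Rabs (v - v0) < r.

Lemma open_box u0 v0 r : open_2d (box u0 v0 r).
Proof.
  intros u v [Hu Hv].
  assert (Hd : 0 < Rmin (r - Rabs (u - u0)) (r - Rabs (v - v0))) by (apply Rmin_glb_lt; lra).
  exists (mkposreal _ Hd). simpl. intros x y Hx Hy.
  pose proof (Rmin_l (r - Rabs (u - u0)) (r - Rabs (v - v0))).
  pose proof (Rmin_r (r - Rabs (u - u0)) (r - Rabs (v - v0))).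
  split.
  - replace (x - u0) with ((x - u) + (u - u0)) by ring.
    eapply Rle_lt_trans; [apply Rabs_triang|]. lra.
  - replace (y - v0) with ((y - v) + (v - v0)) by ring.
    eapply Rle_lt_trans; [apply Rabs_triang|]. lra.
Qed.

Definition C1_partials (Omega : R -> R -> Prop) (Q Qu Qv : R -> R -> R) : Prop :=
  forall u v, Omega u v ->
    is_derive (fun x => Q x v) u (Qu u v) /\
    is_derive (fun y => Q u y) v (Qv u v) /\
    continuity_2d_pt Qu u v /\ continuity_2d_pt Qv u v.

(** Partial derivatives are carried as witnesses rather than computed by [Derive], so closure under
    sums, products and inverses follows by induction on [n] from the Leibniz rules. *)
Fixpoint Cn (n : nat) (Omega : R -> R -> Prop) (Q : R -> R -> R) : Prop :=
  (forall u v, Omega u v -> continuity_2d_pt Q u v) /\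
  match n with
  | O => True
  | S m => exists Qu Qv, C1_partials Omega Q Qu Qv /\ Cn m Omega Qu /\ Cn m Omega Qv
  end.

Lemma Cn_cont n Omega Q u v : Cn n Omega Q -> Omega u v -> continuity_2d_pt Q u v.
Proof. destruct n; intros [H _]; apply H. Qed.

Lemma Cn_S n Omega Q : Cn (S n) Omega Q -> Cn n Omega Q.
Proof.
  revert Q. induction n as [|n IH]; intros Q [Hc [Qu [Qv [HQ [H1 H2]]]]].
  - now split.
  - split; [exact Hc|]. exists Qu, Qv. auto.
Qed.

Lemma Cn_le n m Omega Q : (n <= m)%nat -> Cn m Omega Q -> Cn n Omega Q.
Proof. intros H. induction H; auto. intros HQ. now apply IHle, Cn_S. Qed.

Lemma Cn_ext n Omega Q Q' : (forall u v, Q u v = Q' u v) -> Cn n Omega Q -> Cn n Omega Q'.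
Proof.
  intros E. destruct n; intros [Hc H]; split; auto.
  1, 2: intros u v Huv; apply (continuity_2d_pt_ext Q); auto.
  destruct H as [Qu [Qv [HQ H]]]. exists Qu, Qv. split; auto.
  intros u v Huv. destruct (HQ u v Huv) as (H1 & H2 & H3).
  split; [|split; [|exact H3]].
  - apply (is_derive_ext (fun x => Q x v)); auto.
  - apply (is_derive_ext (fun y => Q u y)); auto.
Qed.

Lemma Cn_const n Omega c : Cn n Omega (fun _ _ => c).
Proof.
  revert c. induction n as [|n IH]; intros c; split; auto;
    try (intros; apply continuity_2d_pt_const).
  exists (fun _ _ => 0), (fun _ _ => 0). split; auto.
  intros u v _. split; [|split; [|split]]; try apply continuity_2d_pt_const;
    apply is_derive_cst.
Qed.

Lemma Cn_plus n Omega Q T :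
  Cn n Omega Q -> Cn n Omega T -> Cn n Omega (fun u v => Q u v + T u v).
Proof.
  revert Q T. induction n as [|n IH]; intros Q T [HQc HQ] [HTc HT]; split; auto;
    try (intros; apply continuity_2d_pt_plus; auto).
  destruct HQ as (Qu & Qv & HQ & HQu & HQv). destruct HT as (Tu & Tv & HT & HTu & HTv).
  exists (fun u v => Qu u v + Tu u v), (fun u v => Qv u v + Tv u v). split; [|auto].
  intros u v Huv. destruct (HQ u v Huv) as (H1 & H2 & H3 & H4).
  destruct (HT u v Huv) as (H5 & H6 & H7 & H8).
  split; [|split; [|split]]; try (apply continuity_2d_pt_plus; assumption).
  - apply (is_derive_Rplus (fun x => Q x v)); auto.
  - apply (is_derive_Rplus (fun y => Q u y)); auto.
Qed.

Lemma Cn_mult n Omega Q T :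
  Cn n Omega Q -> Cn n Omega T -> Cn n Omega (fun u v => Q u v * T u v).
Proof.
  revert Q T. induction n as [|n IH]; intros Q T HQ0 HT0;
    pose proof HQ0 as [HQc HQ]; pose proof HT0 as [HTc HT]; split; auto;
    try (intros; apply continuity_2d_pt_mult; auto).
  destruct HQ as (Qu & Qv & HQ & HQu & HQv). destruct HT as (Tu & Tv & HT & HTu & HTv).
  apply Cn_S in HQ0, HT0.
  exists (fun u v => Qu u v * T u v + Q u v * Tu u v),
    (fun u v => Qv u v * T u v + Q u v * Tv u v).
  split; [|split; apply Cn_plus; apply IH; auto].
  intros u v Huv. destruct (HQ u v Huv) as (H1 & H2 & H3 & H4).
  destruct (HT u v Huv) as (H5 & H6 & H7 & H8).
  split; [|split; [|split]];
    try (apply continuity_2d_pt_plus; apply continuity_2d_pt_mult; auto).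
  - apply (is_derive_Rmult (fun x => Q x v) (fun x => T x v)); auto.
  - apply (is_derive_Rmult (fun y => Q u y) (fun y => T u y)); auto.
Qed.

Lemma Cn_opp n Omega Q : Cn n Omega Q -> Cn n Omega (fun u v => - Q u v).
Proof.
  intros H. apply (Cn_ext n Omega (fun u v => -1 * Q u v)); [intros; ring|].
  apply (Cn_mult n Omega (fun _ _ => -1)); auto. apply Cn_const.
Qed.

Lemma Cn_inv n Omega Q :
  (forall u v, Omega u v -> Q u v <> 0) -> Cn n Omega Q -> Cn n Omega (fun u v => / Q u v).
Proof.
  intros Hnz. induction n as [|n IH]; intros HQ0;
    pose proof HQ0 as [HQc HQ]; split; auto;
    try (intros; apply continuity_2d_pt_inv; auto).
  destruct HQ as (Qu & Qv & HQ & HQu & HQv). apply Cn_S, IH in HQ0.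
  exists (fun u v => - (Qu u v * (/ Q u v * / Q u v))),
    (fun u v => - (Qv u v * (/ Q u v * / Q u v))).
  split; [|split; apply Cn_opp; repeat apply Cn_mult; auto].
  intros u v Huv. destruct (HQ u v Huv) as (H1 & H2 & H3 & H4).
  specialize (Hnz u v Huv).
  assert (E : forall y, - (y * (/ Q u v * / Q u v)) = - y / Q u v ^ 2) by (intros; field; auto).
  split; [|split; [|split]];
    try (apply continuity_2d_pt_opp; repeat apply continuity_2d_pt_mult; auto;
         apply continuity_2d_pt_inv; auto).
  - rewrite E. apply (is_derive_inv (fun x => Q x v)); auto.
  - rewrite E. apply (is_derive_inv (fun y => Q u y)); auto.
Qed.

Lemma continuity_2d_pt_comp1 (f : R -> R) (g : R -> R -> R) (x y : R) :
  continuous f (g x y) -> continuity_2d_pt g x y ->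
  continuity_2d_pt (fun u v => f (g u v)) x y.
Proof. intros Hf. apply continuity_1d_2d_pt_comp, continuity_pt_filterlim, Hf. Qed.

(** Differentiation shifts the phase by [PI / 2] up to a constant factor, so the induction stays
    inside this family once [c] is general. *)
Lemma Cn_cos n Omega a b c : Cn n Omega (fun u v => cos (a * u + b * v + c)).
Proof.
  revert c. induction n as [|n IH]; intros c; split; auto;
  try (intros u v _; apply (continuity_2d_pt_comp1 cos); [apply continuous_cos|];
    repeat apply continuity_2d_pt_plus; try apply continuity_2d_pt_const;
    apply continuity_2d_pt_mult; try apply continuity_2d_pt_const;
    [apply continuity_2d_pt_id1 | apply continuity_2d_pt_id2]).
  assert (E : forall u v, cos (a * u + b * v + (c + PI / 2)) = - sin (a * u + b * v + c)).
  { intros u v. rewrite <- Rplus_assoc, cos_plus, cos_PI2, sin_PI2. ring. }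
  exists (fun u v => a * cos (a * u + b * v + (c + PI / 2))),
    (fun u v => b * cos (a * u + b * v + (c + PI / 2))).
  split; [|split; apply Cn_mult; auto; apply Cn_const].
  intros u v Huv. rewrite E. split; [|split; [|split]];
    try (apply continuity_2d_pt_mult; [apply continuity_2d_pt_const|];
         apply (Cn_cont n Omega); auto);
    auto_derive; auto; unfold Rsqr; ring.
Qed.

Lemma C1_partials_differentiable Omega Q Qu Qv u v :
  open_2d Omega -> C1_partials Omega Q Qu Qv -> Omega u v ->
  differentiable_pt_lim Q u v (Qu u v) (Qv u v).
Proof.
  intros Ho HQ Huv. apply filterdiff_differentiable_pt_lim.
  apply (is_derive_filterdiff Q u v Qu (Qv u v)).
  - apply (locally_2d_locally (fun x y => is_derive (fun z => Q z y) x (Qu x y))).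
    destruct (Ho u v Huv) as [del Hdel]. exists del. intros x y Hx Hy. now apply HQ, Hdel.
  - now apply HQ.
  - apply continuity_2d_pt_filterlim, HQ, Huv.
Qed.

(** [Q'] is [L Q] for the operator [L] of the overview. It is a relation because the values of [Q']
    are determined only on [Omega]. *)
Definition flow_derivative (Omega : R -> R -> Prop) (B Q Q' : R -> R -> R) : Prop :=
  exists Qu Qv, C1_partials Omega Q Qu Qv /\
    forall u v, Omega u v -> Q' u v = Qv u v - B u v * Qu u v.

Lemma Cn_flow_derivative n Omega B Q :
  Cn n Omega B -> Cn (S n) Omega Q ->
  exists Q', flow_derivative Omega B Q Q' /\ Cn n Omega Q'.
Proof.
  intros HB [_ [Qu [Qv [HQ [HQu HQv]]]]].
  exists (fun u v => Qv u v + - (B u v * Qu u v)). split.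
  - exists Qu, Qv. split; [exact HQ|]. intros; ring.
  - apply Cn_plus; [auto|]. apply Cn_opp, Cn_mult; auto.
Qed.

(** By the chain rule, [L] is ordinary differentiation in [v] along the integral curves of
    [(-B, 1)]. On these curves the one-variable van der Corput lemma will be applied. *)
Lemma flow_derivative_along Omega B Q Q' (gam : R -> R) v :
  open_2d Omega -> flow_derivative Omega B Q Q' -> Omega (gam v) v ->
  is_derive gam v (- B (gam v) v) ->
  is_derive (fun y => Q (gam y) y) v (Q' (gam v) v).
Proof.
  intros Ho [Qu [Qv [HQ E]]] Hom Hg. rewrite E by auto.
  apply is_derive_Reals.
  replace (Qv (gam v) v - B (gam v) v * Qu (gam v) v)
    with (Qu (gam v) v * - B (gam v) v + Qv (gam v) v * 1) by ring.
  apply (derivable_pt_lim_comp_2d Q gam (fun y => y)).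
  - now apply (C1_partials_differentiable Omega).
  - now apply is_derive_Reals.
  - apply derivable_pt_lim_id.
Qed.

Lemma box_segment u0 v0 r u u' v x :
  box u0 v0 r u v -> box u0 v0 r u' v -> Rmin u u' <= x <= Rmax u u' -> box u0 v0 r x v.
Proof.
  intros [H1 H2] [H3 _] Hx. split; [|exact H2].
  apply Rabs_def2 in H1, H3. apply Rabs_def1;
  unfold Rmin, Rmax in Hx; destruct Rle_dec; lra.
Qed.

Lemma box_segment2 u0 v0 r u v v' y :
  box u0 v0 r u v -> box u0 v0 r u v' -> Rmin v v' <= y <= Rmax v v' -> box u0 v0 r u y.
Proof.
  intros [H1 H2] [_ H3] Hx. split; [exact H1|].
  apply Rabs_def2 in H2, H3. apply Rabs_def1;
  unfold Rmin, Rmax in Hx; destruct Rle_dec; lra.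
Qed.

Lemma MVT_box1 u0 v0 r h k l u u' v :
  C1_partials (box u0 v0 r) h k l -> box u0 v0 r u v -> box u0 v0 r u' v ->
  exists x, Rmin u u' <= x <= Rmax u u' /\ h u' v - h u v = k x v * (u' - u).
Proof.
  intros HC H1 H2. apply (MVT_gen (fun x => h x v) u u' (fun x => k x v)).
  - intros x Hx. apply HC. apply (box_segment u0 v0 r u u'); auto. simpl in Hx. lra.
  - intros x Hx. apply continuity_pt_filterlim, (is_derive_cont (fun x => h x v) x (k x v)), HC.
    now apply (box_segment u0 v0 r u u').
Qed.

Lemma MVT_box2 u0 v0 r h k l u v v' :
  C1_partials (box u0 v0 r) h k l -> box u0 v0 r u v -> box u0 v0 r u v' ->
  exists y, Rmin v v' <= y <= Rmax v v' /\ h u v' - h u v = l u y * (v' - v).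
Proof.
  intros HC H1 H2. apply (MVT_gen (fun y => h u y) v v' (fun y => l u y)).
  - intros x Hx. apply HC. apply (box_segment2 u0 v0 r u v v'); auto. simpl in Hx. lra.
  - intros x Hx. apply continuity_pt_filterlim, (is_derive_cont (fun y => h u y) x (l u x)), HC.
    now apply (box_segment2 u0 v0 r u v v').
Qed.

Lemma Rabs_segment a b x c e :
  Rmin a b <= x <= Rmax a b -> Rabs (a - c) < e -> Rabs (b - c) < e -> Rabs (x - c) < e.
Proof.
  intros Hx Ha Hb. apply Rabs_def2 in Ha, Hb. apply Rabs_def1;
  unfold Rmin, Rmax in Hx; destruct Rle_dec; lra.
Qed.

(** A quantitative implicit function theorem solving [h u v = s] for [u]. The bound [m <= k] makes
    [h] strictly increasing in [u]: the intermediate value theorem gives existence, [Hinj]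
    uniqueness, and the mean value theorem in each variable the differential of [g]. *)
Lemma implicit_inverse (h k l : R -> R -> R) (u0 v0 r m K : R) :
  0 < r -> 0 < m ->
  C1_partials (box u0 v0 r) h k l ->
  (forall u v, box u0 v0 r u v -> m <= k u v) ->
  (forall u v, box u0 v0 r u v -> Rabs (l u v) <= K) ->
  exists sig g, 0 < sig /\
    (forall s v, Rabs (s - h u0 v0) < sig -> Rabs (v - v0) < sig ->
       box u0 v0 r (g s v) v /\ h (g s v) v = s /\
       differentiable_pt_lim g s v (/ k (g s v) v) (- (l (g s v) v / k (g s v) v))) /\
    (forall u v, box u0 v0 r u v -> Rabs (h u v - h u0 v0) < sig -> Rabs (v - v0) < sig ->
       g (h u v) v = u).
Proof.
  intros Hr Hm HC Hk Hl.
  set (s0 := h u0 v0).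
  assert (H00 : box u0 v0 r u0 v0) by (split; rewrite Rminus_diag, Rabs_R0; lra).
  assert (HK : 0 <= K) by (specialize (Hl _ _ H00); pose proof (Rabs_pos (l u0 v0)); lra).
  (* A change of [v] and of [s] by less than [sig] costs at most [(K + 1) * sig <= m * r / 4], less
     than the rise [m * r / 2] of [h] over half a box in [u]. *)
  set (sig := Rmin (r / 2) (m * r / (4 * (K + 1)))).
  assert (Hsig0 : 0 < sig).
  { unfold sig. apply Rmin_glb_lt; [lra|]. apply Rdiv_lt_0_compat; nra. }
  assert (Hsig1 : sig <= r / 2) by apply Rmin_l.
  assert (Hsig2 : (K + 1) * sig <= m * r / 4).
  { assert (sig <= m * r / (4 * (K + 1))) by apply Rmin_r.
    replace (m * r / 4) with ((K + 1) * (m * r / (4 * (K + 1)))) by (field; lra).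
    apply Rmult_le_compat_l; lra. }
  assert (Hinj : forall u u' v, box u0 v0 r u v -> box u0 v0 r u' v ->
     m * Rabs (u' - u) <= Rabs (h u' v - h u v)).
  { intros u u' v H1 H2. destruct (MVT_box1 u0 v0 r h k l u u' v HC H1 H2) as [x [Hx E]].
    rewrite E, Rabs_mult.
    assert (Hkx := Hk x v (box_segment _ _ _ _ _ _ _ H1 H2 Hx)).
    rewrite (Rabs_right (k x v)) by lra.
    apply Rmult_le_compat_r; [apply Rabs_pos | exact Hkx]. }
  assert (Hlip : forall u v v', box u0 v0 r u v -> box u0 v0 r u v' ->
     Rabs (h u v' - h u v) <= K * Rabs (v' - v)).
  { intros u v v' H1 H2. destruct (MVT_box2 u0 v0 r h k l u v v' HC H1 H2) as [y [Hy E]].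
    rewrite E, Rabs_mult. apply Rmult_le_compat_r; [apply Rabs_pos|].
    apply Hl. now apply (box_segment2 u0 v0 r u v v'). }
  assert (Hex : forall s v, Rabs (s - s0) < sig -> Rabs (v - v0) < sig ->
     exists u, box u0 v0 r u v /\ h u v = s).
  { intros s v Hs Hv.
    assert (Hb : forall u, u0 - r / 2 <= u <= u0 + r / 2 -> box u0 v0 r u v).
    { intros u Hu. split; [apply Rabs_def1; lra|]. lra. }
    assert (Hv0 := Hlip u0 v0 v H00 (Hb u0 ltac:(lra))). fold s0 in Hv0.
    pose proof (slope_lower_bound (fun u => h u v) (fun u => k u v)
      (u0 - r / 2) (u0 + r / 2) m
      (fun x Hx => proj1 (HC x v (Hb x Hx))) (fun x Hx => Hk x v (Hb x Hx))) as Hsl.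
    assert (H1 := Hsl (u0 - r / 2) u0 ltac:(lra) ltac:(lra) ltac:(lra)).
    assert (H2 := Hsl u0 (u0 + r / 2) ltac:(lra) ltac:(lra) ltac:(lra)).
    apply Rabs_def2 in Hs. apply Rabs_le_between in Hv0. simpl in H1, H2.
    destruct (IVT_gen (fun u => h (clamp (u0 - r / 2) (u0 + r / 2) u) v)
      (u0 - r / 2) (u0 + r / 2) s) as [u [Hu E]].
    - intros u. apply continuity_pt_filterlim.
      apply (continuous_clamp (fun u => h u v)); [lra|].
      intros y Hy. apply (is_derive_cont (fun x => h x v) y (k y v)), HC, Hb, Hy.
    - rewrite !clamp_id by lra. rewrite Rmin_left, Rmax_right by nra. nra.
    - rewrite Rmin_left, Rmax_right in Hu by lra.
      rewrite clamp_id in E by lra. exists u. split; auto. }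
  (* A choice among the solutions; by [Hinj] there is only one as long as [s] and [v] stay within
     [sig] of the base values. *)
  set (g := fun s v => epsilon (inhabits 0) (fun u => box u0 v0 r u v /\ h u v = s)).
  assert (Hg : forall s v, Rabs (s - s0) < sig -> Rabs (v - v0) < sig ->
     box u0 v0 r (g s v) v /\ h (g s v) v = s).
  { intros s v Hs Hv. unfold g. apply epsilon_spec. now apply Hex. }
  exists sig, g. split; [auto|]. split.
  2: { intros u v Hb Hs Hv. destruct (Hg (h u v) v Hs Hv) as [H1 H2].
    pose proof (Hinj u (g (h u v) v) v Hb H1) as H3.
    rewrite H2, Rminus_diag, Rabs_R0 in H3.
    pose proof (Rabs_pos (g (h u v) v - u)).
    assert (Rabs (g (h u v) v - u) = 0) by nra.
    apply Rminus_diag_uniq. now apply Rabs_eq_0. }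
  intros s v Hs Hv. destruct (Hg s v Hs Hv) as [Hgb Hgs].
  split; [auto|]. split; [auto|].
  destruct (HC _ _ Hgb) as (_ & _ & Hkc & Hlc).
  set (k0 := k (g s v) v) in *. set (l0 := l (g s v) v) in *.
  assert (Hk0 : m <= k0) by (apply Hk, Hgb).
  assert (Hkinv : continuity_2d_pt (fun x y => / k x y) (g s v) v).
  { apply continuity_2d_pt_inv; auto. fold k0. lra. }
  intros eps.
  (* The three summands are the factors by which the oscillations of [/ k] and [l], each below [e],
     enter the remainder in [E4]. *)
  set (e := eps / (1 + K + / m)).
  assert (Hmi : 0 < / m) by now apply Rinv_0_lt_compat.
  assert (He : 0 < e) by (apply Rdiv_lt_0_compat; [apply cond_pos | lra]).
  destruct (Hkinv (mkposreal e He)) as [d1 Hd1]. destruct (Hlc (mkposreal e He)) as [d2 Hd2].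
  simpl in Hd1, Hd2.
  set (d := Rmin d1 d2).
  assert (Hd : 0 < d) by (apply Rmin_glb_lt; apply cond_pos).
  assert (Hdd1 : d <= d1) by apply Rmin_l. assert (Hdd2 : d <= d2) by apply Rmin_r.
  clearbody d.
  (* Besides keeping the perturbed point in range, the last entry forces [u'] to stay within [d] of
     [u], which is where the continuity of [/ k] and [l] is used. *)
  set (del := Rmin (Rmin (sig - Rabs (s - s0)) (sig - Rabs (v - v0))) (Rmin d (m * d / (2 * (K + 1))))).
  assert (Hdel : 0 < del).
  { unfold del. repeat apply Rmin_glb_lt; try lra. apply Rdiv_lt_0_compat; nra. }
  assert (Hde1 : del <= sig - Rabs (s - s0)) by (unfold del; eapply Rle_trans; [apply Rmin_l|apply Rmin_l]).
  assert (Hde2 : del <= sig - Rabs (v - v0)) by (unfold del; eapply Rle_trans; [apply Rmin_l|apply Rmin_r]).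
  assert (Hde3 : del <= d) by (unfold del; eapply Rle_trans; [apply Rmin_r|apply Rmin_l]).
  assert (Hde4 : (K + 1) * del <= m * d / 2).
  { assert (del <= m * d / (2 * (K + 1))) by (unfold del; eapply Rle_trans; [apply Rmin_r|apply Rmin_r]).
    replace (m * d / 2) with ((K + 1) * (m * d / (2 * (K + 1)))) by (field; lra).
    apply Rmult_le_compat_l; lra. }
  exists (mkposreal del Hdel). simpl. intros s' v' Hs' Hv'.
  assert (Hs1 : Rabs (s' - s0) < sig).
  { replace (s' - s0) with ((s' - s) + (s - s0)) by ring.
    eapply Rle_lt_trans; [apply Rabs_triang|]. lra. }
  assert (Hv1 : Rabs (v' - v0) < sig).
  { replace (v' - v0) with ((v' - v) + (v - v0)) by ring.
    eapply Rle_lt_trans; [apply Rabs_triang|]. lra. }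
  destruct (Hg s' v' Hs1 Hv1) as [Hgb' Hgs'].
  set (u := g s v) in *. set (u' := g s' v') in *.
  assert (Hbm : box u0 v0 r u' v) by (split; [apply Hgb' | apply Hgb]).
  destruct (MVT_box1 u0 v0 r h k l u u' v HC Hgb Hbm) as [xi [Hxi E1]].
  destruct (MVT_box2 u0 v0 r h k l u' v v' HC Hbm Hgb') as [ze [Hze E2]].
  (* An exact increment formula, from a step in [u] at height [v] followed by a step in [v] at
     abscissa [u']; dividing it by [k1] leaves only differences of coefficients to estimate. *)
  assert (E3 : s' - s = k xi v * (u' - u) + l u' ze * (v' - v)) by lra.
  assert (Hu : Rabs (u' - u) < d).
  { pose proof (Hinj u u' v Hgb Hbm) as I1. pose proof (Hlip u' v v' Hbm Hgb') as I2.
    assert (torus_integral : Rabs (h u' v - h u v) <= Rabs (s' - s) + Rabs (h u' v' - h u' v)).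
    { replace (h u' v - h u v) with ((s' - s) + - (h u' v' - h u' v)) by lra.
      eapply Rle_trans; [apply Rabs_triang|]. rewrite Rabs_Ropp. lra. }
    apply (Rmult_lt_reg_l m); nra. }
  assert (Hz0 : forall w, Rabs (w - w) < d) by (intros; rewrite Rminus_diag, Rabs_R0; lra).
  assert (Hxd : Rabs (xi - u) < d) by (apply (Rabs_segment u u' xi); auto).
  assert (Hzd : Rabs (ze - v) < d) by (apply (Rabs_segment v v' ze); auto; lra).
  assert (J1 := Hd1 xi v ltac:(lra) ltac:(pose proof (Hz0 v); lra)).
  assert (J2 := Hd2 u' ze ltac:(lra) ltac:(lra)).
  fold k0 in J1. fold l0 in J2.
  assert (Hbx : box u0 v0 r xi v) by (now apply (box_segment u0 v0 r u u')).
  assert (Hbz : box u0 v0 r u' ze) by (now apply (box_segment2 u0 v0 r u' v v')).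
  assert (Hkx := Hk _ _ Hbx). assert (Hlz := Hl _ _ Hbz).
  set (k1 := k xi v) in *. set (l1 := l u' ze) in *.
  assert (E4 : u' - u - (/ k0 * (s' - s) + - (l0 / k0) * (v' - v))
     = (/ k1 - / k0) * (s' - s) - (l1 * (/ k1 - / k0) + (l1 - l0) * / k0) * (v' - v)).
  { rewrite E3. field. lra. }
  rewrite E4.
  set (Mx := Rmax (Rabs (s' - s)) (Rabs (v' - v))).
  assert (HM1 : Rabs (s' - s) <= Mx) by apply Rmax_l.
  assert (HM2 : Rabs (v' - v) <= Mx) by apply Rmax_r.
  assert (Hk0i : Rabs (/ k0) <= / m).
  { rewrite Rabs_right; [apply Rinv_le_contravar; lra|].
    apply Rle_ge, Rlt_le, Rinv_0_lt_compat; lra. }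
  assert (B1 : Rabs ((/ k1 - / k0) * (s' - s)) <= e * Mx).
  { rewrite Rabs_mult. apply Rmult_le_compat; try apply Rabs_pos; lra. }
  assert (B2 : Rabs (l1 * (/ k1 - / k0)) <= K * e).
  { rewrite Rabs_mult. apply Rmult_le_compat; try apply Rabs_pos; lra. }
  assert (B3 : Rabs ((l1 - l0) * / k0) <= e * / m).
  { rewrite Rabs_mult. apply Rmult_le_compat; try apply Rabs_pos; lra. }
  assert (B4 : Rabs ((l1 * (/ k1 - / k0) + (l1 - l0) * / k0) * (v' - v)) <= (K * e + e * / m) * Mx).
  { rewrite Rabs_mult. apply Rmult_le_compat; try apply Rabs_pos; auto.
    eapply Rle_trans; [apply Rabs_triang | lra]. }
  assert (Ee : eps * Mx = e * Mx + (K * e + e * / m) * Mx).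
  { assert (E5 : e * (1 + K + / m) = eps).
    { unfold e, Rdiv. rewrite Rmult_assoc, Rinv_l; lra. }
    rewrite <- E5. ring. }
  rewrite Ee. unfold Rminus at 1. eapply Rle_trans; [apply Rabs_triang|].
  rewrite Rabs_Ropp. lra.
Qed.

(** * Oscillatory integrals in straightened coordinates *)

Lemma RInt_lin3 (f g h : R -> R) (al be ga a b : R) :
  a <= b ->
  (forall x, a <= x <= b -> continuous f x) ->
  (forall x, a <= x <= b -> continuous g x) ->
  (forall x, a <= x <= b -> continuous h x) ->
  RInt (fun x => al * f x + be * g x + ga * h x) a b
  = al * RInt f a b + be * RInt g a b + ga * RInt h a b.
Proof.
  intros Hab Hf Hg Hh.
  assert (E1 : forall c (k : R -> R), (forall x, a <= x <= b -> continuous k x) ->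
    is_RInt (fun x => c * k x) a b (c * RInt k a b)).
  { intros c k Hk. apply (is_RInt_scal (V := R_NormedModule)).
    apply (RInt_correct (V := R_CompleteNormedModule)). now apply ex_RInt_cont. }
  apply is_RInt_unique.
  apply (is_RInt_plus (V := R_NormedModule) (fun x => al * f x + be * g x)); [|auto].
  apply (is_RInt_plus (V := R_NormedModule) (fun x => al * f x)); auto.
Qed.

Lemma sin_as_cos y : sin y = cos (y + - (PI / 2)).
Proof. rewrite cos_plus, cos_neg, sin_neg, cos_PI2, sin_PI2. ring. Qed.

Section Weight.

Variables (t eta om : R).
Hypothesis (Heta : 0 < eta) (Ht : t * eta ^ 4 = 1).

(** A Lorentzian of width [eta^2 = t^(-1/2)] about the stationary value of [s]. Its mass is at most
    [PI * eta^2], and its complement carries the factor [t * (s - om)^2], so it separates the near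
    and far ranges without a sharp cut. *)
Definition weight (s : R) : R := / (1 + t * (s - om) ^ 2).

Lemma weight_t_pos : 0 < t.
Proof. assert (0 < eta ^ 4) by (apply pow_lt; auto). nra. Qed.

Lemma weight_den s : 1 <= 1 + t * (s - om) ^ 2.
Proof. pose proof weight_t_pos. pose proof (pow2_ge_0 (s - om)). nra. Qed.

Lemma weight_pos s : 0 < weight s.
Proof. apply Rinv_0_lt_compat. pose proof (weight_den s). lra. Qed.

Lemma weight_id s : t * (s - om) ^ 2 * weight s = 1 - weight s.
Proof. unfold weight. pose proof (weight_den s). field. lra. Qed.

Lemma is_derive_weight_mul s :
  is_derive (fun s => (s - om) * weight s) s
    (weight s - 2 * (t * (s - om) ^ 2 * weight s) * weight s).
Proof.
  unfold weight. pose proof (weight_den s).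
  auto_derive; [lra|]. field. lra.
Qed.

Lemma continuous_weight s : continuous weight s.
Proof.
  apply (is_derive_cont _ _ (- (t * (2 * (s - om))) / (1 + t * (s - om) ^ 2) ^ 2)).
  unfold weight. pose proof (weight_den s). auto_derive; [lra|]. field. lra.
Qed.

Lemma continuous_weight_mul s : continuous (fun s => (s - om) * weight s) s.
Proof. eapply is_derive_cont, is_derive_weight_mul. Qed.

Lemma RInt_weight_le a b : a <= b -> RInt weight a b <= PI * eta ^ 2.
Proof.
  intros Hab.
  rewrite (RInt_derive_cont (fun s => eta ^ 2 * atan ((s - om) / eta ^ 2))); auto.
  - pose proof (atan_bound ((b - om) / eta ^ 2)).
    pose proof (atan_bound ((a - om) / eta ^ 2)).
    nra.
  - intros s _. unfold weight. pose proof (weight_den s). auto_derive; [auto|].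
    assert (Et : t = / eta ^ 4).
    { apply (Rmult_eq_reg_r (eta ^ 4)); [|apply pow_nonzero; lra].
      rewrite Rinv_l; [exact Ht | apply pow_nonzero; lra]. }
    assert (Ex : (s + - om) * / (eta * (eta * 1)) * ((s + - om) * / (eta * (eta * 1)) * 1)
      = t * (s - om) ^ 2) by (rewrite Et; field; lra).
    rewrite Ex. field. lra.
  - intros s _. apply continuous_weight.
Qed.

(* AM-GM applied to [|x| sqrt t / (1 + t x^2)]. *)
Lemma weight_mul_le s :
  Rabs ((s - om) * weight s) <= (eta ^ 3 + eta * weight s) / 2.
Proof.
  pose proof (weight_pos s) as Hw. pose proof (weight_den s) as Hd.
  rewrite Rabs_mult, (Rabs_right (weight s)) by lra.
  assert (E : weight s * (1 + t * (s - om) ^ 2) = 1) by (unfold weight; field; lra).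
  pose proof (pow2_abs (s - om)) as Hx. set (x := Rabs (s - om)) in *.
  rewrite <- Hx in *.
  apply (Rmult_le_reg_r (1 + t * x ^ 2)); [lra|].
  replace ((eta ^ 3 + eta * weight s) / 2 * (1 + t * x ^ 2))
    with ((eta ^ 3 * (1 + t * x ^ 2) + eta * (weight s * (1 + t * x ^ 2))) / 2) by field.
  rewrite Rmult_assoc, E.
  assert (0 <= (eta - x) ^ 2) by apply pow2_ge_0.
  apply (Rmult_le_reg_r eta); [auto|]. nra.
Qed.

End Weight.

Definition rect (a b c d x y : R) : Prop := a <= x <= b /\ c <= y <= d.

Lemma continuity_2d_pt_fst (f : R -> R) (x y : R) :
  continuous f x -> continuity_2d_pt (fun u _ => f u) x y.
Proof. intros H. apply (continuity_2d_pt_comp1 f); [exact H | apply continuity_2d_pt_id1]. Qed.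

Section Strip.

(** In the application [P] is the phase in the coordinates [(s, v)], [kap = 1 / Phi_uu] is the
    Jacobian of [u] with respect to [s], and [A] is the amplitude, whose support does not reach [s1]
    or [s2]. *)
Variables (s1 s2 v1 v2 om t th M : R) (P kap A As : R -> R -> R).
Hypotheses (Hs : s1 <= s2) (Hv : v1 <= v2).
Hypothesis HD : forall s v, rect s1 s2 v1 v2 s v ->
  is_derive (fun s => P s v) s ((s - om) * kap s v) /\
  is_derive (fun s => A s v) s (As s v) /\
  continuity_2d_pt P s v /\ continuity_2d_pt kap s v /\
  continuity_2d_pt A s v /\ continuity_2d_pt As s v /\ Rabs (As s v) <= M.
Hypothesis HA : forall v, v1 <= v <= v2 -> A s1 v = 0 /\ A s2 v = 0.

Let ph s v := t * P s v + th.

Lemma strip_continuity s v : rect s1 s2 v1 v2 s v ->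
  continuity_2d_pt (fun s v => A s v * kap s v * cos (ph s v)) s v /\
  continuity_2d_pt (fun s v => As s v * sin (ph s v)) s v /\
  continuity_2d_pt (fun s v => A s v * sin (ph s v)) s v.
Proof.
  intros Hr. destruct (HD s v Hr) as (_ & _ & C1 & C2 & C3 & C4 & _).
  assert (Hph : continuity_2d_pt ph s v).
  { apply continuity_2d_pt_plus; [apply continuity_2d_pt_mult|]; auto using continuity_2d_pt_const. }
  assert (continuity_2d_pt (fun s v => cos (ph s v)) s v)
    by (apply (continuity_2d_pt_comp1 cos); auto using continuous_cos).
  assert (continuity_2d_pt (fun s v => sin (ph s v)) s v)
    by (apply (continuity_2d_pt_comp1 sin); auto using continuous_sin).
  split; [|split]; repeat apply continuity_2d_pt_mult; auto.
Qed.

(** The Jacobian [kap] in the integrand is the same factor as in the [s]-derivative of [P], so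
    [t * (s - om) * kap * cos ph] is exactly the derivative of [sin ph]. The boundary terms vanish
    with [A]. *)
Lemma strip_by_parts (m m' : R -> R) v : v1 <= v <= v2 ->
  (forall s, s1 <= s <= s2 -> is_derive m s (m' s) /\ continuous m' s) ->
  RInt (fun s => m s * (t * (s - om)) * (A s v * kap s v * cos (ph s v))) s1 s2
  = RInt (fun s => - (m s * (As s v * sin (ph s v)) + m' s * (A s v * sin (ph s v)))) s1 s2.
Proof.
  intros Hvv Hm.
  assert (Hr : forall s, s1 <= s <= s2 -> rect s1 s2 v1 v2 s v) by (intros; split; auto).
  assert (C : forall s, s1 <= s <= s2 ->
    continuous (fun s => m s * (t * (s - om)) * (A s v * kap s v * cos (ph s v))) s /\
    continuous (fun s => - (m s * (As s v * sin (ph s v)) + m' s * (A s v * sin (ph s v)))) s).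
  { intros s Hss. destruct (strip_continuity s v (Hr s Hss)) as (C1 & C2 & C3).
    apply continuity_2d_pt_slice1 in C1, C2, C3. destruct (Hm s Hss) as [Dm Cm'].
    pose proof (is_derive_cont _ _ _ Dm) as Cm. split.
    - apply (continuous_mult (fun s => m s * (t * (s - om)))); auto.
      apply (continuous_mult m); auto.
      apply (is_derive_cont _ _ t). auto_derive; auto. ring.
    - apply (continuous_opp (fun s => m s * (As s v * sin (ph s v)) + m' s * (A s v * sin (ph s v)))).
      apply (continuous_plus (fun s => m s * (As s v * sin (ph s v)))).
      + now apply (continuous_mult m (fun s => As s v * sin (ph s v))).
      + now apply (continuous_mult m' (fun s => A s v * sin (ph s v))). }
  apply Rminus_diag_uniq.
  rewrite <- RInt_Rminus by (apply ex_RInt_cont; auto; intros; now apply C).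
  rewrite (RInt_derive_cont (fun s => A s v * m s * sin (ph s v))); auto.
  - destruct (HA v Hvv) as [-> ->]. ring.
  - intros s Hss. destruct (HD s v (Hr s Hss)) as (D1 & D2 & _). destruct (Hm s Hss) as [Dm _].
    replace (m s * (t * (s - om)) * (A s v * kap s v * cos (ph s v)) -
      - (m s * (As s v * sin (ph s v)) + m' s * (A s v * sin (ph s v))))
      with ((As s v * m s + A s v * m' s) * sin (ph s v)
        + A s v * m s * (t * ((s - om) * kap s v) * cos (ph s v))) by ring.
    apply (is_derive_Rmult (fun s => A s v * m s) (fun s => sin (ph s v))).
    + now apply (is_derive_Rmult (fun s => A s v) m).
    + apply (is_derive_comp sin (fun s => ph s v)).
      * apply is_derive_Reals, derivable_pt_lim_sin.
      * unfold ph. replace (t * ((s - om) * kap s v)) with (t * ((s - om) * kap s v) + 0) by ring.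
        apply is_derive_Rplus; [now apply is_derive_scal | apply is_derive_cst].
  - intros s Hss. destruct (C s Hss). now apply (continuous_minus (V := R_NormedModule)).
Qed.

(* With [x = s - om], only the second part of [1 = w + t x^2 w] is integrated by
   parts, which leaves no boundary term at [x = 0]. *)
Lemma stationary_strip (eta E : R) :
  0 < eta -> t * eta ^ 4 = 1 ->
  (forall s th, s1 <= s <= s2 ->
     Rabs (RInt (fun v => A s v * kap s v * cos (t * P s v + th)) v1 v2) <= E * eta /\
     Rabs (RInt (fun v => A s v * cos (t * P s v + th)) v1 v2) <= E * eta) ->
  Rabs (RInt (fun v => RInt (fun s => A s v * kap s v * cos (t * P s v + th)) s1 s2) v1 v2)
  <= (PI * (2 * E + M * (v2 - v1) / 2) + (s2 - s1) * (M * (v2 - v1) / 2)) * eta ^ 3.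
Proof.
  intros He Ht HJ.
  set (w := weight t om).
  pose proof (weight_id t eta om He Ht) as Hid. fold w in Hid.
  pose proof (weight_pos t eta om He Ht) as Hwp. fold w in Hwp.
  (* The derivative of [(s - om) * w s]. By [Hid] it equals [w * (2 * w - 1)], hence is bounded by
     [w] in absolute value. *)
  set (q := fun s => w s - 2 * (t * (s - om) ^ 2 * w s) * w s).
  assert (Hw : forall s, continuous w s) by (intros; eapply continuous_weight; eauto).
  assert (Hxw : forall s, continuous (fun s => (s - om) * w s) s)
    by (intros; eapply continuous_weight_mul; eauto).
  assert (Hq : forall s, continuous q s).
  { intros s. apply (continuous_ext (fun s => w s - 2 * ((1 - w s) * w s))).
    - intros x. unfold q. rewrite Hid. ring_R.
    - apply (continuous_minus w); auto.
      apply (continuous_mult (fun _ => 2) (fun s => (1 - w s) * w s)); [apply continuous_const|].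
      apply (continuous_mult (fun s => 1 - w s) w); auto.
      apply (continuous_minus (fun _ => 1) w); auto. apply continuous_const. }
  set (g1 := fun s v => A s v * kap s v * cos (ph s v)).
  set (g2 := fun s v => As s v * sin (ph s v)).
  set (g3 := fun s v => A s v * sin (ph s v)).
  assert (Hg : forall s v, rect s1 s2 v1 v2 s v ->
    continuity_2d_pt g1 s v /\ continuity_2d_pt g2 s v /\ continuity_2d_pt g3 s v)
    by apply strip_continuity.
  (* The integrand after the partial integration. The first and third terms have a weight of mass
     [O(eta^2)] and an integral in [v] of size [E * eta], which makes [eta^3]. *)
  set (G := fun s v => w s * g1 s v + - ((s - om) * w s) * g2 s v + - q s * g3 s v).
  assert (HG : forall s v, rect s1 s2 v1 v2 s v -> continuity_2d_pt G s v).
  { intros s v Hr. unfold G. repeat apply continuity_2d_pt_plus; apply continuity_2d_pt_mult;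
      try now apply Hg.
    - now apply continuity_2d_pt_fst.
    - apply (continuity_2d_pt_fst (fun s => - ((s - om) * w s))).
      apply (continuous_opp (fun s => (s - om) * w s)); auto.
    - apply (continuity_2d_pt_fst (fun s => - q s)). apply (continuous_opp q); auto. }
  assert (Hswap : forall v, v1 <= v <= v2 -> RInt (fun s => g1 s v) s1 s2 = RInt (fun s => G s v) s1 s2).
  { intros v Hvv.
    assert (Hr : forall s, s1 <= s <= s2 -> rect s1 s2 v1 v2 s v) by (intros; split; auto).
    assert (Hc : forall (c : R -> R) g, (forall s, continuous c s) ->
      (forall s, rect s1 s2 v1 v2 s v -> continuity_2d_pt g s v) -> ex_RInt (fun s => c s * g s v) s1 s2).
    { intros c g Cc Cg. apply ex_RInt_cont; auto. intros s Hss.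
      apply (continuous_mult c (fun s => g s v)); auto. apply (continuity_2d_pt_slice1 g); auto. }
    assert (Hpart := strip_by_parts (fun s => (s - om) * w s) q v Hvv
      (fun s _ => conj (is_derive_weight_mul t eta om He Ht s) (Hq s))).
    assert (E1 : RInt (fun s => g1 s v) s1 s2 = RInt (fun s => w s * g1 s v) s1 s2
      + RInt (fun s => (1 - w s) * g1 s v) s1 s2).
    { rewrite <- RInt_Rplus.
      - apply RInt_congr. intros s. ring.
      - apply Hc; auto. intros; now apply Hg.
      - apply Hc; [|intros; now apply Hg]. intros s. apply (continuous_minus (fun _ => 1) w); auto. apply continuous_const. }
    rewrite E1, (RInt_congr (fun s => (1 - w s) * g1 s v)
      (fun s => (s - om) * w s * (t * (s - om)) * (A s v * kap s v * cos (ph s v)))).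
    2: { intros s. rewrite <- Hid. unfold g1. ring. }
    rewrite Hpart, <- RInt_Rplus.
    - apply RInt_congr. intros s. unfold G, g2, g3. ring.
    - apply Hc; auto. intros; now apply Hg.
    - apply (ex_RInt_opp (V := R_NormedModule) (fun s => (s - om) * w s * g2 s v + q s * g3 s v)).
      apply (ex_RInt_plus (V := R_NormedModule) (fun s => (s - om) * w s * g2 s v)).
      + apply (Hc (fun s => (s - om) * w s)); auto. intros; now apply Hg.
      + apply Hc; auto. intros; now apply Hg. }
  rewrite (RInt_ext _ (fun v => RInt (fun s => G s v) s1 s2)).
  2: { intros v. rewrite Rmin_left, Rmax_right by lra. intros Hvv. apply Hswap. lra. }
  set (bnd := fun s => (2 * E * eta + eta * (M * (v2 - v1)) / 2) * w s
     + (M * (v2 - v1)) * eta ^ 3 / 2).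
  assert (HM : 0 <= M).
  { destruct (HD s1 v1) as (_ & _ & _ & _ & _ & _ & B); [split; lra|].
    pose proof (Rabs_pos (As s1 v1)). lra. }
  assert (HE : 0 <= E * eta).
  { destruct (HJ s1 0) as [H _]; [lra|].
    eapply Rle_trans; [apply Rabs_pos | exact H]. }
  apply Rle_trans with (RInt bnd s1 s2).
  - apply Fubini_bound; auto.
    + intros x y Hx Hy. apply HG. now split.
    + intros s _. apply (continuous_plus (fun s => _ * w s)); [|apply continuous_const].
      apply (continuous_mult (fun _ => _) w); [apply continuous_const | auto].
    + intros s Hss. unfold G.
      assert (Hr : forall v, v1 <= v <= v2 -> rect s1 s2 v1 v2 s v) by (intros; split; auto).
      rewrite (RInt_lin3 (fun v => g1 s v) (fun v => g2 s v) (fun v => g3 s v)); auto;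
        try (intros v Hvv; apply (fun f => continuity_2d_pt_slice2 f s v); now apply Hg, Hr).
      destruct (HJ s th Hss) as [J1 _].
      change (Rabs (RInt (fun v => g1 s v) v1 v2) <= E * eta) in J1.
      destruct (HJ s (th + - (PI / 2)) Hss) as [_ J3].
      assert (J3' : Rabs (RInt (fun v => g3 s v) v1 v2) <= E * eta).
      { erewrite RInt_ext; [exact J3|]. intros v _. unfold g3, ph.
        rewrite sin_as_cos, Rplus_assoc. reflexivity. }
      (* [As] is only continuous, so van der Corput in [v] cannot be applied to this term. The
         trivial bound suffices because its weight [(s - om) * w] is already
         [O(eta^3 + eta * w)]. *)
      assert (J2 : Rabs (RInt (fun v => g2 s v) v1 v2) <= (v2 - v1) * M).
      { apply Rabs_RInt_le_const; auto.
        - intros v Hvv. apply (continuity_2d_pt_slice2 g2 s v). now apply Hg, Hr.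
        - intros v Hvv. rewrite <- (Rmult_1_r M). apply Rabs_mult_le; [|apply Rabs_sin_le].
          apply (HD s v (Hr v Hvv)). }
      pose proof (weight_mul_le t eta om He Ht s) as W. fold w in W.
      assert (Q : Rabs (q s) <= w s).
      { unfold q. rewrite Hid. specialize (Hwp s).
        assert (0 <= 1 - w s).
        { rewrite <- Hid. pose proof (weight_t_pos t eta He Ht).
          pose proof (pow2_ge_0 (s - om)).
          apply Rmult_le_pos; [apply Rmult_le_pos|]; lra. }
        apply Rabs_le. nra. }
      specialize (Hwp s).
      assert (W' : Rabs (w s) <= w s) by (rewrite Rabs_right; lra).
      rewrite <- Rabs_Ropp in W, Q.
      pose proof (Rabs_plus_le _ _ _ _ (Rabs_plus_le _ _ _ _ (Rabs_mult_le _ _ _ _ W' J1)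
        (Rabs_mult_le _ _ _ _ W J2)) (Rabs_mult_le _ _ _ _ Q J3')).
      unfold bnd. lra.
  - unfold bnd.
    assert (Iw : RInt w s1 s2 <= PI * eta ^ 2) by (apply RInt_weight_le; auto).
    rewrite (RInt_congr _ (fun s => (2 * E * eta + eta * (M * (v2 - v1)) / 2) * w s
      + (M * (v2 - v1)) * eta ^ 3 / 2 * 1 + 0 * 1)) by (intros; ring).
    rewrite (RInt_lin3 w (fun _ => 1) (fun _ => 1)); auto; try (intros; apply continuous_const).
    rewrite (RInt_const (V := R_CompleteNormedModule)).
    change (scal (s2 - s1) 1) with ((s2 - s1) * 1).
    assert (0 <= 2 * E * eta + eta * (M * (v2 - v1)) / 2).
    { assert (0 <= M * (v2 - v1)) by (apply Rmult_le_pos; lra). nra. }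
    apply (Rmult_le_compat_l _ _ _ H) in Iw. nra.
Qed.

(** When [s] stays away from [om], the multiplier [1 / (t * (s - om))] is smooth and one integration
    by parts gains a full [1 / t = eta^4], with no oscillation in [v] involved. *)
Lemma nonstationary_strip (c : R) :
  0 < t -> 0 < c ->
  (forall s v, rect s1 s2 v1 v2 s v -> Rabs (A s v) <= M /\ c <= Rabs (s - om)) ->
  Rabs (RInt (fun v => RInt (fun s => A s v * kap s v * cos (t * P s v + th)) s1 s2) v1 v2)
  <= (v2 - v1) * ((s2 - s1) * (M / c + M / c ^ 2)) / t.
Proof.
  intros Ht Hc HD'.
  set (m := fun s => / (t * (s - om))). set (m' := fun s => - (/ t * (/ (s - om)) ^ 2)).
  assert (Hswap : forall v, v1 <= v <= v2 ->
     Rabs (RInt (fun s => A s v * kap s v * cos (ph s v)) s1 s2) <= (s2 - s1) * ((M / c + M / c ^ 2) / t)).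
  { intros v Hvv.
    assert (Hr : forall s, s1 <= s <= s2 -> rect s1 s2 v1 v2 s v) by (intros; split; auto).
    assert (Hnz : forall s, s1 <= s <= s2 -> s - om <> 0).
    { intros s Hss E. destruct (HD' s v (Hr s Hss)) as [_ B]. rewrite E, Rabs_R0 in B. lra. }
    assert (Hm : forall s, s1 <= s <= s2 -> is_derive m s (m' s) /\ continuous m' s).
    { intros s Hss. specialize (Hnz s Hss). split.
      - unfold m, m'. auto_derive; [|field; lra].
        apply Rmult_integral_contrapositive_currified; auto; lra.
      - unfold m'. apply (is_derive_cont _ _ (2 * / t * (/ (s - om)) ^ 3)).
        auto_derive; auto. field. lra. }
    rewrite (RInt_ext _ (fun s => m s * (t * (s - om)) * (A s v * kap s v * cos (ph s v)))).
    2: { intros s. rewrite Rmin_left, Rmax_right by lra. intros Hss.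
         specialize (Hnz s ltac:(lra)). unfold m. rewrite Rinv_l; [ring_R|].
         apply Rmult_integral_contrapositive_currified; auto; lra. }
    rewrite strip_by_parts with (m' := m') by auto.
    apply Rabs_RInt_le_const; auto.
    - intros s Hss. destruct (strip_continuity s v (Hr s Hss)) as (_ & C2 & C3).
      apply continuity_2d_pt_slice1 in C2, C3. destruct (Hm s Hss) as [Dm Cm'].
      apply (continuous_opp (fun s => m s * (As s v * sin (ph s v)) + m' s * (A s v * sin (ph s v)))).
      apply (continuous_plus (fun s => m s * (As s v * sin (ph s v)))).
      + apply (continuous_mult m (fun s => As s v * sin (ph s v))); auto. eapply is_derive_cont, Dm.
      + now apply (continuous_mult m' (fun s => A s v * sin (ph s v))).
    - intros s Hss. destruct (HD s v (Hr s Hss)) as (_ & _ & _ & _ & _ & _ & B1).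
      destruct (HD' s v (Hr s Hss)) as [B2 B3].
      assert (0 < / t) by now apply Rinv_0_lt_compat.
      assert (B4 : Rabs (/ (s - om)) <= / c).
      { rewrite Rabs_inv. apply Rinv_le_contravar; auto. }
      assert (B5 : Rabs (m s) <= / t * / c).
      { unfold m. rewrite Rinv_mult. apply Rabs_mult_le; auto. rewrite Rabs_right; lra. }
      assert (B6 : Rabs (m' s) <= / t * (/ c) ^ 2).
      { unfold m'. rewrite Rabs_Ropp. apply Rabs_mult_le; [rewrite Rabs_right; lra|].
        rewrite <- RPow_abs. apply pow_incr. split; [apply Rabs_pos | auto]. }
      rewrite Rabs_Ropp.
      pose proof (Rabs_plus_le _ _ _ _
        (Rabs_mult_le _ _ _ _ B5 (Rabs_mult_le _ _ _ _ B1 (Rabs_sin_le (ph s v))))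
        (Rabs_mult_le _ _ _ _ B6 (Rabs_mult_le _ _ _ _ B2 (Rabs_sin_le (ph s v))))) as B7.
      eapply Rle_trans; [exact B7|]. right. field. lra. }
  replace ((v2 - v1) * ((s2 - s1) * (M / c + M / c ^ 2)) / t)
    with ((v2 - v1) * ((s2 - s1) * ((M / c + M / c ^ 2) / t))) by (field; split; lra).
  apply abs_RInt_le_const; auto.
  apply (ex_RInt_RInt_param (fun v s => A s v * kap s v * cos (ph s v))); auto.
  intros x y Hx Hy. apply (continuity_2d_pt_swap (fun s v => A s v * kap s v * cos (ph s v))).
  apply strip_continuity. now split.
Qed.

End Strip.

(** * The local decay estimate *)

Lemma continuity_2d_pt_comp2 (f g k : R -> R -> R) (x y : R) :
  continuity_2d_pt f (g x y) (k x y) -> continuity_2d_pt g x y -> continuity_2d_pt k x y ->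
  continuity_2d_pt (fun u v => f (g u v) (k u v)) x y.
Proof.
  intros Hf Hg Hk eps. destruct (Hf eps) as [d Hd].
  destruct (Hg d) as [d1 Hd1]. destruct (Hk d) as [d2 Hd2].
  assert (Hm : 0 < Rmin d1 d2) by (apply Rmin_glb_lt; apply cond_pos).
  exists (mkposreal _ Hm). simpl. intros u v Hu Hv.
  pose proof (Rmin_l d1 d2). pose proof (Rmin_r d1 d2).
  apply Hd; [apply Hd1 | apply Hd2]; lra.
Qed.

Lemma differentiable_pt_lim_partials f x y lx ly :
  differentiable_pt_lim f x y lx ly ->
  continuity_2d_pt f x y /\ is_derive (fun u => f u y) x lx /\ is_derive (fun v => f x v) y ly.
Proof.
  intros H. split; [|split].
  - apply differentiable_continuity_pt. now exists lx, ly.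
  - apply is_derive_Reals. replace lx with (lx * 1 + ly * 0) by ring.
    apply (derivable_pt_lim_comp_2d f (fun u => u) (fun _ => y)); auto.
    + apply derivable_pt_lim_id. + apply derivable_pt_lim_const.
  - apply is_derive_Reals. replace ly with (lx * 0 + ly * 1) by ring.
    apply (derivable_pt_lim_comp_2d f (fun _ => x) (fun v => v)); auto.
    + apply derivable_pt_lim_const. + apply derivable_pt_lim_id.
Qed.

Lemma locally_2d_le_bound Q u v :
  continuity_2d_pt Q u v -> locally_2d (fun x y => Rabs (Q x y) <= Rabs (Q u v) + 1) u v.
Proof.
  intros H. destruct (H (mkposreal 1 Rlt_0_1)) as [d Hd]. exists d. intros x y Hx Hy.
  specialize (Hd x y Hx Hy). simpl in Hd.
  replace (Q x y) with ((Q x y - Q u v) + Q u v) by ring.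
  eapply Rle_trans; [apply Rabs_triang|]. lra.
Qed.

Lemma locally_2d_ge_half Q u v :
  continuity_2d_pt Q u v -> 0 < Q u v -> locally_2d (fun x y => Q u v / 2 <= Q x y) u v.
Proof.
  intros H Hp. assert (H2 : 0 < Q u v / 2) by lra.
  destruct (H (mkposreal _ H2)) as [d Hd]. exists d. intros x y Hx Hy.
  specialize (Hd x y Hx Hy). simpl in Hd. apply Rabs_def2 in Hd. lra.
Qed.

(** The iterates [L^i Q]; each application of [L] spends one order of differentiability of [Q] and
    of [B]. *)
Lemma flow_chain n Omega B Q :
  Cn n Omega B -> Cn n Omega Q ->
  exists Qc : nat -> R -> R -> R, Qc O = Q /\
    (forall i, (i < n)%nat -> flow_derivative Omega B (Qc i) (Qc (S i))) /\
    (forall u v, Omega u v -> continuity_2d_pt (Qc n) u v).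
Proof.
  revert Q. induction n as [|n IH]; intros Q HB HQ.
  - exists (fun _ => Q). split; [auto|]. split; [lia|]. apply HQ.
  - apply Cn_S in HB. destruct (Cn_flow_derivative n Omega B Q HB HQ) as [Q' [H1 H2]].
    destruct (IH Q' HB H2) as [Qc [E [Hc Hn]]].
    exists (fun i => match i with O => Q | S k => Qc k end).
    split; [auto|]. split; [|exact Hn].
    intros [|i] Hi; [rewrite E; exact H1 | apply Hc; lia].
Qed.

Lemma RInt_zero_outside (f : R -> R) (a b c d : R) :
  a <= c -> c <= d -> d <= b -> (forall x, a <= x <= b -> continuous f x) ->
  (forall x, a <= x <= c -> f x = 0) -> (forall x, d <= x <= b -> f x = 0) ->
  RInt f a b = RInt f c d.
Proof.
  intros Hac Hcd Hdb Hf H1 H2.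
  assert (Z : forall p q, p <= q -> (forall x, p <= x <= q -> f x = 0) -> RInt f p q = 0).
  { intros p q Hpq H. rewrite (RInt_ext _ (fun _ => 0)).
    - apply RInt_zero.
    - intros x. rewrite Rmin_left, Rmax_right by lra. intros Hx. apply H. lra. }
  rewrite (RInt_split f a c b), (RInt_split f c d b); try lra; try (intros; apply Hf; lra).
  rewrite (Z a c), (Z d b), Rplus_0_l, Rplus_0_r; auto.
Qed.

(* [eta] is [t^(-1/4)]; thanks to the free phase [th] the cosine integral
   controls the complex exponential one. *)
Definition decays_near (Phi : R -> R -> R) (u0 v0 : R) : Prop :=
  exists rho K, 0 < rho /\ 0 < K /\
  forall (A Au Av : R -> R -> R) (M om1 om2 th t eta : R),
    C1_partials (fun _ _ => True) A Au Av ->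
    (forall u v, Rabs (A u v) <= M /\ Rabs (Au u v) <= M /\ Rabs (Av u v) <= M) ->
    (forall u v, ~ box u0 v0 rho u v -> A u v = 0) ->
    0 < eta <= 1 -> t * eta ^ 4 = 1 ->
    Rabs (RInt (fun v => RInt (fun u =>
      A u v * cos (t * (Phi u v - om1 * u - om2 * v) + th))
      (u0 - rho) (u0 + rho)) (v0 - rho) (v0 + rho)) <= K * M * eta ^ 3.

Lemma C1_partials_cont Omega Q Qu Qv u v :
  open_2d Omega -> C1_partials Omega Q Qu Qv -> Omega u v -> continuity_2d_pt Q u v.
Proof.
  intros Ho HQ Huv. eapply differentiable_pt_lim_partials.
  eapply C1_partials_differentiable; eauto.
Qed.

Lemma C1_partials_mono (Om Om' : R -> R -> Prop) Q Qu Qv :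
  (forall u v, Om' u v -> Om u v) -> C1_partials Om Q Qu Qv -> C1_partials Om' Q Qu Qv.
Proof. intros H HQ u v Huv. apply HQ, H, Huv. Qed.

Lemma flow_derivative_mono (Om Om' : R -> R -> Prop) B Q Q' :
  (forall u v, Om' u v -> Om u v) -> flow_derivative Om B Q Q' -> flow_derivative Om' B Q Q'.
Proof.
  intros H [Qu [Qv [HQ E]]]. exists Qu, Qv. split; [now apply (C1_partials_mono Om)|auto].
Qed.

Lemma flow_derivative_cont Omega B Q Q' u v :
  open_2d Omega -> flow_derivative Omega B Q Q' -> Omega u v -> continuity_2d_pt Q u v.
Proof. intros Ho [Qu [Qv [HQ _]]]. now apply (C1_partials_cont Omega Q Qu Qv). Qed.

(* Along the curves [s = Phi_u], which are the integral curves of the field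
   [(-B, 1)], the phase has [v]-derivatives [D i - Bc (i+1) (s - om1)]. *)
Lemma decays_near_pos (j : nat) (Phi Phu Phv Phuu Phuv Phvv B kap : R -> R -> R)
    (D : nat -> R -> R -> R) (u0 v0 r : R) :
  (j <= 2)%nat -> 0 < r ->
  C1_partials (box u0 v0 r) Phi Phu Phv ->
  C1_partials (box u0 v0 r) Phu Phuu Phuv ->
  C1_partials (box u0 v0 r) Phv Phuv Phvv ->
  (forall u v, box u0 v0 r u v ->
     0 < Phuu u v /\ kap u v * Phuu u v = 1 /\ B u v * Phuu u v = Phuv u v) ->
  Cn (S j) (box u0 v0 r) B -> Cn 1 (box u0 v0 r) kap ->
  (forall u v, box u0 v0 r u v -> D O u v = Phvv u v - B u v * Phuv u v) ->
  (forall i, (i < j)%nat -> flow_derivative (box u0 v0 r) B (D i) (D (S i))) ->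
  (forall u v, box u0 v0 r u v -> continuity_2d_pt (D j) u v) ->
  D j u0 v0 <> 0 ->
  decays_near Phi u0 v0.
Proof.
  intros Hj Hr HPhi HPu HPv HPuu HB Hkap HD0 HD HDj HDnz.
  (* [Bc i] is [L^i B]. The chain must reach [S j], the index that accompanies [D j] in the phase
     derivative of order [j + 2]. *)
  destruct (flow_chain (S j) _ B B HB HB) as [Bc [EB [HBc HBcn]]].
  destruct Hkap as [Hkc [ku [kv [Hk [[Hku _] [Hkv _]]]]]].
  assert (H00 : box u0 v0 r u0 v0) by (split; rewrite Rminus_diag, Rabs_R0; lra).
  destruct (HPu _ _ H00) as (_ & _ & Cuu & Cuv).
  assert (Hsg : exists sg, (sg = 1 \/ sg = -1) /\ 0 < sg * D j u0 v0).
  { destruct (Rtotal_order (D j u0 v0) 0) as [H|[H|H]]; [exists (-1)|contradiction|exists 1];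
    split; auto; lra. }
  destruct Hsg as [sg [Hsg HDpos]].
  set (d0 := sg * D j u0 v0 / 2).
  assert (Hd0 : 0 < d0) by (unfold d0; lra).
  (* One constant for all coefficients on a small box: each term leaves a margin of 1 over the value
     at the base point, and the leading 1 gives [1 <= K1]. *)
  set (K1 := 1 + (Rabs (Phuu u0 v0) + 1) + (Rabs (Phuv u0 v0) + 1) + (Rabs (kap u0 v0) + 1)
    + (Rabs (ku u0 v0) + 1) + (Rabs (kv u0 v0) + 1) + (Rabs (B u0 v0) + 1)
    + (Rabs (Bc (S j) u0 v0) + 1)).
  assert (HK1 : 1 <= K1 /\ Rabs (Phuu u0 v0) + 1 <= K1 /\ Rabs (Phuv u0 v0) + 1 <= K1 /\
    Rabs (kap u0 v0) + 1 <= K1 /\ Rabs (ku u0 v0) + 1 <= K1 /\ Rabs (kv u0 v0) + 1 <= K1 /\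
    Rabs (B u0 v0) + 1 <= K1 /\ Rabs (Bc (S j) u0 v0) + 1 <= K1).
  { unfold K1.
    pose proof (Rabs_pos (Phuu u0 v0)). pose proof (Rabs_pos (Phuv u0 v0)).
    pose proof (Rabs_pos (kap u0 v0)). pose proof (Rabs_pos (ku u0 v0)).
    pose proof (Rabs_pos (kv u0 v0)). pose proof (Rabs_pos (B u0 v0)).
    pose proof (Rabs_pos (Bc (S j) u0 v0)). repeat split; lra. }
  destruct HK1 as (HK1 & L1 & L2 & L3 & L4 & L5 & L6 & L7). clearbody K1.
  set (m := Phuu u0 v0 / 2).
  assert (Hm : 0 < m) by (unfold m; destruct (HPuu _ _ H00); lra).
  assert (Hloc : locally_2d (fun u v =>
     (((((((Rabs (Phuu u v) <= Rabs (Phuu u0 v0) + 1 /\ Rabs (Phuv u v) <= Rabs (Phuv u0 v0) + 1) /\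
     Rabs (kap u v) <= Rabs (kap u0 v0) + 1) /\ Rabs (ku u v) <= Rabs (ku u0 v0) + 1) /\
     Rabs (kv u v) <= Rabs (kv u0 v0) + 1) /\ Rabs (B u v) <= Rabs (B u0 v0) + 1) /\
     Rabs (Bc (S j) u v) <= Rabs (Bc (S j) u0 v0) + 1) /\ m <= Phuu u v) /\
     d0 <= sg * D j u v) u0 v0).
  { assert (CB : continuity_2d_pt B u0 v0) by apply HB, H00.
    repeat apply locally_2d_and; try (apply locally_2d_le_bound; now auto).
    - apply locally_2d_ge_half; auto. now apply HPuu.
    - apply (locally_2d_ge_half (fun u v => sg * D j u v)); auto.
      apply continuity_2d_pt_mult; [apply continuity_2d_pt_const | auto]. }
  destruct Hloc as [del Hloc].
  set (r1 := Rmin r del).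
  assert (Hr1 : 0 < r1) by (apply Rmin_glb_lt; [auto | apply cond_pos]).
  assert (Hbox : forall u v, box u0 v0 r1 u v -> box u0 v0 r u v).
  { intros u v [H1 H2]. pose proof (Rmin_l r del). fold r1 in H. split; lra. }
  assert (Hb : forall u v, box u0 v0 r1 u v -> Rabs (Phuu u v) <= K1 /\ Rabs (Phuv u v) <= K1 /\
     Rabs (kap u v) <= K1 /\ Rabs (ku u v) <= K1 /\ Rabs (kv u v) <= K1 /\ Rabs (B u v) <= K1 /\
     Rabs (Bc (S j) u v) <= K1 /\ m <= Phuu u v /\ d0 <= sg * D j u v).
  { intros u v [H1 H2]. pose proof (Rmin_r r del). fold r1 in H.
    destruct (Hloc u v) as ((((((((? & ?) & ?) & ?) & ?) & ?) & ?) & ?) & ?);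
      repeat split; lra. }
  clearbody r1 m. clear Hloc del L1 L2 L3 L4 L5 L6 L7.
  pose proof (open_box u0 v0 r) as Hop.
  pose proof (C1_partials_mono _ _ _ _ _ Hbox HPu) as HPu1.
  destruct (implicit_inverse Phu Phuu Phuv u0 v0 r1 m K1 Hr1 Hm HPu1)
    as [sig [g [Hsig [Hg Hginv]]]]; [apply Hb | apply Hb |].
  set (s0 := Phu u0 v0) in *.
  (* For [|s - om1| <= c0] the term [Bc (S j) * (s - om1)] is at most [d0 / 2], half of the lower
     bound for [|D j|], and cannot cancel it. *)
  set (c0 := d0 / (2 * K1)).
  assert (Hc0 : 0 < c0) by (apply Rdiv_lt_0_compat; lra).
  assert (Hc0K : K1 * c0 = d0 / 2) by (unfold c0; field; lra).
  set (w := Rmin (sig / 2) (c0 / 4)).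
  assert (Hw : 0 < w) by (apply Rmin_glb_lt; lra).
  assert (Hw1 : w <= sig / 2) by apply Rmin_l.
  assert (Hw2 : w <= c0 / 4) by apply Rmin_r.
  clearbody w.
  (* The last entry keeps [Phu] within [w / 2] of [s0] on the box of radius [rho], so the support of
     the amplitude lies strictly inside the strip [|s - s0| <= w]. *)
  set (rho := Rmin (Rmin (r1 / 2) (sig / 2)) (w / (4 * K1))).
  assert (Hrho : 0 < rho).
  { repeat apply Rmin_glb_lt; try lra. apply Rdiv_lt_0_compat; lra. }
  assert (Hrho1 : rho <= r1 / 2) by (unfold rho; eapply Rle_trans; [apply Rmin_l|apply Rmin_l]).
  assert (Hrho2 : rho <= sig / 2) by (unfold rho; eapply Rle_trans; [apply Rmin_l|apply Rmin_r]).
  assert (Hrho3 : K1 * (2 * rho) <= w / 2).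
  { assert (rho <= w / (4 * K1)) by apply Rmin_r.
    replace (w / 2) with (K1 * (2 * (w / (4 * K1)))) by (field; lra).
    apply Rmult_le_compat_l; lra. }
  clearbody rho.
  set (s1 := s0 - w). set (s2 := s0 + w). set (v1 := v0 - rho). set (v2 := v0 + rho).
  assert (Hosc : forall u v, Rabs (u - u0) <= rho -> Rabs (v - v0) <= rho ->
     box u0 v0 r1 u v /\ Rabs (Phu u v - s0) <= w / 2).
  { intros u v Hu Hv.
    assert (B1 : box u0 v0 r1 u v) by (split; lra).
    assert (B2 : box u0 v0 r1 u0 v) by (split; [rewrite Rminus_diag, Rabs_R0|]; lra).
    assert (B3 : box u0 v0 r1 u0 v0) by (split; rewrite Rminus_diag, Rabs_R0; lra).
    split; auto.
    destruct (MVT_box1 _ _ _ _ _ _ _ _ _ HPu1 B2 B1) as [x [Hx E1]].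
    destruct (MVT_box2 _ _ _ _ _ _ _ _ _ HPu1 B3 B2) as [y [Hy E2]].
    replace (Phu u v - s0) with (Phuu x v * (u - u0) + Phuv u0 y * (v - v0)) by (unfold s0; lra).
    destruct (Hb _ _ (box_segment _ _ _ _ _ _ _ B2 B1 Hx)) as (C1 & _).
    destruct (Hb _ _ (box_segment2 _ _ _ _ _ _ _ B3 B2 Hy)) as (_ & C2 & _).
    assert (Rabs (Phuu x v * (u - u0)) <= K1 * rho)
      by now apply Rabs_mult_le.
    assert (Rabs (Phuv u0 y * (v - v0)) <= K1 * rho)
      by now apply Rabs_mult_le.
    eapply Rle_trans; [apply Rabs_triang|]. lra. }
  assert (Hrect : forall s v, rect s1 s2 v1 v2 s v -> Rabs (s - s0) < sig /\ Rabs (v - v0) < sig /\ Rabs (v - v0) <= rho).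
  { unfold s1, s2, v1, v2. intros s v [H1 H2]. split; [|split]; [apply Rabs_def1; lra | apply Rabs_def1; lra | apply Rabs_le; lra]. }
  assert (Hgr : forall s v, rect s1 s2 v1 v2 s v ->
     box u0 v0 r1 (g s v) v /\ Phu (g s v) v = s /\
     continuity_2d_pt g s v /\ is_derive (fun s => g s v) s (kap (g s v) v) /\
     is_derive (fun v => g s v) v (- B (g s v) v)).
  { intros s v Hr0. destruct (Hrect s v Hr0) as (R1 & R2 & _).
    destruct (Hg s v R1 R2) as (G1 & G2 & G3).
    destruct (differentiable_pt_lim_partials _ _ _ _ _ G3) as (G4 & G5 & G6).
    destruct (HPuu _ _ (Hbox _ _ G1)) as (P1 & P2 & P3).
    split; [auto|]. split; [auto|]. split; [auto|].
    replace (kap (g s v) v) with (/ Phuu (g s v) v) by (apply (Rmult_eq_reg_r (Phuu (g s v) v)); [rewrite Rinv_l|]; lra).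
    replace (- B (g s v) v) with (- (Phuv (g s v) v / Phuu (g s v) v)) by (rewrite <- P3; field; lra).
    auto. }
  assert (Hcg : forall Q s v, rect s1 s2 v1 v2 s v -> continuity_2d_pt Q (g s v) v ->
     continuity_2d_pt (fun s v => Q (g s v) v) s v).
  { intros Q s v Hr0 HQ. apply (continuity_2d_pt_comp2 Q g (fun _ v => v)); auto.
    - now apply Hgr.
    - apply continuity_2d_pt_id2. }
  (* Rescales [eta] to [eta * T] so that the lower bound [t * d0 / 2] on the phase derivative meets
     the normalisation of van der Corput. *)
  set (T := Rmax 1 (2 / d0)).
  assert (HT1 : 1 <= T) by apply Rmax_l.
  assert (HT2 : 2 / d0 <= T) by apply Rmax_r.
  (* Times [M], this bounds [A * kap] along a curve and its derivative, since [L A] is at most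
     [(1 + K1) * M] and [L kap] at most [K1 * (1 + K1)]. *)
  set (M1 := 2 * K1 * (1 + K1)).
  set (E1 := vdc_const j * T * (M1 * (1 + (v2 - v1)))).
  assert (Hvv : v2 - v1 = 2 * rho) by (unfold v1, v2; ring).
  assert (Hss : s2 - s1 = 2 * w) by (unfold s1, s2; ring).
  assert (HM1 : 0 < M1) by (unfold M1; nra).
  assert (HE1 : 0 < E1).
  { unfold E1. pose proof (vdc_const_pos j). rewrite Hvv.
    apply Rmult_lt_0_compat; apply Rmult_lt_0_compat; lra. }
  set (Kn := PI * (2 * E1 + K1 * (v2 - v1) / 2) + (s2 - s1) * (K1 * (v2 - v1) / 2)).
  set (Kf := (v2 - v1) * ((s2 - s1) * (K1 / (c0 / 4) + K1 / (c0 / 4) ^ 2))).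
  assert (HKn : 0 < Kn).
  { unfold Kn. rewrite Hvv, Hss. pose proof PI_RGT_0.
    assert (0 < K1 * (2 * rho) / 2) by nra.
    apply Rplus_lt_0_compat; apply Rmult_lt_0_compat; lra. }
  assert (HKf : 0 < Kf).
  { unfold Kf. rewrite Hvv, Hss. repeat apply Rmult_lt_0_compat; try lra.
    apply Rplus_lt_0_compat; apply Rdiv_lt_0_compat; try lra. apply pow_lt; lra. }
  exists rho, (Kn + Kf). split; [auto|]. split; [lra|].
  intros A Au Av M om1 om2 th t eta HA HAM HAsupp Heta Ht.
  assert (HM : 0 <= M) by (destruct (HAM 0 0) as [H _]; pose proof (Rabs_pos (A 0 0)); lra).
  assert (HopT : open_2d (fun _ _ => True)).
  { intros u v _. exists (mkposreal 1 Rlt_0_1). auto. }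
  assert (HAc : forall u v, continuity_2d_pt A u v)
    by (intros u v; apply (C1_partials_cont (fun _ _ => True) A Au Av); auto).
  set (F := fun u v => Phi u v - om1 * u - om2 * v).
  assert (HF : C1_partials (box u0 v0 r1) F (fun u v => Phu u v - om1) (fun u v => Phv u v - om2)).
  { intros u v Huv. destruct (HPhi u v (Hbox _ _ Huv)) as (F1 & F2 & F3 & F4).
    split; [|split; [|split]];
      try (apply continuity_2d_pt_minus; [auto | apply continuity_2d_pt_const]).
    - unfold F. replace (Phu u v - om1) with ((Phu u v - om1) - 0) by ring.
      apply (is_derive_Rminus (fun x => Phi x v - om1 * x) (fun _ => om2 * v));
        [|apply is_derive_cst].
      apply (is_derive_Rminus (fun x => Phi x v) (fun x => om1 * x)); auto.
      auto_derive; auto. ring.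
    - unfold F. replace (Phv u v - om2) with ((Phv u v - 0) - om2) by ring.
      apply (is_derive_Rminus (fun y => Phi u y - om1 * u) (fun y => om2 * y));
        [|auto_derive; auto; ring].
      apply (is_derive_Rminus (fun y => Phi u y) (fun _ => om1 * u)); auto.
      apply is_derive_cst. }
  set (P := fun s v => F (g s v) v).
  assert (HFc : forall u v, box u0 v0 r1 u v -> continuity_2d_pt F u v).
  { intros u v Huv. eapply C1_partials_cont; [apply open_box | exact HF | exact Huv]. }
  (* The substitution [u = g s v] for each fixed [v]. By the choice of [rho], [g s1 v] and [g s2 v]
     lie on either side of the interval in [u], beyond the support of [A], so the integral may be
     extended to them. *)
  assert (Hstep : RInt (fun v => RInt (fun u => A u v * cos (t * F u v + th)) (u0 - rho) (u0 + rho)) v1 v2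
    = RInt (fun v => RInt (fun s => A (g s v) v * kap (g s v) v * cos (t * P s v + th)) s1 s2) v1 v2).
  { apply RInt_ext. intros v. rewrite Rmin_left, Rmax_right by (unfold v1, v2; lra). intros Hv.
    assert (Hrv : forall s, s1 <= s <= s2 -> rect s1 s2 v1 v2 s v) by (intros; split; lra).
    assert (Hvr : Rabs (v - v0) <= rho) by (apply Rabs_le; unfold v1, v2 in Hv; lra).
    assert (Hmono : forall s u, s1 <= s <= s2 -> Rabs (u - u0) <= rho ->
        exists k, 0 < k /\ Phu u v - s = k * (u - g s v)).
    { intros s u Hs Hu. destruct (Hgr s v (Hrv s Hs)) as (B1 & B2 & _).
      destruct (Hosc u v Hu Hvr) as [B3 _].
      destruct (MVT_box1 _ _ _ _ _ _ _ _ _ HPu1 B1 B3) as [x [Hx E]].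
      rewrite B2 in E. exists (Phuu x v). split; [|exact E].
      destruct (Hb _ _ (box_segment _ _ _ _ _ _ _ B1 B3 Hx)) as (_ & _ & _ & _ & _ & _ & _ & ? & _). lra. }
    assert (Hlo : g s1 v <= u0 - rho).
    { assert (Hu : Rabs (u0 - rho - u0) <= rho) by (apply Rabs_le; lra).
      destruct (Hmono s1 (u0 - rho) ltac:(lra) Hu) as [k [Hk0 E]].
      destruct (Hosc _ _ Hu Hvr) as [_ O]. apply Rabs_le_between in O.
      assert (0 < k * (u0 - rho - g s1 v)) by (rewrite <- E; unfold s1; lra). nra. }
    assert (Hhi : u0 + rho <= g s2 v).
    { assert (Hu : Rabs (u0 + rho - u0) <= rho) by (apply Rabs_le; lra).
      destruct (Hmono s2 (u0 + rho) ltac:(lra) Hu) as [k [Hk0 E]].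
      destruct (Hosc _ _ Hu Hvr) as [_ O]. apply Rabs_le_between in O.
      assert (k * (u0 + rho - g s2 v) < 0) by (rewrite <- E; unfold s2; lra). nra. }
    assert (Hin : forall u, g s1 v <= u <= g s2 v -> box u0 v0 r1 u v).
    { intros u Hu. apply (box_segment u0 v0 r1 (g s1 v) (g s2 v)).
      - apply Hgr, Hrv; lra. - apply Hgr, Hrv; lra.
      - rewrite Rmin_left, Rmax_right; lra. }
    assert (Hfc : forall u, box u0 v0 r1 u v -> continuous (fun u => A u v * cos (t * F u v + th)) u).
    { intros u Hu. apply (continuity_2d_pt_slice1 (fun u v => A u v * cos (t * F u v + th)) u v).
      apply continuity_2d_pt_mult; auto.
      apply (continuity_2d_pt_comp1 cos (fun u v => t * F u v + th)); [apply continuous_cos|].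
      apply continuity_2d_pt_plus; [apply continuity_2d_pt_mult|]; auto; apply continuity_2d_pt_const. }
    rewrite <- (RInt_zero_outside (fun u => A u v * cos (t * F u v + th)) (g s1 v) (g s2 v)); auto; try lra.
    2, 3: intros x Hx; rewrite HAsupp; [ring|]; intros [C _]; apply Rabs_def2 in C; lra.
    rewrite <- (RInt_comp (V := R_CompleteNormedModule) (fun u => A u v * cos (t * F u v + th))
      (fun s => g s v) (fun s => kap (g s v) v)).
    - apply RInt_congr. intros s. unfold scal; simpl. unfold mult; simpl. unfold P. ring.
    - rewrite Rmin_left, Rmax_right by lra. intros s Hs. apply Hfc, Hgr, Hrv, Hs.
    - rewrite Rmin_left, Rmax_right by lra. intros s Hs.
      destruct (Hgr s v (Hrv s Hs)) as (B1 & _ & _ & B4 & _). split; [exact B4|].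
      apply (continuity_2d_pt_slice1 (fun s v => kap (g s v) v) s v).
      apply Hcg; auto. }
  fold v1 v2. change (Rabs (RInt (fun v => RInt (fun u => A u v * cos (t * F u v + th))
    (u0 - rho) (u0 + rho)) v1 v2) <= (Kn + Kf) * M * eta ^ 3).
  rewrite Hstep.
  assert (Hcommon : forall s v, rect s1 s2 v1 v2 s v ->
     is_derive (fun s => P s v) s ((s - om1) * kap (g s v) v) /\
     is_derive (fun s => A (g s v) v) s (Au (g s v) v * kap (g s v) v) /\
     continuity_2d_pt P s v /\ continuity_2d_pt (fun s v => kap (g s v) v) s v /\
     continuity_2d_pt (fun s v => A (g s v) v) s v /\
     continuity_2d_pt (fun s v => Au (g s v) v * kap (g s v) v) s v /\
     Rabs (Au (g s v) v * kap (g s v) v) <= K1 * M).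
  { intros s v Hr0. destruct (Hgr s v Hr0) as (B1 & B2 & B3 & B4 & B5).
    destruct (HF _ _ B1) as (F1 & _). destruct (HA (g s v) v I) as (A1 & A2 & A3 & A4).
    split; [|split; [|split; [|split; [|split; [|split]]]]]; auto.
    - rewrite B2 in F1. rewrite Rmult_comm.
      apply (is_derive_comp (fun u => F u v) (fun s => g s v) s (s - om1) (kap (g s v) v)); auto.
    - rewrite Rmult_comm.
      apply (is_derive_comp (fun u => A u v) (fun s => g s v) s _ (kap (g s v) v)); auto.
    - apply (Hcg F); auto.
    - apply (continuity_2d_pt_mult (fun s v => Au (g s v) v)); auto.
    - rewrite Rabs_mult, Rmult_comm. apply Rmult_le_compat; try apply Rabs_pos.
      + now apply Hb. + apply HAM. }
  assert (Hedge : forall v, v1 <= v <= v2 -> A (g s1 v) v = 0 /\ A (g s2 v) v = 0).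
  { intros v Hv.
    assert (He : forall s, s = s1 \/ s = s2 -> A (g s v) v = 0).
    { intros s Hs. apply HAsupp. intros [C1 C2].
      assert (Hr0 : rect s1 s2 v1 v2 s v) by (split; [destruct Hs; subst; lra | auto]).
      destruct (Hgr s v Hr0) as (_ & B2 & _).
      destruct (Hosc (g s v) v) as [_ O]; try lra. rewrite B2 in O.
      apply Rabs_le_between in O. unfold s1, s2 in Hs. lra. }
    split; apply He; auto. }
  assert (Heta3 : 0 < eta ^ 3) by (apply pow_lt; lra).
  (* Since [w <= c0 / 4], each alternative holds on the whole strip: either [|s - om1| >= c0 / 4]
     throughout and the phase is nonstationary in [s], or [|s - om1| <= c0] throughout and [D j]
     dominates. *)
  destruct (Rle_lt_dec (c0 / 2) (Rabs (s0 - om1))) as [Hfar|Hnear].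
  - assert (Htp : 0 < t) by (apply (weight_t_pos t eta); lra).
    apply Rle_trans with ((v2 - v1) * ((s2 - s1) * (K1 * M / (c0 / 4) + K1 * M / (c0 / 4) ^ 2)) / t).
    + apply (nonstationary_strip s1 s2 v1 v2 om1 t th (K1 * M) P
        (fun s v => kap (g s v) v) (fun s v => A (g s v) v) (fun s v => Au (g s v) v * kap (g s v) v));
        try lra; auto.
      intros s v Hr0. split.
      * destruct (HAM (g s v) v) as [H _]. nra.
      * destruct Hr0 as [Hs _]. unfold s1, s2 in Hs.
        assert (Rabs (s0 - s) <= w) by (apply Rabs_le; lra).
        assert (Rabs (s0 - om1) <= Rabs (s0 - s) + Rabs (s - om1)).
        { replace (s0 - om1) with ((s0 - s) + (s - om1)) by ring. apply Rabs_triang. }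
        lra.
    + replace ((v2 - v1) * ((s2 - s1) * (K1 * M / (c0 / 4) + K1 * M / (c0 / 4) ^ 2)) / t)
        with (Kf * M * / t) by (unfold Kf; field; split; lra).
      assert (Et : / t = eta ^ 4).
      { apply (Rmult_eq_reg_l t); [rewrite Rinv_r; lra | lra]. }
      rewrite Et.
      assert (eta ^ 4 <= eta ^ 3) by (simpl in *; nra).
      assert (0 <= Kf * M) by (apply Rmult_le_pos; lra).
      assert (0 <= Kn * M) by (apply Rmult_le_pos; lra). nra.
  - assert (Hx : forall s, s1 <= s <= s2 -> Rabs (s - om1) <= c0).
    { intros s Hs. unfold s1, s2 in Hs.
      assert (Rabs (s - s0) <= w) by (apply Rabs_le; lra).
      replace (s - om1) with ((s - s0) + (s0 - om1)) by ring.
      eapply Rle_trans; [apply Rabs_triang|]. lra. }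
    assert (Hvdc : forall s th' b b', s1 <= s <= s2 ->
       (forall v, v1 <= v <= v2 -> is_derive b v (b' v) /\ continuous b' v /\
          Rabs (b v) <= M1 * M /\ Rabs (b' v) <= M1 * M) ->
       Rabs (RInt (fun v => b v * cos (t * P s v + th')) v1 v2) <= E1 * M * eta).
    { intros s th' b b' Hs Hbb.
      (* Constant along the curve, because [Phu = s] there; this is why differentiating [B * X]
         touches only [B]. *)
      set (X := s - om1).
      set (phi := fun (i : nat) (v : R) => match i with
        | O => t * P s v + th'
        | S O => t * (Phv (g s v) v - om2 - B (g s v) v * X)
        | S (S i) => t * (D i (g s v) v - Bc (S i) (g s v) v * X)
        end).
      assert (Hrv : forall v, v1 <= v <= v2 -> rect s1 s2 v1 v2 s v) by (intros; split; auto).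
      assert (Hfl : forall Q Q' v, v1 <= v <= v2 -> flow_derivative (box u0 v0 r) B Q Q' ->
         is_derive (fun v => Q (g s v) v) v (Q' (g s v) v)).
      { intros Q Q' v Hv HQ. destruct (Hgr s v (Hrv v Hv)) as (B1 & _ & _ & _ & B5).
        apply (flow_derivative_along (box u0 v0 r) B Q Q' (fun v => g s v)); auto. }
      assert (Hcomb : forall a a' c c' (k : R) v, is_derive a v a' -> is_derive c v c' ->
         is_derive (fun v => t * (a v - k - c v * X)) v (t * (a' - c' * X))).
      { intros a a' c c' k v H1 H2. apply (is_derive_scal (fun v => a v - k - c v * X)).
        apply (is_derive_Rminus (fun v => a v - k) (fun v => c v * X)).
        - replace a' with (a' - 0) by ring.
          apply (is_derive_Rminus a (fun _ => k)); auto.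
          apply is_derive_cst.
        - replace (c' * X) with (c' * X + c v * 0) by ring.
          apply (is_derive_Rmult c (fun _ => X)); auto.
          apply is_derive_cst. }
      assert (HB0 : flow_derivative (box u0 v0 r) B B (Bc 1%nat))
        by (rewrite <- EB at 2; apply HBc; lia).
      assert (HDi : forall i v, (i <= j)%nat -> v1 <= v <= v2 ->
         continuity_2d_pt (D i) (g s v) v).
      { intros i v Hi Hv. destruct (Hgr s v (Hrv v Hv)) as (B1 & _).
        destruct (Nat.eq_dec i j) as [->|Hn]; [auto|].
        apply (flow_derivative_cont (box u0 v0 r) B (D i) (D (S i))); auto. apply HD; lia. }
      replace (E1 * M * eta) with (vdc_const j * (eta * T) * (M1 * M * (1 + (v2 - v1))))
        by (unfold E1; ring).
      apply (van_der_corput_amp j phi b b'); try lra; try nra.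
      + intros i v Hi Hv. destruct (Hgr s v (Hrv v Hv)) as (B1 & B2 & _ & _ & B5).
        destruct i as [|[|i]].
        * simpl.
          replace (t * (Phv (g s v) v - om2 - B (g s v) v * X))
            with (t * (Phv (g s v) v - om2 - B (g s v) v * X) + 0) by ring.
          apply (is_derive_Rplus (fun v => t * P s v) (fun _ => th'));
            [|apply is_derive_cst].
          apply (is_derive_scal (fun v => P s v)).
          unfold P, X. replace (s - om1) with (Phu (g s v) v - om1) by lra.
          apply (flow_derivative_along (box u0 v0 r1) B F
            (fun u v => (Phv u v - om2) - B u v * (Phu u v - om1)) (fun v => g s v)); auto.
          -- apply open_box.
          -- exists (fun u v => Phu u v - om1), (fun u v => Phv u v - om2). split; auto.
        * simpl. apply Hcomb.
          -- rewrite HD0 by auto.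
             apply (Hfl Phv (fun u v => Phvv u v - B u v * Phuv u v)); auto.
             exists Phuv, Phvv. split; auto.
          -- apply Hfl; auto.
        * simpl phi.
          apply (is_derive_ext (fun v => t * (D i (g s v) v - 0 - Bc (S i) (g s v) v * X))).
          { intros y. change (t * (D i (g s y) y - 0 - Bc (S i) (g s y) y * X)
              = t * (D i (g s y) y - Bc (S i) (g s y) y * X)). ring. }
          apply Hcomb; apply Hfl; auto.
          -- apply HD; lia. -- apply HBc; lia.
      + intros v Hv. destruct (Hgr s v (Hrv v Hv)) as (B1 & _).
        replace (j + 2)%nat with (S (S j)) by lia. simpl phi.
        apply (continuity_2d_pt_slice2 (fun _ v => t * (D j (g s v) v - Bc (S j) (g s v) v * X)) s v).
        assert (Hsl : forall Q, continuity_2d_pt Q (g s v) v ->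
          continuity_2d_pt (fun _ v => Q (g s v) v) s v).
        { intros Q HQ. pose proof (Hcg Q s v (Hrv v Hv) HQ) as H1.
          apply continuity_2d_pt_slice2 in H1.
          apply (continuity_2d_pt_comp1 (fun v => Q (g s v) v) (fun _ v => v)); auto.
          apply continuity_2d_pt_id2. }
        apply continuity_2d_pt_mult; [apply continuity_2d_pt_const|].
        apply continuity_2d_pt_minus; [apply Hsl; apply HDi; auto|].
        apply continuity_2d_pt_mult; [apply Hsl; auto | apply continuity_2d_pt_const].
      + assert (Hlow : forall v, v1 <= v <= v2 -> 1 <= (eta * T) ^ (j + 2) * (sg * phi (j + 2)%nat v)).
        { intros v Hv. destruct (Hgr s v (Hrv v Hv)) as (B1 & _).
          replace (phi (j + 2)%nat) with (phi (S (S j))) by (f_equal; lia). simpl phi.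
          destruct (Hb _ _ B1) as (_ & _ & _ & _ & _ & _ & C1 & _ & C2).
          assert (C3 : Rabs (Bc (S j) (g s v) v * X) <= d0 / 2).
          { rewrite Rabs_mult, <- Hc0K. apply Rmult_le_compat; try apply Rabs_pos; auto. apply Hx, Hs. }
          apply Rabs_le_between in C3.
          assert (C4 : d0 / 2 <= sg * (D j (g s v) v - Bc (S j) (g s v) v * X))
            by (destruct Hsg; subst sg; lra).
          assert (Htp : 0 < t) by (apply (weight_t_pos t eta); lra).
          (* Here [j <= 2] and [eta <= 1] enter: [eta^(j+2)] is at least [eta^4], so all three types
             of point are charged the cusp rate. *)
          assert (C5 : eta ^ 4 * T <= (eta * T) ^ (j + 2)).
          { rewrite Rpow_mult_distr. apply Rmult_le_compat.
            - apply pow_le; lra.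
            - lra.
            - replace 4%nat with ((j + 2) + (2 - j))%nat by lia. rewrite pow_add.
              rewrite <- (Rmult_1_r (eta ^ (j + 2))) at 2.
              apply Rmult_le_compat_l; [apply pow_le; lra|].
              rewrite <- (pow1 (2 - j)). apply pow_incr; lra.
            - rewrite <- (pow_1 T) at 1. apply Rle_pow; [lra | lia]. }
          set (Y := D j (g s v) v - Bc (S j) (g s v) v * X) in *.
          apply Rle_trans with (eta ^ 4 * T * (t * (d0 / 2))).
          - replace (eta ^ 4 * T * (t * (d0 / 2))) with ((t * eta ^ 4) * (T * (d0 / 2))) by ring.
            rewrite Ht. apply Rle_div_l in HT2; [|lra]. lra.
          - replace (sg * (t * Y)) with (t * (sg * Y)) by ring.
            apply Rmult_le_compat; auto.
            + apply Rmult_le_pos; [apply pow_le|]; lra.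
            + apply Rmult_le_pos; lra.
            + apply Rmult_le_compat_l; lra. }
        destruct Hsg; subst sg; [left|right]; intros v Hv; specialize (Hlow v Hv); lra.
      + intros v Hv. now apply Hbb.
      + intros v Hv. now apply Hbb.
      + intros v Hv. now apply Hbb. }
    assert (HsliceQ : forall Q s v, rect s1 s2 v1 v2 s v -> continuity_2d_pt Q (g s v) v ->
       continuous (fun v => Q (g s v) v) v).
    { intros Q s v Hr0 HQ. apply (continuity_2d_pt_slice2 (fun s v => Q (g s v) v) s v). auto. }
    assert (HflA : flow_derivative (box u0 v0 r) B A (fun u v => Av u v - B u v * Au u v)).
    { exists Au, Av. split; auto. now apply (C1_partials_mono (fun _ _ => True)). }
    assert (Hflk : flow_derivative (box u0 v0 r) B kap (fun u v => kv u v - B u v * ku u v)).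
    { exists ku, kv. split; auto. }
    apply Rle_trans with ((PI * (2 * (E1 * M) + K1 * M * (v2 - v1) / 2)
      + (s2 - s1) * (K1 * M * (v2 - v1) / 2)) * eta ^ 3).
    2: { replace ((PI * (2 * (E1 * M) + K1 * M * (v2 - v1) / 2)
           + (s2 - s1) * (K1 * M * (v2 - v1) / 2))) with (Kn * M) by (unfold Kn; field).
         assert (0 <= Kf * M) by (apply Rmult_le_pos; lra). nra. }
    apply (stationary_strip s1 s2 v1 v2 om1 t th (K1 * M) P
        (fun s v => kap (g s v) v) (fun s v => A (g s v) v) (fun s v => Au (g s v) v * kap (g s v) v));
      try lra; auto.
    intros s th' Hs.
    assert (Hrv : forall v, v1 <= v <= v2 -> rect s1 s2 v1 v2 s v) by (intros; split; auto).
    assert (HLA : forall v, v1 <= v <= v2 ->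
      Rabs (Av (g s v) v - B (g s v) v * Au (g s v) v) <= (1 + K1) * M).
    { intros v Hv. destruct (Hgr s v (Hrv v Hv)) as (B1 & _).
      destruct (Hb _ _ B1) as (_ & _ & _ & _ & _ & C1 & _).
      destruct (HAM (g s v) v) as (_ & C2 & C3).
      unfold Rminus. eapply Rle_trans; [apply Rabs_triang|]. rewrite Rabs_Ropp, Rabs_mult.
      assert (Rabs (B (g s v) v) * Rabs (Au (g s v) v) <= K1 * M)
        by (apply Rmult_le_compat; auto; apply Rabs_pos). lra. }
    split.
    + apply (Hvdc s th' (fun v => A (g s v) v * kap (g s v) v)
        (fun v => (Av (g s v) v - B (g s v) v * Au (g s v) v) * kap (g s v) v
          + A (g s v) v * (kv (g s v) v - B (g s v) v * ku (g s v) v))); auto.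
      intros v Hv. destruct (Hgr s v (Hrv v Hv)) as (B1 & _ & _ & _ & B5).
      destruct (Hb _ _ B1) as (_ & _ & C1 & C2 & C3 & C4 & _).
      destruct (HAM (g s v) v) as (C5 & C6 & C7). destruct (HA (g s v) v I) as (_ & _ & A3 & A4).
      specialize (HLA v Hv).
      assert (CB : continuity_2d_pt B (g s v) v) by (apply HB; auto).
      split; [|split; [|split]].
      * apply (is_derive_Rmult (fun v => A (g s v) v) (fun v => kap (g s v) v)).
        -- apply (flow_derivative_along (box u0 v0 r) B A
             (fun u v => Av u v - B u v * Au u v) (fun v => g s v)); auto.
        -- apply (flow_derivative_along (box u0 v0 r) B kap
             (fun u v => kv u v - B u v * ku u v) (fun v => g s v)); auto.
      * apply (HsliceQ (fun u v => (Av u v - B u v * Au u v) * kap u v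
          + A u v * (kv u v - B u v * ku u v)) s v); auto.
        repeat (apply continuity_2d_pt_plus || apply continuity_2d_pt_opp
          || apply continuity_2d_pt_mult); auto.
      * cbv beta. rewrite Rabs_mult.
        assert (Rabs (A (g s v) v) * Rabs (kap (g s v) v) <= M * K1)
          by (apply Rmult_le_compat; auto; apply Rabs_pos).
        unfold M1. assert (0 <= K1 * M) by (apply Rmult_le_pos; lra).
        assert (0 <= K1 * (K1 * M)) by (apply Rmult_le_pos; lra). lra.
      * cbv beta. eapply Rle_trans; [apply Rabs_triang|]. rewrite !Rabs_mult.
        assert (Rabs (kv (g s v) v - B (g s v) v * ku (g s v) v) <= K1 * (1 + K1)).
        { unfold Rminus. eapply Rle_trans; [apply Rabs_triang|]. rewrite Rabs_Ropp, Rabs_mult.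
          assert (Rabs (B (g s v) v) * Rabs (ku (g s v) v) <= K1 * K1)
            by (apply Rmult_le_compat; auto; apply Rabs_pos). lra. }
        assert (Rabs (Av (g s v) v - B (g s v) v * Au (g s v) v) * Rabs (kap (g s v) v)
          <= (1 + K1) * M * K1) by (apply Rmult_le_compat; auto; apply Rabs_pos).
        assert (Rabs (A (g s v) v) * Rabs (kv (g s v) v - B (g s v) v * ku (g s v) v)
          <= M * (K1 * (1 + K1))) by (apply Rmult_le_compat; auto; apply Rabs_pos).
        unfold M1. lra.
    + apply (Hvdc s th' (fun v => A (g s v) v)
        (fun v => Av (g s v) v - B (g s v) v * Au (g s v) v)); auto.
      intros v Hv. destruct (Hgr s v (Hrv v Hv)) as (B1 & _ & _ & _ & B5).
      destruct (HAM (g s v) v) as (C5 & C6 & C7). destruct (HA (g s v) v I) as (_ & _ & A3 & A4).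
      specialize (HLA v Hv).
      assert (CB : continuity_2d_pt B (g s v) v) by (apply HB; auto).
      assert (0 <= K1 * M) by (apply Rmult_le_pos; lra).
      assert (0 <= K1 * (K1 * M)) by (apply Rmult_le_pos; lra).
      assert (M <= K1 * M) by nra.
      split; [|split; [|split]].
      * apply (flow_derivative_along (box u0 v0 r) B A
             (fun u v => Av u v - B u v * Au u v) (fun v => g s v)); auto.
      * apply (HsliceQ (fun u v => Av u v - B u v * Au u v) s v); auto.
        apply continuity_2d_pt_minus; auto. apply continuity_2d_pt_mult; auto.
      * unfold M1. lra.
      * unfold M1. lra.
Qed.

(** * Nondegeneracy of the planar phase *)

Lemma Cn_mono n (Om Om' : R -> R -> Prop) Q :
  (forall u v, Om' u v -> Om u v) -> Cn n Om Q -> Cn n Om' Q.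
Proof.
  intros H. revert Q. induction n as [|n IH]; intros Q [Hc HQ]; split; auto.
  destruct HQ as [Qu [Qv [HQ [H1 H2]]]]. exists Qu, Qv.
  split; [now apply (C1_partials_mono Om)|]. auto.
Qed.

(** Evenness of the cosine absorbs the sign once [om1], [om2] and [th] are negated too; this reduces
    [Phi_uu < 0] to [Phi_uu > 0]. *)
Lemma decays_near_opp Phi u0 v0 :
  decays_near (fun u v => - Phi u v) u0 v0 -> decays_near Phi u0 v0.
Proof.
  intros [rho [K [Hr [HK H]]]]. exists rho, K. split; [auto|]. split; [auto|].
  intros A Au Av M om1 om2 th t eta H1 H2 H3 H4 H5.
  specialize (H A Au Av M (- om1) (- om2) (- th) t eta H1 H2 H3 H4 H5).
  erewrite RInt_congr; [exact H|]. intros v. apply RInt_congr. intros u.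
  rewrite <- cos_neg. do 2 f_equal. ring.
Qed.

Lemma C1_partials_opp Om Q Qu Qv :
  C1_partials Om Q Qu Qv ->
  C1_partials Om (fun u v => - Q u v) (fun u v => - Qu u v) (fun u v => - Qv u v).
Proof.
  intros H u v Huv. destruct (H u v Huv) as (H1 & H2 & H3 & H4).
  split; [|split; [|split]]; try (now apply continuity_2d_pt_opp).
  - apply (is_derive_opp (fun x => Q x v)); auto.
  - apply (is_derive_opp (fun y => Q u y)); auto.
Qed.

Lemma flow_derivative_opp Om B Q Q' :
  flow_derivative Om B Q Q' -> flow_derivative Om B (fun u v => - Q u v) (fun u v => - Q' u v).
Proof.
  intros [Qu [Qv [H E]]]. exists (fun u v => - Qu u v), (fun u v => - Qv u v).
  split; [now apply C1_partials_opp|]. intros u v Huv. rewrite E by auto. ring.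
Qed.

(** The form in which nondegeneracy gets checked. The last hypothesis ranges over every chain [D]
    because [flow_chain] provides the iterates of [L] only existentially; on [Om] they are
    determined. *)
Lemma decays_near_flow (j : nat) (Om : R -> R -> Prop)
    (Phi Phu Phv Phuu Phuv Phvv : R -> R -> R) (u0 v0 : R) :
  (j <= 2)%nat -> open_2d Om -> Om u0 v0 ->
  C1_partials Om Phi Phu Phv -> C1_partials Om Phu Phuu Phuv -> C1_partials Om Phv Phuv Phvv ->
  (forall u v, Om u v -> Phuu u v <> 0) ->
  Cn (S j) Om Phuu -> Cn (S j) Om Phuv -> Cn j Om Phvv ->
  (forall D : nat -> R -> R -> R,
     (forall u v, D O u v = Phvv u v - Phuv u v * / Phuu u v * Phuv u v) ->
     (forall i, (i < j)%nat ->
        flow_derivative Om (fun u v => Phuv u v * / Phuu u v) (D i) (D (S i))) ->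
     D j u0 v0 <> 0) ->
  decays_near Phi u0 v0.
Proof.
  intros Hj Ho H0 HP HPu HPv Hnz Huu Huv Hvv HD.
  set (B := fun u v => Phuv u v * / Phuu u v).
  assert (Hk : Cn (S j) Om (fun u v => / Phuu u v)) by (apply Cn_inv; auto).
  assert (HB : Cn (S j) Om B) by (apply (Cn_mult (S j) Om Phuv); auto).
  assert (HD0 : Cn j Om (fun u v => Phvv u v + - (B u v * Phuv u v))).
  { apply Cn_plus; auto. apply Cn_opp, Cn_mult; now apply Cn_S. }
  destruct (flow_chain j Om B _ (Cn_S _ _ _ HB) HD0) as [D [ED [HDc HDn]]].
  assert (HDnz : D j u0 v0 <> 0).
  { apply HD; auto. intros u v. rewrite ED. unfold B. ring. }
  assert (Hk1 : Cn 1 Om (fun u v => / Phuu u v)) by (apply (Cn_le 1 (S j)); [lia | auto]).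
  assert (HcD : continuity_2d_pt Phuu u0 v0) by apply Huu, H0.
  assert (Hpos : exists sg, (sg = 1 \/ sg = -1) /\ 0 < sg * Phuu u0 v0).
  { pose proof (Hnz _ _ H0).
    destruct (Rtotal_order (Phuu u0 v0) 0) as [H1|[H1|H1]]; [exists (-1)|contradiction|exists 1];
    split; auto; lra. }
  destruct Hpos as [sg [Hsg Hpos]].
  destruct (locally_2d_and _ _ _ _ (Ho _ _ H0)
    (locally_2d_ge_half (fun u v => sg * Phuu u v) u0 v0
      (continuity_2d_pt_mult (fun _ _ => sg) Phuu u0 v0 (continuity_2d_pt_const _ _ _) HcD) Hpos))
    as [r Hr].
  assert (Hbox : forall u v, box u0 v0 r u v -> Om u v).
  { intros u v [H1 H2]. now apply Hr. }
  assert (Hbp : forall u v, box u0 v0 r u v -> 0 < sg * Phuu u v).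
  { intros u v [H1 H2]. destruct (Hr u v H1 H2). lra. }
  assert (HBb : Cn (S j) (box u0 v0 r) B) by (apply (Cn_mono _ Om); auto).
  assert (Hkb : Cn 1 (box u0 v0 r) (fun u v => / Phuu u v)) by (apply (Cn_mono _ Om); auto).
  destruct Hsg; subst sg.
  - apply (decays_near_pos j Phi Phu Phv Phuu Phuv Phvv B (fun u v => / Phuu u v) D u0 v0 r);
      try (now apply (C1_partials_mono Om)); auto.
    + apply cond_pos.
    + intros u v Hb. specialize (Hbp u v Hb). split; [lra|]. unfold B.
      split; field; lra.
    + intros u v Hb. rewrite ED. ring.
    + intros i Hi. apply (flow_derivative_mono Om); auto.
  - apply decays_near_opp.
    apply (decays_near_pos j (fun u v => - Phi u v) (fun u v => - Phu u v) (fun u v => - Phv u v)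
      (fun u v => - Phuu u v) (fun u v => - Phuv u v) (fun u v => - Phvv u v) B
      (fun u v => - / Phuu u v) (fun i u v => - D i u v) u0 v0 r);
      try (now apply C1_partials_opp, (C1_partials_mono Om)); auto.
    + apply cond_pos.
    + intros u v Hb. specialize (Hbp u v Hb). split; [lra|]. unfold B.
      split; field; lra.
    + now apply Cn_opp.
    + intros u v Hb. rewrite ED. ring.
    + intros i Hi. apply flow_derivative_opp, (flow_derivative_mono Om); auto.
    + intros u v Hb. apply continuity_2d_pt_opp; auto.
    + lra.
Qed.

(** Uniqueness of derivatives allows [L Q] at a point to be read off from any explicit computation
    of the two partials. *)
Lemma flow_derivative_eq Om B Q Q' u v a b :
  flow_derivative Om B Q Q' -> Om u v ->
  is_derive (fun x => Q x v) u a -> is_derive (fun y => Q u y) v b ->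
  Q' u v = b - B u v * a.
Proof.
  intros [Qu [Qv [H E]]] Huv Ha Hb. rewrite E by auto.
  destruct (H u v Huv) as (H1 & H2 & _).
  apply is_derive_unique in H1, H2, Ha, Hb. congruence.
Qed.

(* [2 cos x + 2 cos y + 4 cos x cos y = king x * king y - 1]: the planar part of
   the symbol is a product. *)
Definition king (x : R) : R := 1 + 2 * cos x.
Definition king1 (x : R) : R := - 2 * sin x.
Definition king2 (x : R) : R := - 2 * cos x.

Lemma is_derive_king x : is_derive king x (king1 x).
Proof. unfold king, king1. auto_derive; auto. ring. Qed.

Lemma is_derive_king1 x : is_derive king1 x (king2 x).
Proof. unfold king1, king2. auto_derive; auto. ring. Qed.

Lemma is_derive_king2 x : is_derive king2 x (- king1 x).
Proof. unfold king1, king2. auto_derive; auto. ring. Qed.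

Lemma king1_sqr x : king1 x ^ 2 = 4 - king2 x ^ 2.
Proof. unfold king1, king2. pose proof (sin2_cos2 x). unfold Rsqr in *. nra. Qed.

Lemma king2_eq x : king2 x = 1 - king x.
Proof. unfold king, king2. ring. Qed.

Section LinearComp.

Variables (n : nat) (Om : R -> R -> Prop) (a b : R).

Lemma Cn_king : Cn n Om (fun u v => king (a * u + b * v)).
Proof.
  apply (Cn_ext n Om (fun u v => 1 + 2 * cos (a * u + b * v + 0))).
  - intros. unfold king. do 3 f_equal. ring.
  - apply Cn_plus; [apply Cn_const|]. apply Cn_mult; [apply Cn_const | apply Cn_cos].
Qed.

Lemma Cn_king1 : Cn n Om (fun u v => king1 (a * u + b * v)).
Proof.
  apply (Cn_ext n Om (fun u v => 2 * cos (a * u + b * v + PI / 2))).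
  - intros. unfold king1. rewrite cos_plus, cos_PI2, sin_PI2. ring.
  - apply Cn_mult; [apply Cn_const | apply Cn_cos].
Qed.

Lemma Cn_king2 : Cn n Om (fun u v => king2 (a * u + b * v)).
Proof.
  apply (Cn_ext n Om (fun u v => - 2 * cos (a * u + b * v + 0))).
  - intros. unfold king2. do 2 f_equal. ring.
  - apply Cn_mult; [apply Cn_const | apply Cn_cos].
Qed.

End LinearComp.

Lemma C1_partials_prod Om p dp q dq :
  (forall x, is_derive p x (dp x)) -> (forall x, is_derive q x (dq x)) ->
  (forall x, continuous dp x) -> (forall x, continuous dq x) ->
  C1_partials Om (fun u v => p u * q v) (fun u v => dp u * q v) (fun u v => p u * dq v).
Proof.
  intros Hp Hq Hdp Hdq u v _.
  assert (Hsnd : forall f : R -> R, continuous f v -> continuity_2d_pt (fun _ y => f y) u v).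
  { intros f Hf. apply (continuity_2d_pt_comp1 f); [exact Hf | apply continuity_2d_pt_id2]. }
  split; [|split; [|split]].
  - replace (dp u * q v) with (dp u * q v + p u * 0) by ring.
    apply (is_derive_Rmult p (fun _ => q v)); auto.
    apply is_derive_cst.
  - apply (is_derive_scal q v (p u)); auto.
  - apply continuity_2d_pt_mult; [now apply continuity_2d_pt_fst|].
    apply Hsnd. eapply is_derive_cont, Hq.
  - apply continuity_2d_pt_mult; [|now apply Hsnd].
    apply continuity_2d_pt_fst. eapply is_derive_cont, Hp.
Qed.

Lemma continuous_king x : continuous king x.
Proof. eapply is_derive_cont, is_derive_king. Qed.
Lemma continuous_king1 x : continuous king1 x.
Proof. eapply is_derive_cont, is_derive_king1. Qed.
Lemma continuous_king2 x : continuous king2 x.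
Proof. eapply is_derive_cont, is_derive_king2. Qed.

Lemma Cn_prod n Om (p q : R -> R) :
  Cn n Om (fun u v => p (1 * u + 0 * v)) -> Cn n Om (fun u v => q (0 * u + 1 * v)) ->
  Cn n Om (fun u v => p u * q v).
Proof.
  intros Hp Hq. apply (Cn_ext n Om (fun u v => p (1 * u + 0 * v) * q (0 * u + 1 * v))).
  - intros. do 2 f_equal; ring.
  - now apply Cn_mult.
Qed.

(** The function [D] of the overview for [Phi = king u * king v]: the Schur complement
    [Phi_vv - Phi_uv^2 / Phi_uu] of the Hessian. *)
Definition king_hess (u v : R) : R :=
  king u * king2 v - king1 u * king1 v * / (king2 u * king v) * (king1 u * king1 v).

(** This is [L king_hess] over a common denominator. The factor [king1 v] in front vanishes with
    [sin v], which is what forces the separate treatment of cusps. *)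
Definition king_hess' (u v : R) : R :=
  king1 v / (king2 u ^ 3 * king v ^ 2) *
  (king1 u ^ 4 * king1 v ^ 2 + 3 * king2 u ^ 2 * king1 u ^ 2 * king1 v ^ 2
   - 3 * king1 u ^ 2 * king2 u ^ 2 * king v * king2 v - king u * king2 u ^ 3 * king v ^ 2).

(** The set where [Phi_uu] does not vanish, so that [Phi_u] can replace [u] as a coordinate. *)
Definition king_dom (u v : R) : Prop := king2 u * king v <> 0.

Lemma open_king_dom : open_2d king_dom.
Proof.
  intros u v H. apply (continuity_2d_pt_neq_0 (fun u v => king2 u * king v)); auto.
  apply continuity_2d_pt_mult.
  - apply continuity_2d_pt_fst, continuous_king2.
  - apply (continuity_2d_pt_comp1 king); [apply continuous_king | apply continuity_2d_pt_id2].
Qed.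

Lemma ex_derive_king x : ex_derive (fun y => king y) x.
Proof. eexists. apply is_derive_king. Qed.
Lemma ex_derive_king1 x : ex_derive (fun y => king1 y) x.
Proof. eexists. apply is_derive_king1. Qed.
Lemma ex_derive_king2 x : ex_derive (fun y => king2 y) x.
Proof. eexists. apply is_derive_king2. Qed.

Lemma Derive_king x : Derive (fun y => king y) x = king1 x.
Proof. apply is_derive_unique, is_derive_king. Qed.
Lemma Derive_king1 x : Derive (fun y => king1 y) x = king2 x.
Proof. apply is_derive_unique, is_derive_king1. Qed.
Lemma Derive_king2 x : Derive (fun y => king2 y) x = - king1 x.
Proof. apply is_derive_unique, is_derive_king2. Qed.

Lemma king_hess_flow D0 D1 u v :
  (forall u v, D0 u v = king_hess u v) ->
  flow_derivative king_dom (fun u v => king1 u * king1 v * / (king2 u * king v)) D0 D1 ->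
  king_dom u v -> D1 u v = king_hess' u v.
Proof.
  intros E H Huv.
  assert (Hu : king2 u <> 0) by (intros Z; apply Huv; rewrite Z; ring).
  assert (Hv : king v <> 0) by (intros Z; apply Huv; rewrite Z; ring).
  rewrite (flow_derivative_eq _ _ D0 D1 u v
    (king1 u * king2 v - king1 v ^ 2 / king v * (2 * king1 u + king1 u ^ 3 / king2 u ^ 2))
    (- king u * king1 v - king1 u ^ 2 / king2 u *
      (2 * king1 v * king2 v / king v - king1 v ^ 3 / king v ^ 2)) H Huv).
  - unfold king_hess'. field. auto.
  - apply (is_derive_ext (fun x => king_hess x v)); [intros; symmetry; apply E|].
    unfold king_hess. auto_derive.
    + exact (conj (ex_derive_king u) (conj (ex_derive_king1 u) (conj (ex_derive_king2 u)
        (conj Huv (conj (ex_derive_king1 u) I))))).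
    + rewrite Derive_king1, Derive_king2, Derive_king. field. auto.
  - apply (is_derive_ext (fun y => king_hess u y)); [intros; symmetry; apply E|].
    unfold king_hess. auto_derive.
    + exact (conj (ex_derive_king2 v) (conj (ex_derive_king1 v) (conj (ex_derive_king v)
        (conj Huv (conj (ex_derive_king1 v) I))))).
    + rewrite Derive_king1, Derive_king2, Derive_king. field. auto.
Qed.

Lemma decays_near_king (j : nat) u0 v0 :
  (j <= 2)%nat -> king_dom u0 v0 ->
  (forall D : nat -> R -> R -> R,
     (forall u v, D O u v = king_hess u v) ->
     (forall i, (i < j)%nat -> flow_derivative king_dom
        (fun u v => king1 u * king1 v * / (king2 u * king v)) (D i) (D (S i))) ->
     D j u0 v0 <> 0) ->
  decays_near (fun u v => king u * king v) u0 v0.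
Proof.
  intros Hj H0 HD.
  apply (decays_near_flow j king_dom _ (fun u v => king1 u * king v) (fun u v => king u * king1 v)
    (fun u v => king2 u * king v) (fun u v => king1 u * king1 v) (fun u v => king u * king2 v)); auto;
  try (apply C1_partials_prod; auto using is_derive_king, is_derive_king1,
       continuous_king1, continuous_king2);
  try (apply Cn_prod; auto using Cn_king, Cn_king1, Cn_king2).
  apply open_king_dom.
Qed.

(** The case [j = 0]: [king_hess] times [Phi_uu] is the Hessian determinant. *)
Lemma decays_near_king_nondegenerate u v :
  king_dom u v -> king u * king2 v * (king2 u * king v) <> (king1 u * king1 v) ^ 2 ->
  decays_near (fun u v => king u * king v) u v.
Proof.
  intros H Hdet. apply (decays_near_king 0); auto. intros D E _. rewrite E. unfold king_hess.
  intros Z. apply Hdet.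
  apply (Rmult_eq_compat_r (king2 u * king v)) in Z. rewrite Rmult_0_l in Z.
  replace ((king u * king2 v - king1 u * king1 v * / (king2 u * king v) * (king1 u * king1 v)) *
    (king2 u * king v)) with (king u * king2 v * (king2 u * king v) - (king1 u * king1 v) ^ 2) in Z
    by (field; split; intros Z'; apply H; rewrite Z'; ring).
  lra.
Qed.

Lemma decays_near_king_fold u v :
  king_dom u v -> king_hess' u v <> 0 -> decays_near (fun u v => king u * king v) u v.
Proof.
  intros H Hnz. apply (decays_near_king 1); auto. intros D E HD.
  rewrite (king_hess_flow (D 0%nat) (D 1%nat)); auto.
Qed.

(** Since [king1 v = 0], also [B = 0] here, and [L (L D)] reduces to the [v]-derivative of
    [king_hess']. That derivative is [king2 v] times the cofactor of [king1 v], namely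
    [- 36 / (king2 u * king v)]. *)
Lemma decays_near_king_cusp u v :
  king_dom u v -> king u = 0 -> king1 v = 0 -> decays_near (fun u v => king u * king v) u v.
Proof.
  intros H Hu0 Hv0. apply (decays_near_king 2); auto. intros D E HD.
  assert (Hu : king2 u <> 0) by (intros Z; apply H; rewrite Z; ring).
  assert (Hv : king v <> 0) by (intros Z; apply H; rewrite Z; ring).
  assert (H12 : flow_derivative king_dom (fun u v => king1 u * king1 v * / (king2 u * king v))
    (D 1%nat) (D 2%nat)) by (apply HD; lia).
  assert (HD1 : locally_2d (fun u v => D 1%nat u v = king_hess' u v) u v).
  { destruct (open_king_dom u v H) as [d Hd]. exists d. intros x y Hx Hy.
    apply (king_hess_flow (D 0%nat)); auto. }
  pose proof H12 as [Qu [Qv [HQ EQ]]]. rewrite EQ by auto. rewrite Hv0.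
  destruct (HQ u v H) as (_ & HQv & _).
  (* The cofactor of [king1 y] in [king_hess']. At a zero of [king1] only its value contributes to
     the derivative of the product, so [dR] can stay abstract. *)
  set (Rm := fun y => / (king2 u ^ 3 * king y ^ 2) *
    (king1 u ^ 4 * king1 y ^ 2 + 3 * king2 u ^ 2 * king1 u ^ 2 * king1 y ^ 2
     - 3 * king1 u ^ 2 * king2 u ^ 2 * king y * king2 y - king u * king2 u ^ 3 * king y ^ 2)).
  assert (HRnz : king2 u ^ 3 * king v ^ 2 <> 0).
  { apply Rmult_integral_contrapositive_currified; now apply pow_nonzero. }
  assert (HR : ex_derive Rm v).
  { unfold Rm. auto_derive.
    exact (conj (ex_derive_king v) (conj HRnz (conj (ex_derive_king1 v) (conj (ex_derive_king1 v)
      (conj (ex_derive_king v) (conj (ex_derive_king2 v) (conj (ex_derive_king v) I))))))). }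
  destruct HR as [dR HR].
  assert (HQv2 : is_derive (fun y => D 1%nat u y) v (king2 v * Rm v + king1 v * dR)).
  { apply (is_derive_ext_loc (fun y => king1 y * Rm y)).
    - apply locally_2d_1d_const_x in HD1. revert HD1. apply filter_imp.
      intros y Ey. transitivity (king_hess' u y); [|now symmetry].
      change (king1 y * Rm y = king_hess' u y). unfold Rm, king_hess', Rdiv. ring.
    - apply (is_derive_Rmult king1 Rm); auto. apply is_derive_king1. }
  apply is_derive_unique in HQv, HQv2.
  rewrite HQv in HQv2. rewrite HQv2.
  (* [king u = 0] means [cos u = - 1/2], hence [4 * sin u ^ 2 = 3]; likewise [sin v = 0] gives
     [king2 v ^ 2 = 4]. *)
  assert (Hu1 : king1 u ^ 2 = 3) by (rewrite king1_sqr, king2_eq, Hu0; ring).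
  assert (Hv1 : king2 v ^ 2 = 4).
  { pose proof (king1_sqr v) as E1. rewrite Hv0 in E1. lra. }
  unfold Rm. rewrite Hv0, Hu0.
  replace (king2 v * (/ (king2 u ^ 3 * king v ^ 2) *
    (king1 u ^ 4 * 0 ^ 2 + 3 * king2 u ^ 2 * king1 u ^ 2 * 0 ^ 2 -
      3 * king1 u ^ 2 * king2 u ^ 2 * king v * king2 v - 0 * king2 u ^ 3 * king v ^ 2)) + 0 * dR -
    king1 u * 0 * / (king2 u * king v) * Qu u v)
  with (- 3 * king1 u ^ 2 * king2 v ^ 2 / (king2 u * king v)) by (field; auto).
  rewrite Hu1, Hv1. intros Z. unfold Rdiv in Z.
  apply Rmult_integral in Z. destruct Z as [Z|Z]; [lra|].
  now apply (Rinv_neq_0_compat (king2 u * king v)).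
Qed.

Lemma no_degenerate_fold (c d : R) :
  -1 <= c <= 1 -> -1 < d < 1 -> c <> 0 -> 1 + 2 * d <> 0 ->
  c * d * (1 + 2 * c) * (1 + 2 * d) = 4 * (1 - c ^ 2) * (1 - d ^ 2) ->
  8 * (1 - c ^ 2) ^ 2 * (1 - d ^ 2) + 24 * (1 - c ^ 2) * (1 - d ^ 2) * c ^ 2
    + 12 * (1 - c ^ 2) * c ^ 2 * d * (1 + 2 * d) + c ^ 3 * (1 + 2 * c) * (1 + 2 * d) ^ 2 = 0 ->
  False.
Proof.
  (* Eliminating gives [c^2 (1 + 6 d + 2 d^2) = - 2 d (1 - d^2)], so [- 1/2 < d < 0];
     then the first equation forces [c (1 + 2 c) < 0], and its two sides have
     incompatible sizes. *)
  intros Hc Hd Hc0 Hq E2 E1.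
  destruct (Req_dec (1 - c ^ 2) 0) as [Ha|Ha].
  - rewrite Ha in *. ring_simplify in E1.
    assert (Hp : 1 + 2 * c <> 0) by (intros Z; assert (c = - / 2) by lra; subst c; lra).
    assert (Hnz : c ^ 3 * ((1 + 2 * c) * (1 + 2 * d) ^ 2) <> 0).
    { repeat apply Rmult_integral_contrapositive_currified; auto; now apply pow_nonzero. }
    apply Hnz. nra.
  - assert (E3 : c ^ 2 * (1 + 6 * d + 2 * d ^ 2) = - 2 * d * (1 - d ^ 2)).
    { apply (Rmult_eq_reg_l (1 - c ^ 2)); [|exact Ha].
      apply (f_equal (Rmult d)) in E1. apply (f_equal (Rmult (c ^ 2 * (1 + 2 * d)))) in E2.
      nra. }
    assert (Hd2 : 0 < 1 - d ^ 2) by nra.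
    assert (Ha2 : 0 < 1 - c ^ 2) by nra.
    assert (Hab : 0 < (1 - c ^ 2) * (1 - d ^ 2)) by (apply Rmult_lt_0_compat; lra).
    assert (Hdq : 0 < - d * (1 + 2 * d) <= / 2) by nra.
    nra.
Qed.

(** The classification is exhaustive: if the Hessian determinant vanishes, then either [sin v = 0],
    which forces [king u = 0] and a cusp, or [sin v <> 0] and [no_degenerate_fold] excludes the
    vanishing of [L D]. *)
Lemma decays_near_king_dom u v : king_dom u v -> decays_near (fun u v => king u * king v) u v.
Proof.
  intros H.
  destruct (Req_dec (king u * king2 v * (king2 u * king v)) ((king1 u * king1 v) ^ 2)) as [E|E];
    [|now apply decays_near_king_nondegenerate].
  assert (Hu : king2 u <> 0) by (intros Z; apply H; rewrite Z; ring).
  assert (Hv : king v <> 0) by (intros Z; apply H; rewrite Z; ring).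
  destruct (Req_dec (king1 v) 0) as [Z|Z].
  { apply decays_near_king_cusp; auto.
    pose proof (king1_sqr v) as Hs. rewrite Z in E, Hs.
    assert (king2 v <> 0) by (intros Y; rewrite Y in Hs; lra).
    assert (E0 : king u * (king2 v * (king2 u * king v)) = 0) by (rewrite <- Rmult_assoc, E; ring).
    apply Rmult_integral in E0. destruct E0 as [E0|E0]; auto.
    exfalso. apply Rmult_integral in E0. destruct E0 as [E0|E0]; [auto|].
    now apply Rmult_integral in E0; destruct E0. }
  apply decays_near_king_fold; auto.
  unfold king_hess'. apply Rmult_integral_contrapositive_currified.
  { apply Rmult_integral_contrapositive_currified; auto.
    apply Rinv_neq_0_compat, Rmult_integral_contrapositive_currified; now apply pow_nonzero. }
  intros E1.
  replace (king1 u ^ 4) with ((king1 u ^ 2) ^ 2) in E1 by ring.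
  rewrite Rpow_mult_distr in E. rewrite !king1_sqr in E, E1.
  pose proof (COS_bound u).
  assert (Hd : -1 < cos v < 1).
  { pose proof (sin2_cos2 v) as S. unfold Rsqr in S. unfold king1 in Z.
    nra. }
  unfold king, king2 in *.
  (* With [c = cos u] and [d = cos v], [E] and [E1] are the two equations of that lemma multiplied
     by 4 and by 8. *)
  apply (no_degenerate_fold (cos u) (cos v)); auto.
  - intros Y. apply Hu. rewrite Y. ring.
  - lra.
  - lra.
Qed.

(** Where both pure second derivatives vanish, neither variable can be straightened. In the
    coordinates [(u, v) = (x, y - x)] the second [u]-derivative becomes [2 * Phi_xy], which is
    nonzero, and so is the Hessian determinant: the case [j = 0] applies. *)
Lemma decays_near_king_shear x y :
  king2 x * king y = 0 -> king x * king2 y = 0 ->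
  decays_near (fun u v => king u * king (u + v)) x (y - x).
Proof.
  intros H1 H2.
  (* If [sin x = 0] then [king x] and [king2 x] are both nonzero, so [king y] and [king2 y] would
     both vanish, against [king2 y = 1 - king y]; similarly for [y]. *)
  assert (Hx : king1 x <> 0 /\ king1 y <> 0).
  { pose proof (king1_sqr x) as Sx. pose proof (king1_sqr y) as Sy.
    rewrite (king2_eq x) in H1, Sx. rewrite (king2_eq y) in H2, Sy.
    apply Rmult_integral in H1. apply Rmult_integral in H2.
    split; intros Z; rewrite Z in *; destruct H1, H2; nra. }
  destruct Hx as [Hx Hy].
  set (Psi2 := fun u v => king2 u * king (u + v) + 2 * (king1 u * king1 (u + v)) + king u * king2 (u + v)).
  assert (Hlin : forall n Om p q, (Cn n Om (fun u v => p (1 * u + 0 * v))) ->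
     Cn n Om (fun u v => q (1 * u + 1 * v)) -> Cn n Om (fun u v => p u * q (u + v))).
  { intros n Om p q Hp Hq. apply (Cn_ext n Om (fun u v => p (1 * u + 0 * v) * q (1 * u + 1 * v))).
    - intros. do 2 f_equal; ring.
    - now apply Cn_mult. }
  assert (HP2 : forall n Om, Cn n Om Psi2).
  { intros n Om. unfold Psi2. apply Cn_plus; [apply Cn_plus|]; [|apply Cn_mult; [apply Cn_const|]|];
    apply Hlin; auto using Cn_king, Cn_king1, Cn_king2. }
  assert (Huv : forall n Om, Cn n Om (fun u v => king1 u * king1 (u + v) + king u * king2 (u + v))).
  { intros n Om. apply Cn_plus; apply Hlin; auto using Cn_king, Cn_king1, Cn_king2. }
  assert (Hvv : forall n Om, Cn n Om (fun u v => king u * king2 (u + v))).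
  { intros n Om. apply Hlin; auto using Cn_king, Cn_king1, Cn_king2. }
  assert (Hu : forall n Om, Cn n Om (fun u v => king1 u * king (u + v) + king u * king1 (u + v))).
  { intros n Om. apply Cn_plus; apply Hlin; auto using Cn_king, Cn_king1, Cn_king2. }
  assert (Hv : forall n Om, Cn n Om (fun u v => king u * king1 (u + v))).
  { intros n Om. apply Hlin; auto using Cn_king, Cn_king1, Cn_king2. }
  assert (E : x + (y - x) = y) by ring.
  assert (E0 : Psi2 x (y - x) = 2 * (king1 x * king1 y)).
  { unfold Psi2. rewrite E, H1, H2. ring. }
  assert (Hn : king1 x * king1 y <> 0) by now apply Rmult_integral_contrapositive_currified.
  apply (decays_near_flow 0 (fun u v => Psi2 u v <> 0) _
    (fun u v => king1 u * king (u + v) + king u * king1 (u + v)) (fun u v => king u * king1 (u + v))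
    Psi2 (fun u v => king1 u * king1 (u + v) + king u * king2 (u + v))
    (fun u v => king u * king2 (u + v))); auto.
  - intros u v H. apply continuity_2d_pt_neq_0; auto. now apply (HP2 0%nat (fun _ _ => True)).
  - rewrite E0. lra.
  - intros u v _. split; [|split; [|split]].
    + auto_derive; [exact (conj (ex_derive_king u) (conj (ex_derive_king (u + v)) I))|].
      rewrite !Derive_king. ring.
    + auto_derive; [exact (ex_derive_king (u + v))|]. rewrite !Derive_king. ring.
    + now apply (Hu 0%nat (fun _ _ => True)).
    + now apply (Hv 0%nat (fun _ _ => True)).
  - intros u v _. split; [|split; [|split]].
    + auto_derive; [exact (conj (ex_derive_king1 u) (conj (ex_derive_king (u + v))
        (conj (ex_derive_king u) (conj (ex_derive_king1 (u + v)) I))))|].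
      rewrite !Derive_king, !Derive_king1. unfold Psi2. ring.
    + auto_derive; [exact (conj (ex_derive_king (u + v)) (conj (ex_derive_king1 (u + v)) I))|].
      rewrite !Derive_king, !Derive_king1. ring.
    + now apply (HP2 0%nat (fun _ _ => True)).
    + now apply (Huv 0%nat (fun _ _ => True)).
  - intros u v _. split; [|split; [|split]].
    + auto_derive; [exact (conj (ex_derive_king u) (conj (ex_derive_king1 (u + v)) I))|].
      rewrite !Derive_king, !Derive_king1. ring.
    + auto_derive; [exact (ex_derive_king1 (u + v))|]. rewrite !Derive_king1. ring.
    + now apply (Huv 0%nat (fun _ _ => True)).
    + now apply (Hvv 0%nat (fun _ _ => True)).
  - intros D ED _. rewrite ED, E0, E, H2.
    replace (0 - (king1 x * king1 y + 0) * / (2 * (king1 x * king1 y)) * (king1 x * king1 y + 0))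
      with (- / 2 * (king1 x * king1 y)) by (field; auto).
    apply Rmult_integral_contrapositive_currified; auto. lra.
Qed.

(** * Localisation and compactness *)

(** [decays_near] asks only for amplitudes of class C^1, so a squared positive part serves as
    cutoff; the square makes it differentiable at the edge of its support. *)
Definition bump (d x : R) : R := Rmax 0 (1 - (x / d) ^ 2) ^ 2.
Definition bump' (d x : R) : R := - 4 * x / d ^ 2 * Rmax 0 (1 - (x / d) ^ 2).

Lemma is_derive_Rmax_sqr z : is_derive (fun z => Rmax 0 z ^ 2) z (2 * Rmax 0 z).
Proof.
  apply is_derive_Reals. intros eps Heps. exists (mkposreal eps Heps). simpl.
  intros h Hh Hhe.
  assert (H : Rabs (Rmax 0 (z + h) ^ 2 - Rmax 0 z ^ 2 - 2 * Rmax 0 z * h) <= h ^ 2).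
  { unfold Rmax. destruct (Rle_dec 0 (z + h)), (Rle_dec 0 z); apply Rabs_le; nra. }
  replace ((Rmax 0 (z + h) * (Rmax 0 (z + h) * 1) - Rmax 0 z * (Rmax 0 z * 1)) / h - 2 * Rmax 0 z)
    with ((Rmax 0 (z + h) ^ 2 - Rmax 0 z ^ 2 - 2 * Rmax 0 z * h) * / h) by (field; auto).
  rewrite Rabs_mult, Rabs_inv.
  assert (Hp : 0 < Rabs h) by now apply Rabs_pos_lt.
  apply (Rmult_lt_reg_r (Rabs h)); [auto|]. rewrite Rmult_assoc, Rinv_l, Rmult_1_r by lra.
  rewrite <- (pow2_abs h) in H. eapply Rle_lt_trans; [exact H|]. simpl. nra.
Qed.

Section Bump.

Variable d : R.
Hypothesis Hd : 0 < d.

Lemma is_derive_bump x : is_derive (bump d) x (bump' d x).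
Proof.
  unfold bump, bump'.
  replace (- 4 * x / d ^ 2 * Rmax 0 (1 - (x / d) ^ 2))
    with (scal (- (2 * x) / d ^ 2) (2 * Rmax 0 (1 - (x / d) ^ 2)))
    by (unfold scal; simpl; unfold mult; simpl; field; lra).
  apply (is_derive_comp (fun z => Rmax 0 z ^ 2) (fun x => 1 - (x / d) ^ 2)).
  - apply is_derive_Rmax_sqr.
  - auto_derive; auto. field. lra.
Qed.

Lemma continuous_Rmax_0 x : continuous (Rmax 0) x.
Proof.
  apply continuity_pt_filterlim. intros eps Heps. exists eps. split; [auto|].
  intros y [_ Hy]. eapply Rle_lt_trans; [|exact Hy]. simpl. unfold Rdist, Rmax, Rabs.
  repeat (destruct Rle_dec || destruct Rcase_abs); lra.
Qed.

Lemma continuous_bump' x : continuous (bump' d) x.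
Proof.
  unfold bump'. apply (continuous_mult (fun x => - 4 * x / d ^ 2)).
  - apply (is_derive_cont _ _ (- 4 / d ^ 2)). auto_derive; auto. field. lra.
  - apply (continuous_comp (fun x => 1 - (x / d) ^ 2) (Rmax 0)); [|apply continuous_Rmax_0].
    apply (is_derive_cont _ _ (- (2 * x / d ^ 2))). auto_derive; auto. field. lra.
Qed.

Lemma one_le_sqr_div x : d <= Rabs x -> 1 <= (x / d) ^ 2.
Proof.
  intros H. replace ((x / d) ^ 2) with (x ^ 2 / d ^ 2) by (field; lra).
  apply Rle_div_r; [apply pow_lt, Hd|]. rewrite <- (pow2_abs x). nra.
Qed.

Lemma bump_outside x : d <= Rabs x -> bump d x = 0.
Proof.
  intros H. unfold bump. rewrite Rmax_left; [ring|].
  pose proof (one_le_sqr_div x H). lra.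
Qed.

Lemma bump_range x : 0 <= bump d x <= 1.
Proof.
  unfold bump. pose proof (pow2_ge_0 (x / d)).
  assert (0 <= Rmax 0 (1 - (x / d) ^ 2) <= 1).
  { split; [apply Rmax_l | apply Rmax_lub; lra]. }
  split; [apply pow_le; lra|].
  apply Rle_trans with (1 ^ 2); [apply pow_incr; lra | lra].
Qed.

Lemma bump'_bound x : Rabs (bump' d x) <= 4 / d.
Proof.
  unfold bump'. destruct (Rle_lt_dec d (Rabs x)) as [H|H].
  - rewrite Rmax_left, Rmult_0_r, Rabs_R0; [apply Rlt_le, Rdiv_lt_0_compat; lra|].
    pose proof (one_le_sqr_div x H). lra.
  - assert (0 <= Rmax 0 (1 - (x / d) ^ 2) <= 1).
    { split; [apply Rmax_l|]. pose proof (pow2_ge_0 (x / d)). apply Rmax_lub; lra. }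
    rewrite Rabs_mult. rewrite (Rabs_right (Rmax _ _)) by lra.
    replace (- 4 * x / d ^ 2) with (- (4 / d ^ 2) * x) by (field; lra).
    assert (0 < 4 / d ^ 2) by (apply Rdiv_lt_0_compat; [lra | apply pow_lt, Hd]).
    rewrite Rabs_mult, Rabs_Ropp, (Rabs_right (4 / d ^ 2)) by lra.
    replace (4 / d) with (4 / d ^ 2 * d * 1) by (field; lra).
    apply Rmult_le_compat; try lra.
    + apply Rmult_le_pos; [lra | apply Rabs_pos].
    + apply Rmult_le_compat_l; lra.
Qed.

Lemma RInt_bump_pos : 0 < RInt (bump d) (- d) d.
Proof.
  apply RInt_gt_0; [lra| |].
  - intros x Hx. unfold bump. apply pow_lt.
    assert (H : (x / d) ^ 2 < 1).
    { replace ((x / d) ^ 2) with (x ^ 2 / d ^ 2) by (field; lra).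
      apply Rlt_div_l; [apply pow_lt, Hd|]. nra. }
    rewrite Rmax_right; lra.
  - intros x _. eapply is_derive_cont, is_derive_bump.
Qed.

End Bump.

(** * Localised planar integrals, uniformly over the torus *)

Definition wave (t a b th x y : R) : R := cos (t * (king x * king y) + a * x + b * y + th).

Lemma continuity_2d_pt_wave t a b th x y : continuity_2d_pt (wave t a b th) x y.
Proof.
  unfold wave. apply (continuity_2d_pt_comp1 cos); [apply continuous_cos|].
  assert (Hx : forall f : R -> R, continuous f x -> continuity_2d_pt (fun u _ => f u) x y)
    by (intros; now apply continuity_2d_pt_fst).
  assert (Hy : forall f : R -> R, continuous f y -> continuity_2d_pt (fun _ v => f v) x y).
  { intros f Hf. apply (continuity_2d_pt_comp1 f); [exact Hf | apply continuity_2d_pt_id2]. }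
  repeat apply continuity_2d_pt_plus; try apply continuity_2d_pt_const;
    repeat apply continuity_2d_pt_mult; try apply continuity_2d_pt_const;
    try apply continuity_2d_pt_id1; try apply continuity_2d_pt_id2.
  - apply Hx, continuous_king. - apply Hy, continuous_king.
Qed.

Lemma continuity_2d_pt_snd (f : R -> R) (x y : R) :
  continuous f y -> continuity_2d_pt (fun _ v => f v) x y.
Proof. intros H. apply (continuity_2d_pt_comp1 f); [exact H | apply continuity_2d_pt_id2]. Qed.

Lemma RInt2_support (h : R -> R -> R) (x1 y1 d a b c e : R) :
  0 < d -> (forall x y, continuity_2d_pt h x y) ->
  (forall x y, d <= Rabs (x - x1) \/ d <= Rabs (y - y1) -> h x y = 0) ->
  a <= x1 - d -> x1 + d <= b -> c <= y1 - d -> y1 + d <= e ->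
  RInt (fun y => RInt (fun x => h x y) a b) c e
  = RInt (fun y => RInt (fun x => h x y) (x1 - d) (x1 + d)) (y1 - d) (y1 + d).
Proof.
  intros Hd Hc Hz Ha Hb Hc' He.
  rewrite (RInt_congr _ (fun y => RInt (fun x => h x y) (x1 - d) (x1 + d))).
  - apply RInt_zero_outside; try lra.
    + intros y _. apply (continuous_RInt_param (fun y x => h x y)).
      intros u v. apply continuity_2d_pt_swap, Hc.
    + intros y Hy. rewrite (RInt_congr _ (fun _ => 0)).
      * apply RInt_zero.
      * intros x. apply Hz. right. rewrite Rabs_left1; lra.
    + intros y Hy. rewrite (RInt_congr _ (fun _ => 0)).
      * apply RInt_zero.
      * intros x. apply Hz. right. rewrite Rabs_right; lra.
  - intros y. apply RInt_zero_outside; try lra.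
    + intros x _. apply (continuity_2d_pt_slice1 h x y), Hc.
    + intros x Hx. apply Hz. left. rewrite Rabs_left1; lra.
    + intros x Hx. apply Hz. left. rewrite Rabs_right; lra.
Qed.

(** The frequencies [a] and [b] are arbitrary reals, and the centre of the bump is decoupled from
    the point where the phase was analysed. Compactness can then supply a single radius for all
    centres. *)
Definition bump_bound (d x1 y1 K : R) : Prop :=
  forall t a b th eta, 0 < eta <= 1 -> t * eta ^ 4 = 1 ->
  Rabs (RInt (fun y => RInt (fun x => bump d (x - x1) * bump d (y - y1) * wave t a b th x y)
    (x1 - d) (x1 + d)) (y1 - d) (y1 + d)) <= K * eta ^ 3.

Lemma is_derive_bump_shift d c x : 0 < d -> is_derive (fun x => bump d (x - c)) x (bump' d (x - c)).
Proof.
  intros Hd. replace (bump' d (x - c)) with (scal 1 (bump' d (x - c))) by apply Rmult_1_l.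
  apply (is_derive_comp (bump d) (fun x => x - c)); [now apply is_derive_bump|].
  auto_derive; auto.
Qed.

Lemma continuous_shift (f : R -> R) c x : continuous f (x - c) -> continuous (fun x => f (x - c)) x.
Proof.
  intros H. apply (continuous_comp (fun x => x - c) f); auto.
  apply (continuous_minus (fun x => x) (fun _ => c)); [apply continuous_id | apply continuous_const].
Qed.

Lemma C1_partials_bump d x1 y1 : 0 < d ->
  C1_partials (fun _ _ => True) (fun u v => bump d (u - x1) * bump d (v - y1))
    (fun u v => bump' d (u - x1) * bump d (v - y1)) (fun u v => bump d (u - x1) * bump' d (v - y1)).
Proof.
  intros Hd. apply (C1_partials_prod _ (fun u => bump d (u - x1)) (fun u => bump' d (u - x1))
    (fun v => bump d (v - y1)) (fun v => bump' d (v - y1)));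
  intros x; try (now apply is_derive_bump_shift);
  apply (continuous_shift (bump' d)); now apply continuous_bump'.
Qed.

Lemma Rabs_bump d x : Rabs (bump d x) <= 1.
Proof. destruct (bump_range d x). rewrite Rabs_right; lra. Qed.

Lemma continuity_2d_pt_bump d x1 y1 x y : 0 < d ->
  continuity_2d_pt (fun u v => bump d (u - x1) * bump d (v - y1)) x y.
Proof.
  intros Hd. apply (C1_partials_cont (fun _ _ => True) _ _ _ x y) with (2 := C1_partials_bump d x1 y1 Hd); auto.
  intros u v _. exists (mkposreal 1 Rlt_0_1). auto.
Qed.

(** Halving [rho] keeps the support of a nearby bump inside the box of [decays_near], whose
    frequencies are taken as [- a / t] and [- b / t]. The constant [1 + 8 / d] bounds the amplitude
    and its partials; it is the one needed in sheared coordinates, where two terms of size [4 / d]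
    add up. *)
Lemma bump_bound_direct x0 y0 :
  decays_near (fun u v => king u * king v) x0 y0 ->
  exists rho K, 0 < rho /\ 0 < K /\ forall d x1 y1, 0 < d <= rho ->
    Rabs (x1 - x0) < rho -> Rabs (y1 - y0) < rho -> bump_bound d x1 y1 (K * (1 + 8 / d)).
Proof.
  intros [rho [K [Hr [HK H]]]]. exists (rho / 2), K. split; [lra|]. split; [auto|].
  intros d x1 y1 Hd Hx Hy t a b th eta He Ht.
  assert (Htp : 0 < t) by (apply (weight_t_pos t eta); lra).
  assert (H8 : 0 < 4 / d) by (apply Rdiv_lt_0_compat; lra).
  specialize (H _ _ _ (1 + 8 / d) (- (a / t)) (- (b / t)) th t eta (C1_partials_bump d x1 y1 (proj1 Hd))).
  assert (Hfar : forall u c c0, Rabs (c - c0) < rho / 2 -> ~ Rabs (u - c0) < rho -> d <= Rabs (u - c)).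
  { intros u c c0 H1 H2. apply Rnot_lt_le; intros H3. apply H2.
    replace (u - c0) with ((u - c) + (c - c0)) by ring.
    eapply Rle_lt_trans; [apply Rabs_triang|]. lra. }
  assert (Hb : forall u v,
    Rabs (bump d (u - x1) * bump d (v - y1)) <= 1 + 8 / d /\
    Rabs (bump' d (u - x1) * bump d (v - y1)) <= 1 + 8 / d /\
    Rabs (bump d (u - x1) * bump' d (v - y1)) <= 1 + 8 / d).
  { intros u v. split; [|split].
    - apply Rle_trans with (1 * 1); [|lra]. apply Rabs_mult_le; apply Rabs_bump.
    - apply Rle_trans with (4 / d * 1); [|lra]. apply Rabs_mult_le; [apply bump'_bound; lra | apply Rabs_bump].
    - apply Rle_trans with (1 * (4 / d)); [|lra]. apply Rabs_mult_le; [apply Rabs_bump | apply bump'_bound; lra]. }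
  specialize (H Hb).
  assert (Hs : forall u v, ~ box x0 y0 rho u v -> bump d (u - x1) * bump d (v - y1) = 0).
  { intros u v Hn. destruct (Rlt_dec (Rabs (u - x0)) rho) as [Hu|Hu].
    - rewrite (bump_outside d (proj1 Hd) (v - y1)); [ring|].
      apply (Hfar v y1 y0); [lra|]. intros Hv. apply Hn. now split.
    - rewrite (bump_outside d (proj1 Hd) (u - x1)); [ring|]. apply (Hfar u x1 x0); auto. }
  specialize (H Hs He Ht).
  rewrite (RInt_congr _ (fun v => RInt (fun u => bump d (u - x1) * bump d (v - y1) * wave t a b th u v)
    (x0 - rho) (x0 + rho))) in H.
  2: { intros v. apply RInt_congr. intros u. unfold wave. do 2 f_equal. field. lra. }
  apply Rabs_def2 in Hx, Hy.
  rewrite (RInt2_support (fun u v => bump d (u - x1) * bump d (v - y1) * wave t a b th u v) x1 y1 d) in H;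
    try lra.
  - intros x y. apply continuity_2d_pt_mult; [apply continuity_2d_pt_bump; lra | apply continuity_2d_pt_wave].
  - intros x y [Hz|Hz]; rewrite (bump_outside d (proj1 Hd) _ Hz); ring.
Qed.

(** The phase is symmetric in its variables, so points where only [Phi_yy] is nonzero reduce to
    those where [Phi_xx] is. *)
Lemma bump_bound_sym d x1 y1 K : 0 < d -> bump_bound d y1 x1 K -> bump_bound d x1 y1 K.
Proof.
  intros Hd H t a b th eta He Ht. specialize (H t b a th eta He Ht).
  rewrite <- Fubini in H; try lra.
  - erewrite RInt_congr; [exact H|]. intros y. apply RInt_congr. intros x.
    unfold wave. rewrite (Rmult_comm (king x)), (Rmult_comm (bump d (x - x1))). do 2 f_equal. ring.
  - intros x y _ _. apply continuity_2d_pt_mult; [apply continuity_2d_pt_bump; lra | apply continuity_2d_pt_wave].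
Qed.

(** The map [(u, v) -> (u, u + v)] has Jacobian 1 and acts as a translation of the inner variable at
    fixed [u]. The frequency in [u] becomes [a + b], and [rho / 4] absorbs the four displacements
    that add up in [v]. *)
Lemma bump_bound_shear x0 y0 :
  decays_near (fun u v => king u * king (u + v)) x0 (y0 - x0) ->
  exists rho K, 0 < rho /\ 0 < K /\ forall d x1 y1, 0 < d <= rho ->
    Rabs (x1 - x0) < rho -> Rabs (y1 - y0) < rho -> bump_bound d x1 y1 (K * (1 + 8 / d)).
Proof.
  intros [rho [K [Hr [HK H]]]]. exists (rho / 4), K. split; [lra|]. split; [auto|].
  intros d x1 y1 Hd Hx Hy t a b th eta He Ht.
  assert (Hdp := proj1 Hd).
  assert (Htp : 0 < t) by (apply (weight_t_pos t eta); lra).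
  assert (H8 : 0 < 4 / d) by (apply Rdiv_lt_0_compat; lra).
  set (A := fun u v => bump d (u - x1) * bump d (u + v - y1)).
  assert (Hc2 : forall (f g : R -> R) u v, (forall x, continuous f x) -> (forall x, continuous g x) ->
     continuity_2d_pt (fun u v => f (u - x1) * g (u + v - y1)) u v).
  { intros f g u v Hf Hg. apply continuity_2d_pt_mult.
    - apply (continuity_2d_pt_fst (fun u => f (u - x1))). now apply continuous_shift.
    - apply (continuity_2d_pt_comp1 g); auto.
      repeat apply continuity_2d_pt_plus; try apply continuity_2d_pt_const;
        [apply continuity_2d_pt_id1 | apply continuity_2d_pt_id2]. }
  assert (Cb : forall x, continuous (bump d) x) by (intros; eapply is_derive_cont, is_derive_bump; auto).
  assert (Cb' : forall x, continuous (bump' d) x) by (intros; now apply continuous_bump').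
  assert (HAC : C1_partials (fun _ _ => True) A
    (fun u v => bump' d (u - x1) * bump d (u + v - y1) + bump d (u - x1) * bump' d (u + v - y1))
    (fun u v => bump d (u - x1) * bump' d (u + v - y1))).
  { intros u v _. split; [|split; [|split]].
    - apply (is_derive_Rmult (fun u => bump d (u - x1)) (fun u => bump d (u + v - y1)));
        [now apply is_derive_bump_shift|].
      apply (is_derive_ext (fun u => bump d (u - (y1 - v)))); [intros; f_equal; ring|].
      replace (u + v - y1) with (u - (y1 - v)) by ring. now apply is_derive_bump_shift.
    - apply (is_derive_scal (fun v => bump d (u + v - y1)) v (bump d (u - x1))).
      apply (is_derive_ext (fun v => bump d (v - (y1 - u)))); [intros; f_equal; ring|].
      replace (u + v - y1) with (v - (y1 - u)) by ring. now apply is_derive_bump_shift.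
    - apply continuity_2d_pt_plus; apply Hc2; auto.
    - apply Hc2; auto. }
  assert (Hbb' : forall u v, Rabs (bump d u * bump' d v) <= 4 / d).
  { intros u v. apply Rle_trans with (1 * (4 / d)); [|lra].
    apply Rabs_mult_le; [apply Rabs_bump | now apply bump'_bound]. }
  assert (HAb : forall u v, Rabs (A u v) <= 1 + 8 / d /\
    Rabs (bump' d (u - x1) * bump d (u + v - y1) + bump d (u - x1) * bump' d (u + v - y1)) <= 1 + 8 / d /\
    Rabs (bump d (u - x1) * bump' d (u + v - y1)) <= 1 + 8 / d).
  { intros u v. split; [|split].
    - apply Rle_trans with (1 * 1); [|lra]. apply Rabs_mult_le; apply Rabs_bump.
    - eapply Rle_trans; [apply Rabs_triang|]. rewrite (Rmult_comm (bump' d (u - x1))).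
      pose proof (Hbb' (u + v - y1) (u - x1)). pose proof (Hbb' (u - x1) (u + v - y1)). lra.
    - pose proof (Hbb' (u - x1) (u + v - y1)). lra. }
  assert (HAs : forall u v, ~ box x0 (y0 - x0) rho u v -> A u v = 0).
  { intros u v Hn. unfold A.
    destruct (Rle_lt_dec d (Rabs (u - x1))) as [Hu|Hu]; [rewrite (bump_outside d Hdp _ Hu); ring|].
    destruct (Rle_lt_dec d (Rabs (u + v - y1))) as [Hv|Hv]; [rewrite (bump_outside d Hdp _ Hv); ring|].
    exfalso. apply Hn. apply Rabs_def2 in Hx, Hy, Hu, Hv. split; apply Rabs_def1; lra. }
  specialize (H A _ _ (1 + 8 / d) (- ((a + b) / t)) (- (b / t)) th t eta HAC HAb HAs He Ht).
  set (W := fun u v => A u v * wave t a b th u (u + v)).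
  assert (HWc : forall u v, continuity_2d_pt W u v).
  { intros u v. apply continuity_2d_pt_mult; [apply Hc2; auto|].
    apply (continuity_2d_pt_comp2 (wave t a b th) (fun u v => u) (fun u v => u + v)).
    - apply continuity_2d_pt_wave.
    - apply continuity_2d_pt_id1.
    - apply continuity_2d_pt_plus; [apply continuity_2d_pt_id1 | apply continuity_2d_pt_id2]. }
  rewrite (RInt_congr _ (fun v => RInt (fun u => W u v) (x0 - rho) (x0 + rho))) in H.
  2: { intros v. apply RInt_congr. intros u. unfold W, wave. do 2 f_equal. field. lra. }
  rewrite <- (Fubini W) in H; auto; try lra.
  apply Rabs_def2 in Hx, Hy.
  set (g := fun x y => bump d (x - x1) * bump d (y - y1) * wave t a b th x y).
  assert (Hgc : forall x y, continuity_2d_pt g x y).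
  { intros x y. apply continuity_2d_pt_mult; [apply continuity_2d_pt_bump; lra | apply continuity_2d_pt_wave]. }
  assert (Hz : forall x y, d <= Rabs (x - x1) \/ d <= Rabs (y - y1) -> g x y = 0).
  { intros x y [Hz|Hz]; unfold g; rewrite (bump_outside d Hdp _ Hz); ring. }
  assert (E : RInt (fun x => RInt (fun v => W x v) (y0 - x0 - rho) (y0 - x0 + rho)) (x0 - rho) (x0 + rho)
    = RInt (fun y => RInt (fun x => g x y) (x1 - d) (x1 + d)) (y1 - d) (y1 + d)).
  { rewrite <- (RInt2_support g x1 y1 d (x0 - rho) (x0 + rho) (y1 - d) (y1 + d)); auto; try lra.
    rewrite <- (Fubini g); auto; try lra.
    apply RInt_congr. intros x.
    destruct (Rle_lt_dec d (Rabs (x - x1))) as [Hu|Hu].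
    - rewrite (RInt_congr (fun v => W x v) (fun _ => 0)), (RInt_congr (fun y => g x y) (fun _ => 0)).
      + now rewrite !RInt_zero.
      + intros y. apply Hz. now left.
      + intros v. unfold W, A. rewrite (bump_outside d Hdp _ Hu). ring.
    - apply Rabs_def2 in Hu.
      (* The sheared domain and the support of the bump differ, so both integrals are compared on
         the translated interval, which contains that support. *)
      rewrite <- (RInt_zero_outside (fun y => g x y) (y0 - x0 - rho + x) (y0 - x0 + rho + x)
        (y1 - d) (y1 + d)); try lra.
      + rewrite <- (RInt_shift (fun y => g x y)).
        * apply RInt_congr. intros v. unfold W, g, A. now rewrite (Rplus_comm v).
        * intros y. apply (continuity_2d_pt_slice2 g x y), Hgc.
      + intros y _. apply (continuity_2d_pt_slice2 g x y), Hgc.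
      + intros y Hyy. apply Hz. right. rewrite Rabs_left1; lra.
      + intros y Hyy. apply Hz. right. rewrite Rabs_right; lra. }
  rewrite E in H. exact H.
Qed.

Lemma bump_bound_local x0 y0 :
  exists rho K, 0 < rho /\ 0 < K /\ forall d x1 y1, 0 < d <= rho ->
    Rabs (x1 - x0) < rho -> Rabs (y1 - y0) < rho -> bump_bound d x1 y1 (K * (1 + 8 / d)).
Proof.
  destruct (Req_dec (king2 x0 * king y0) 0) as [H1|H1].
  - destruct (Req_dec (king2 y0 * king x0) 0) as [H2|H2].
    + apply bump_bound_shear, decays_near_king_shear; lra.
    + destruct (bump_bound_direct y0 x0 (decays_near_king_dom _ _ H2)) as [rho [K [Hr [HK H]]]].
      exists rho, K. split; [auto|]. split; [auto|]. intros. apply bump_bound_sym; [lra|]. now apply H.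
  - apply bump_bound_direct, decays_near_king_dom, H1.
Qed.

(** The gauge given to compactness is the minimum of the local radius and the inverse of the local
    constant. The resulting [d] is then below some local radius near each centre and at the same
    time bounds the corresponding constant by [/ d]. *)
Lemma bump_bound_uniform a b :
  exists d K, 0 < d /\ 0 < K /\
    forall x1 y1, a <= x1 <= b -> a <= y1 <= b -> bump_bound d x1 y1 K.
Proof.
  assert (Hch : forall p : R * R, exists q : R * R, 0 < fst q /\ 0 < snd q /\
    forall d x1 y1, 0 < d <= fst q -> Rabs (x1 - fst p) < fst q -> Rabs (y1 - snd p) < fst q ->
      bump_bound d x1 y1 (snd q * (1 + 8 / d))).
  { intros [x y]. destruct (bump_bound_local x y) as [rho [K H]]. exists (rho, K). exact H. }
  set (sel := fun p => proj1_sig (constructive_indefinite_description _ (Hch p))).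
  assert (Hsel : forall p, 0 < fst (sel p) /\ 0 < snd (sel p) /\
    forall d x1 y1, 0 < d <= fst (sel p) -> Rabs (x1 - fst p) < fst (sel p) ->
      Rabs (y1 - snd p) < fst (sel p) -> bump_bound d x1 y1 (snd (sel p) * (1 + 8 / d))).
  { intros p. unfold sel. destruct (constructive_indefinite_description _ (Hch p)) as [q Hq]. exact Hq. }
  assert (Hpos : forall u v, 0 < Rmin (fst (sel (u, v))) (/ snd (sel (u, v)))).
  { intros u v. destruct (Hsel (u, v)) as (H1 & H2 & _).
    apply Rmin_glb_lt; [auto | now apply Rinv_0_lt_compat]. }
  destruct (compactness_value_2d a b a b (fun u v => mkposreal _ (Hpos u v))) as [d Hd].
  assert (Hdp : 0 < d) by apply cond_pos.
  assert (H8 : 0 < 8 / d) by (apply Rdiv_lt_0_compat; lra).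
  exists d, (/ d * (1 + 8 / d)). split; [auto|]. split.
  { apply Rmult_lt_0_compat; [now apply Rinv_0_lt_compat | lra]. }
  intros x1 y1 Hx Hy t a0 b0 th eta He Ht.
  (* Compactness yields the base point only under a double negation, hence the argument by
     contradiction. *)
  apply Rnot_lt_le; intros Hlt. apply (Hd x1 y1 Hx Hy).
  intros [u [v [_ [_ [Hu [Hv Hduv]]]]]]. simpl in Hu, Hv, Hduv.
  destruct (Hsel (u, v)) as (H1 & H2 & H3). simpl in H3.
  pose proof (Rmin_l (fst (sel (u, v))) (/ snd (sel (u, v)))) as M1.
  pose proof (Rmin_r (fst (sel (u, v))) (/ snd (sel (u, v)))) as M2.
  specialize (H3 d x1 y1 ltac:(lra) ltac:(lra) ltac:(lra) t a0 b0 th eta He Ht).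
  assert (HKd : snd (sel (u, v)) <= / d).
  { rewrite <- (Rinv_inv (snd (sel (u, v)))). apply Rinv_le_contravar; lra. }
  assert (0 < eta ^ 3) by (apply pow_lt; lra).
  assert (snd (sel (u, v)) * (1 + 8 / d) * eta ^ 3 <= / d * (1 + 8 / d) * eta ^ 3).
  { apply Rmult_le_compat_r; [lra|]. apply Rmult_le_compat_r; lra. }
  lra.
Qed.

(** * From localised integrals to integrals over a period *)

Lemma RInt_periodic_shift (h : R -> R) (p z : R) :
  (forall x, continuous h x) -> (forall x, h (x + p) = h x) ->
  RInt (fun x => h (x + z)) 0 p = RInt h 0 p.
Proof.
  intros Hc Hp.
  assert (Hex : forall a b, ex_RInt h a b)
    by (intros; apply (ex_RInt_continuous (V := R_CompleteNormedModule)); auto).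
  assert (E1 : RInt h 0 z = RInt h p (z + p)).
  { rewrite (RInt_congr _ (fun x => h (x + p))) by (intros; now rewrite Hp).
    rewrite RInt_shift by auto. f_equal; ring. }
  assert (C1 : plus (RInt h 0 z) (RInt h z (p + z)) = RInt h 0 (p + z)).
  { apply (RInt_Chasles (V := R_CompleteNormedModule)); auto. }
  assert (C2 : plus (RInt h 0 p) (RInt h p (p + z)) = RInt h 0 (p + z)).
  { apply (RInt_Chasles (V := R_CompleteNormedModule)); auto. }
  unfold plus in C1, C2; simpl in C1, C2.
  rewrite RInt_shift, Rplus_0_l by auto. rewrite (Rplus_comm z p) in E1. lra.
Qed.

Lemma RInt_bump_shift (d c : R) (h : R -> R) : 0 < d -> (forall x, continuous h x) ->
  RInt (fun x => bump d (x - c) * h x) (c - d) (c + d)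
  = RInt (fun z => bump d z * h (z + c)) (- d) d.
Proof.
  intros Hd Hc. symmetry. rewrite (RInt_congr _ (fun z => bump d (z + c - c) * h (z + c)))
    by (intros z; now replace (z + c - c) with z by ring).
  rewrite (RInt_shift (fun x => bump d (x - c) * h x)).
  - f_equal; ring.
  - intros x. apply (continuous_mult (fun x => bump d (x - c)) h); auto.
    apply continuous_shift. eapply is_derive_cont, is_derive_bump, Hd.
Qed.

(* Averaging the localised integral over the centre of the bump recovers the
   integral over a period. *)
Lemma Rabs_RInt_periodic_le (d p S : R) (h : R -> R) :
  0 < d -> 0 <= p -> (forall x, continuous h x) -> (forall x, h (x + p) = h x) ->
  (forall c, 0 <= c <= p -> Rabs (RInt (fun x => bump d (x - c) * h x) (c - d) (c + d)) <= S) ->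
  Rabs (RInt h 0 p) <= p / RInt (bump d) (- d) d * S.
Proof.
  intros Hd Hp Hc Hper HS.
  pose proof (RInt_bump_pos d Hd) as Hb. set (m := RInt (bump d) (- d) d) in *.
  assert (Cb : forall x, continuous (bump d) x) by (intros; eapply is_derive_cont, is_derive_bump; auto).
  assert (C2 : forall c z, continuity_2d_pt (fun c z => bump d z * h (z + c)) c z).
  { intros c z. apply continuity_2d_pt_mult; [now apply continuity_2d_pt_snd|].
    apply (continuity_2d_pt_comp1 h); auto.
    apply continuity_2d_pt_plus; [apply continuity_2d_pt_id2 | apply continuity_2d_pt_id1]. }
  assert (E : RInt (fun c => RInt (fun z => bump d z * h (z + c)) (- d) d) 0 p = m * RInt h 0 p).
  { rewrite (Fubini (fun c z => bump d z * h (z + c)) 0 p (- d) d); auto; try lra.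
    rewrite Rmult_comm, (RInt_congr _ (fun z => RInt h 0 p * bump d z)).
    - apply RInt_Rscal, ex_RInt_all, Cb.
    - intros z. rewrite (Rmult_comm (RInt h 0 p)), <- (RInt_periodic_shift h p z) by auto.
      rewrite (RInt_congr _ (fun x => bump d z * h (x + z))) by (intros; now rewrite (Rplus_comm z)).
      apply RInt_Rscal, ex_RInt_all. intros x. apply (continuous_comp (fun x => x + z) h); auto.
      apply (continuous_plus (fun x => x) (fun _ => z)); [apply continuous_id | apply continuous_const]. }
  assert (H : Rabs (m * RInt h 0 p) <= (p - 0) * S).
  { rewrite <- E. apply abs_RInt_le_const; auto.
    - apply (ex_RInt_RInt_param (fun c z => bump d z * h (z + c))); auto; lra.
    - intros c Hcp. rewrite <- RInt_bump_shift by auto. auto. }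
  rewrite Rabs_mult, (Rabs_right m) in H by lra.
  apply (Rmult_le_reg_l m); [auto|].
  replace (m * (p / m * S)) with ((p - 0) * S) by (field; lra). exact H.
Qed.

Lemma cos_period_IZR x (n : Z) : cos (x + IZR n * (2 * PI)) = cos x.
Proof.
  destruct (Z.le_gt_cases 0 n) as [H|H].
  - destruct (Z_of_nat_complete n H) as [k ->]. rewrite <- INR_IZR_INZ.
    rewrite <- (cos_period x k). f_equal. ring.
  - destruct (Z_of_nat_complete (- n) ltac:(lia)) as [k Hk].
    rewrite <- (cos_period (x + IZR n * (2 * PI)) k). f_equal.
    rewrite INR_IZR_INZ, <- Hk, opp_IZR. ring.
Qed.

Lemma king_period x : king (x + 2 * PI) = king x.
Proof. unfold king. rewrite <- (cos_period_IZR x 1). do 3 f_equal. ring. Qed.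

(** Integer frequencies make the integrand periodic, as the averaging over bump centres requires. It
    is applied in [y] and then, after exchanging the integrals, in [x], in place of a partition of
    unity. *)
Lemma king_kernel_decay :
  exists K, 0 < K /\ forall (t th eta : R) (n m : Z), 0 < eta <= 1 -> t * eta ^ 4 = 1 ->
  Rabs (RInt (fun y => RInt (fun x => wave t (IZR n) (IZR m) th x y) 0 (2 * PI)) 0 (2 * PI))
  <= K * eta ^ 3.
Proof.
  pose proof PI_RGT_0 as HPI.
  destruct (bump_bound_uniform 0 (2 * PI)) as [d [K [Hd [HK H]]]].
  pose proof (RInt_bump_pos d Hd) as Hb. set (c0 := RInt (bump d) (- d) d) in *.
  set (q := 2 * PI / c0).
  assert (Hq : 0 < q) by (apply Rdiv_lt_0_compat; lra).
  exists (q * (q * K)). split; [apply Rmult_lt_0_compat; [lra | now apply Rmult_lt_0_compat]|].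
  intros t th eta n m He Ht.
  set (k := wave t (IZR n) (IZR m) th).
  assert (Hkc : forall x y, continuity_2d_pt k x y) by (intros; apply continuity_2d_pt_wave).
  assert (Hkx : forall x y, k (x + 2 * PI) y = k x y).
  { intros x y. unfold k, wave. rewrite king_period.
    rewrite <- (cos_period_IZR (t * (king x * king y) + IZR n * x + IZR m * y + th) n). f_equal. ring. }
  assert (Hky : forall x y, k x (y + 2 * PI) = k x y).
  { intros x y. unfold k, wave. rewrite king_period.
    rewrite <- (cos_period_IZR (t * (king x * king y) + IZR n * x + IZR m * y + th) m). f_equal. ring. }
  assert (Cb : forall x, continuous (bump d) x) by (intros; eapply is_derive_cont, is_derive_bump; auto).
  replace (q * (q * K) * eta ^ 3) with (q * (q * (K * eta ^ 3))) by ring.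
  apply Rabs_RInt_periodic_le; auto; try lra.
  { intros y. apply (continuous_RInt_param (fun y x => k x y)).
    intros u v. apply (continuity_2d_pt_swap k), Hkc. }
  { intros y. apply RInt_congr. intros x. apply Hky. }
  intros y1 Hy1.
  assert (Hyc : forall x y, continuity_2d_pt (fun x y => bump d (y - y1) * k x y) x y).
  { intros x y. apply continuity_2d_pt_mult; auto.
    apply (continuity_2d_pt_snd (fun y => bump d (y - y1))). now apply continuous_shift. }
  rewrite (RInt_congr _ (fun y => RInt (fun x => bump d (y - y1) * k x y) 0 (2 * PI))).
  2: { intros y. symmetry. apply RInt_Rscal.
       apply ex_RInt_cont; [lra|]. intros x _. apply (continuity_2d_pt_slice1 k x y), Hkc. }
  rewrite <- (Fubini (fun x y => bump d (y - y1) * k x y)); auto; try lra.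
  apply Rabs_RInt_periodic_le; auto; try lra.
  { intros x. apply (continuous_RInt_param (fun x y => bump d (y - y1) * k x y)); auto. }
  { intros x. apply RInt_congr. intros y. now rewrite Hkx. }
  intros x1 Hx1.
  rewrite (RInt_congr _ (fun x => RInt (fun y => bump d (x - x1) * bump d (y - y1) * k x y) (y1 - d) (y1 + d))).
  2: { intros x. rewrite (RInt_congr (fun y => bump d (x - x1) * bump d (y - y1) * k x y)
           (fun y => bump d (x - x1) * (bump d (y - y1) * k x y)))
         by (intros; ring).
       symmetry. apply RInt_Rscal.
       apply ex_RInt_cont; [lra|]. intros y _.
       apply (continuity_2d_pt_slice2 (fun x y => bump d (y - y1) * k x y) x y), Hyc. }
  rewrite (Fubini (fun x y => bump d (x - x1) * bump d (y - y1) * k x y)); try lra.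
  - apply H; auto.
  - intros x y _ _. apply continuity_2d_pt_mult; [now apply continuity_2d_pt_bump | auto].
Qed.

(** * The vertical kernel and integrals over the torus *)

(** On the outer thirds of [[0, PI]] the cosine is at least 1/2 in absolute value and the second
    derivative of the phase decides; on the middle third the sine is, and the third derivative does.
    The constant is [10 + 22 + 10], and [eta <= 1] turns [t * eta^3 = 1] into [t * eta^2 >= 1]. The
    sign [sg] serves the other half period. *)
Lemma chain_half_decay (sg t a th eta : R) :
  sg = 1 \/ sg = -1 -> 0 < eta <= 1 -> t * eta ^ 3 = 1 ->
  Rabs (RInt (fun z => cos (sg * (2 * t) * cos z + a * z + th)) 0 PI) <= 42 * eta.
Proof.
  intros Hsg He Ht. pose proof PI_RGT_0 as HPI.
  set (ph := fun (i : nat) (z : R) => match i with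
    | O => sg * (2 * t) * cos z + a * z + th
    | 1%nat => - (sg * (2 * t) * sin z) + a
    | 2%nat => - (sg * (2 * t) * cos z)
    | _ => sg * (2 * t) * sin z end).
  assert (Hder : forall i x, (i < 3)%nat -> is_derive (ph i) x (ph (S i) x)).
  { intros i x Hi. destruct i as [|[|[|i]]]; try lia; unfold ph; auto_derive; auto; ring. }
  assert (Hcont : forall x, continuous (ph 0%nat) x) by (intros; eapply is_derive_cont, Hder; lia).
  assert (Hcos : forall p q, 0 <= p -> p <= q -> q <= PI ->
     (forall z, p <= z <= q -> / 2 <= cos z) \/ (forall z, p <= z <= q -> cos z <= - / 2) ->
     Rabs (RInt (fun z => cos (ph O z)) p q) <= 10 * eta).
  { intros p q Hp Hpq Hq Hs.
    destruct Hsg as [-> | ->]; destruct Hs as [Hs|Hs].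
    2, 3: apply (van_der_corput 0 ph); try lra; [intros; apply Hder; lia
      | intros; apply (is_derive_cont _ _ (ph 3%nat x)), Hder; lia
      | intros x Hx; specialize (Hs x Hx); simpl; nra].
    all: rewrite (RInt_congr _ (fun z => cos (- ph O z))) by (intros; symmetry; apply cos_neg);
      apply (van_der_corput 0 (fun i z => - ph i z)); try lra; [intros; apply (is_derive_opp (ph i)), Hder; lia
      | intros; apply (continuous_opp (ph 2%nat)), (is_derive_cont _ _ (ph 3%nat x)), Hder; lia
      | intros x Hx; specialize (Hs x Hx); simpl; nra]. }
  assert (Hsin : forall p q, 0 <= p -> p <= q -> q <= PI ->
     (forall z, p <= z <= q -> / 2 <= sin z) ->
     Rabs (RInt (fun z => cos (ph O z)) p q) <= 22 * eta).
  { assert (H22 : vdc_const 1 = 22) by (simpl; ring).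
    assert (Hc3 : forall x, continuous (ph 3%nat) x).
    { intros x. apply (is_derive_cont _ _ (sg * (2 * t) * cos x)). unfold ph. auto_derive; auto. ring. }
    assert (Hlow : forall z, / 2 <= sin z -> 1 <= eta ^ 3 * (2 * t * sin z)).
    { intros z Hz. rewrite <- Ht. nra. }
    intros p q Hp Hpq Hq Hs. rewrite <- H22.
    destruct Hsg as [E | E].
    - apply (van_der_corput 1 ph); try lra; [intros; apply Hder; lia | intros; apply Hc3|].
      intros x Hx. specialize (Hlow x (Hs x Hx)). simpl ph. rewrite E.
      change (1 + 2)%nat with 3%nat. lra.
    - rewrite (RInt_congr _ (fun z => cos (- ph O z))) by (intros; symmetry; apply cos_neg).
      apply (van_der_corput 1 (fun i z => - ph i z)); try lra;
        [intros; apply (is_derive_opp (ph i)), Hder; lia | intros; apply (continuous_opp (ph 3%nat)), Hc3|].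
      intros x Hx. specialize (Hlow x (Hs x Hx)). simpl ph. rewrite E.
      change (1 + 2)%nat with 3%nat. lra. }
  change (Rabs (RInt (fun z => cos (ph O z)) 0 PI) <= 42 * eta).
  assert (Hcc : forall x, continuous (fun z => cos (ph O z)) x) by (intros; now apply continuous_cos_comp).
  rewrite (RInt_split _ 0 (PI / 3) PI), (RInt_split _ (PI / 3) (2 * (PI / 3)) PI); auto; try lra.
  assert (C1 : cos (PI / 3) = / 2) by (rewrite cos_PI3; lra).
  assert (C2 : cos (2 * (PI / 3)) = - / 2) by (rewrite cos_2PI3; lra).
  assert (I1 : Rabs (RInt (fun z => cos (ph O z)) 0 (PI / 3)) <= 10 * eta).
  { apply Hcos; try lra. left. intros z Hz. rewrite <- C1. apply cos_decr_1; lra. }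
  assert (I4 : Rabs (RInt (fun z => cos (ph O z)) (2 * (PI / 3)) PI) <= 10 * eta).
  { apply Hcos; try lra. right. intros z Hz. rewrite <- C2. apply cos_decr_1; lra. }
  assert (I2 : Rabs (RInt (fun z => cos (ph O z)) (PI / 3) (2 * (PI / 3))) <= 22 * eta).
  { apply Hsin; try lra. intros z Hz.
    assert (cos z <= / 2) by (rewrite <- C1; apply cos_decr_1; lra).
    assert (- / 2 <= cos z) by (rewrite <- C2; apply cos_decr_1; lra).
    assert (0 <= sin z) by (apply sin_ge_0; lra).
    pose proof (sin2_cos2 z) as S. unfold Rsqr in S. nra. }
  eapply Rle_trans; [apply Rabs_triang|].
  eapply Rle_trans; [apply Rplus_le_compat_l, Rabs_triang|]. lra.
Qed.

Lemma chain_kernel_decay (t a th eta : R) :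
  0 < eta <= 1 -> t * eta ^ 3 = 1 ->
  Rabs (RInt (fun z => cos (2 * t * cos z + a * z + th)) 0 (2 * PI)) <= 84 * eta.
Proof.
  intros He Ht. pose proof PI_RGT_0 as HPI.
  assert (Hc : forall x, continuous (fun z => cos (2 * t * cos z + a * z + th)) x).
  { intros x. apply continuous_cos_comp.
    apply (is_derive_cont _ _ (- (2 * t * sin x) + a)). auto_derive; auto. ring. }
  rewrite (RInt_split _ 0 PI (2 * PI)); auto; try lra.
  replace (RInt (fun z => cos (2 * t * cos z + a * z + th)) 0 PI)
    with (RInt (fun z => cos (1 * (2 * t) * cos z + a * z + th)) 0 PI)
    by (apply RInt_congr; intros; do 3 f_equal; ring).
  (* Translation by [PI] changes the sign of [cos z] and contributes [a * PI] to the free phase. *)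
  replace (RInt (fun z => cos (2 * t * cos z + a * z + th)) PI (2 * PI))
    with (RInt (fun z => cos (-1 * (2 * t) * cos z + a * z + (a * PI + th))) 0 PI).
  2: { transitivity (RInt (fun z => cos (2 * t * cos z + a * z + th)) (0 + PI) (PI + PI));
         [|f_equal; ring].
       rewrite <- (RInt_shift (fun z => cos (2 * t * cos z + a * z + th))) by auto.
       apply RInt_congr. intros z. rewrite neg_cos. f_equal. ring. }
  pose proof (chain_half_decay 1 t a th eta (or_introl eq_refl) He Ht).
  pose proof (chain_half_decay (-1) t a (a * PI + th) eta (or_intror eq_refl) He Ht).
  eapply Rle_trans; [apply Rabs_triang|]. lra.
Qed.

(* The regularity that survives two integrations in [x] and [y] as continuity
   in [z], with no need for joint continuity in three variables. *)
Record admissible (F : R -> R -> R -> R) : Prop := {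
  adm_cont : forall x y z, continuity_2d_pt (fun x y => F x y z) x y;
  adm_bound : exists M, forall x y z, Rabs (F x y z) <= M;
  adm_lip : exists L, forall x y z z', Rabs (F x y z - F x y z') <= L * Rabs (z - z') }.

Lemma admissible_const c : admissible (fun _ _ _ => c).
Proof.
  split.
  - intros. apply continuity_2d_pt_const.
  - exists (Rabs c). intros; lra.
  - exists 0. intros. rewrite Rminus_diag, Rabs_R0. lra.
Qed.

Lemma admissible_plus F G :
  admissible F -> admissible G -> admissible (fun x y z => F x y z + G x y z).
Proof.
  intros [F1 [MF F2] [LF F3]] [G1 [MG G2] [LG G3]]. split.
  - intros. now apply continuity_2d_pt_plus.
  - exists (MF + MG). intros. eapply Rle_trans; [apply Rabs_triang|]. now apply Rplus_le_compat.
  - exists (LF + LG). intros x y z z'.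
    replace (F x y z + G x y z - (F x y z' + G x y z'))
      with ((F x y z - F x y z') + (G x y z - G x y z')) by ring.
    eapply Rle_trans; [apply Rabs_triang|]. rewrite Rmult_plus_distr_r. now apply Rplus_le_compat.
Qed.

Lemma admissible_mult F G :
  admissible F -> admissible G -> admissible (fun x y z => F x y z * G x y z).
Proof.
  intros [F1 [MF F2] [LF F3]] [G1 [MG G2] [LG G3]]. split.
  - intros. now apply continuity_2d_pt_mult.
  - exists (MF * MG). intros. now apply Rabs_mult_le.
  - exists (LF * MG + MF * LG). intros x y z z'.
    replace (F x y z * G x y z - F x y z' * G x y z')
      with ((F x y z - F x y z') * G x y z + F x y z' * (G x y z - G x y z')) by ring.
    eapply Rle_trans; [apply Rabs_triang|].
    replace ((LF * MG + MF * LG) * Rabs (z - z'))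
      with (LF * Rabs (z - z') * MG + MF * (LG * Rabs (z - z'))) by ring.
    apply Rplus_le_compat; now apply Rabs_mult_le.
Qed.

Lemma cos_lipschitz x y : Rabs (cos x - cos y) <= Rabs (x - y).
Proof.
  destruct (MVT_gen cos y x (fun z => - sin z)) as [c [_ E]].
  - intros z _. apply is_derive_Reals, derivable_pt_lim_cos.
  - intros z _. apply continuity_cos.
  - rewrite E, Rabs_mult, Rabs_Ropp. pose proof (Rabs_sin_le c). pose proof (Rabs_pos (x - y)). nra.
Qed.

Lemma admissible_cos F L :
  (forall x y z, continuity_2d_pt (fun x y => F x y z) x y) ->
  (forall x y z z', Rabs (F x y z - F x y z') <= L * Rabs (z - z')) ->
  admissible (fun x y z => cos (F x y z)).
Proof.
  intros H1 H2. split.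
  - intros x y z. apply (continuity_2d_pt_comp1 cos (fun x y => F x y z)); auto. apply continuous_cos.
  - exists 1. intros. apply Rabs_cos_le.
  - exists L. intros x y z z'. eapply Rle_trans; [apply cos_lipschitz | auto].
Qed.

Lemma admissible_pow F k : admissible F -> admissible (fun x y z => F x y z ^ k).
Proof.
  intros HF. induction k as [|k IH]; [apply (admissible_const 1)|].
  now apply (admissible_mult F (fun x y z => F x y z ^ k)).
Qed.

Definition torus_integral (F : R -> R -> R -> R) : R :=
  RInt (fun z => RInt (fun y => RInt (fun x => F x y z) 0 (2 * PI)) 0 (2 * PI)) 0 (2 * PI).

Lemma torus_integral_ext F G : (forall x y z, F x y z = G x y z) -> torus_integral F = torus_integral G.
Proof.
  intros H. apply RInt_congr; intros z. apply RInt_congr; intros y. apply RInt_congr; intros x. apply H.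
Qed.

Lemma two_PI_pos : 0 < 2 * PI.
Proof. pose proof PI_RGT_0. lra. Qed.

Section AdmissibleIntegral.

Variable F : R -> R -> R -> R.
Hypothesis HF : admissible F.

Lemma ex_RInt_adm1 a b y z : ex_RInt (fun x => F x y z) a b.
Proof.
  apply ex_RInt_all. intros x.
  apply (continuity_2d_pt_slice1 (fun x y => F x y z) x y), HF.
Qed.

Lemma ex_RInt_adm2 a b c d z : ex_RInt (fun y => RInt (fun x => F x y z) a b) c d.
Proof.
  apply ex_RInt_all. intros y.
  apply (continuous_RInt_param (fun y x => F x y z)).
  intros u v. apply (continuity_2d_pt_swap (fun x y => F x y z)), HF.
Qed.

Lemma ex_RInt_adm3 a b :
  ex_RInt (fun z => RInt (fun y => RInt (fun x => F x y z) 0 (2 * PI)) 0 (2 * PI)) a b.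
Proof.
  pose proof two_PI_pos as HP.
  apply ex_RInt_all. intros z.
  destruct (adm_lip F HF) as [L HL].
  assert (HL0 : 0 <= L).
  { specialize (HL 0 0 1 0). rewrite Rminus_0_r, Rabs_R1, Rmult_1_r in HL.
    eapply Rle_trans; [apply Rabs_pos | exact HL]. }
  (* The Lipschitz constant of the double integral in [z], plus 1 so that it can be divided by even
     if [L = 0]. *)
  set (Q := 2 * PI * (2 * PI * L) + 1).
  assert (HQ : 0 < Q) by (unfold Q;
    pose proof (Rmult_le_pos _ _ (Rlt_le _ _ HP) (Rmult_le_pos _ _ (Rlt_le _ _ HP) HL0)); lra).
  apply continuity_pt_filterlim. intros eps Heps.
  exists (eps / Q). split; [now apply Rdiv_lt_0_compat|].
  intros z' [_ Hz]. simpl in Hz. unfold Rdist in Hz. simpl. unfold Rdist.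
  rewrite <- RInt_Rminus by apply ex_RInt_adm2.
  assert (H1 : Rabs (RInt (fun y => minus (RInt (fun x => F x y z') 0 (2 * PI)) (RInt (fun x => F x y z) 0 (2 * PI))) 0 (2 * PI))
    <= (2 * PI - 0) * ((2 * PI - 0) * (L * Rabs (z' - z)))).
  { apply abs_RInt_le_const; [lra| |].
    - apply (ex_RInt_minus (V := R_CompleteNormedModule)); apply ex_RInt_adm2.
    - intros y _. rewrite <- RInt_Rminus by apply ex_RInt_adm1.
      apply abs_RInt_le_const; [lra| |].
      + apply (ex_RInt_minus (V := R_CompleteNormedModule)); apply ex_RInt_adm1.
      + intros x _. apply HL. }
  eapply Rle_lt_trans; [exact H1|].
  pose proof (Rabs_pos (z' - z)).
  apply Rle_lt_trans with (Q * Rabs (z' - z)); [unfold Q; lra|].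
  apply (Rmult_lt_compat_l Q) in Hz; [|auto].
  replace (Q * (eps / Q)) with eps in Hz by (field; lra). exact Hz.
Qed.

Lemma torus_integral_scal c : torus_integral (fun x y z => c * F x y z) = c * torus_integral F.
Proof.
  unfold torus_integral. rewrite (RInt_congr _ (fun z => c * RInt (fun y => RInt (fun x => F x y z) 0 (2 * PI)) 0 (2 * PI))).
  - apply RInt_Rscal, ex_RInt_adm3.
  - intros z. rewrite (RInt_congr _ (fun y => c * RInt (fun x => F x y z) 0 (2 * PI))).
    + apply RInt_Rscal, ex_RInt_adm2.
    + intros y. apply RInt_Rscal, ex_RInt_adm1.
Qed.

Lemma torus_integral_bound M : (forall x y z, Rabs (F x y z) <= M) -> Rabs (torus_integral F) <= (2 * PI) ^ 3 * M.
Proof.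
  intros H. pose proof two_PI_pos as HP.
  replace ((2 * PI) ^ 3 * M) with ((2 * PI - 0) * ((2 * PI - 0) * ((2 * PI - 0) * M))) by ring.
  apply abs_RInt_le_const; [lra | apply ex_RInt_adm3|]. intros z _.
  apply abs_RInt_le_const; [lra | apply ex_RInt_adm2|]. intros y _.
  apply abs_RInt_le_const; [lra | apply ex_RInt_adm1|]. intros x _. apply H.
Qed.

End AdmissibleIntegral.

Lemma torus_integral_plus F G : admissible F -> admissible G ->
  torus_integral (fun x y z => F x y z + G x y z) = torus_integral F + torus_integral G.
Proof.
  intros HF HG. unfold torus_integral.
  rewrite (RInt_congr _ (fun z => RInt (fun y => RInt (fun x => F x y z) 0 (2 * PI)) 0 (2 * PI)
    + RInt (fun y => RInt (fun x => G x y z) 0 (2 * PI)) 0 (2 * PI))).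
  - apply RInt_Rplus; now apply ex_RInt_adm3.
  - intros z. rewrite (RInt_congr _ (fun y => RInt (fun x => F x y z) 0 (2 * PI) + RInt (fun x => G x y z) 0 (2 * PI))).
    + apply RInt_Rplus; now apply ex_RInt_adm2.
    + intros y. apply RInt_Rplus; now apply ex_RInt_adm1.
Qed.

(** The addition formula factors an integral with separated phase into one-dimensional times planar
    integrals; in real form two products appear. *)
Lemma torus_integral_split (a : R -> R) (b : R -> R -> R) :
  (forall z, continuous a z) -> (forall x y, continuity_2d_pt b x y) ->
  torus_integral (fun x y z => cos (a z + b x y))
  = RInt (fun z => cos (a z)) 0 (2 * PI) * RInt (fun y => RInt (fun x => cos (b x y)) 0 (2 * PI)) 0 (2 * PI)
  - RInt (fun z => sin (a z)) 0 (2 * PI) * RInt (fun y => RInt (fun x => sin (b x y)) 0 (2 * PI)) 0 (2 * PI).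
Proof.
  intros Ha Hb. pose proof two_PI_pos as HP.
  assert (Cc : forall x y, continuity_2d_pt (fun x y => cos (b x y)) x y)
    by (intros; apply (continuity_2d_pt_comp1 cos); auto; apply continuous_cos).
  assert (Cs : forall x y, continuity_2d_pt (fun x y => sin (b x y)) x y)
    by (intros; apply (continuity_2d_pt_comp1 sin); auto; apply continuous_sin).
  set (Bc := RInt (fun y => RInt (fun x => cos (b x y)) 0 (2 * PI)) 0 (2 * PI)).
  set (Bs := RInt (fun y => RInt (fun x => sin (b x y)) 0 (2 * PI)) 0 (2 * PI)).
  unfold torus_integral. rewrite (RInt_congr _ (fun z => Bc * cos (a z) + - Bs * sin (a z) + 0 * 1)).
  - rewrite (RInt_lin3 (fun z => cos (a z)) (fun z => sin (a z)) (fun _ => 1)); try lra.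
    + intros. now apply continuous_cos_comp. + intros. now apply continuous_sin_comp.
    + intros. apply continuous_const.
  - intros z.
    assert (Hpar : forall f, (forall x y, continuity_2d_pt f x y) -> forall y, continuous (fun y => RInt (fun x => f x y) 0 (2 * PI)) y).
    { intros f Hf y. apply (continuous_RInt_param (fun y x => f x y)).
      intros u v. apply (continuity_2d_pt_swap f), Hf. }
    rewrite (RInt_congr _ (fun y => cos (a z) * RInt (fun x => cos (b x y)) 0 (2 * PI)
       + - sin (a z) * RInt (fun x => sin (b x y)) 0 (2 * PI) + 0 * 1)).
    + rewrite (RInt_lin3 (fun y => RInt (fun x => cos (b x y)) 0 (2 * PI))
        (fun y => RInt (fun x => sin (b x y)) 0 (2 * PI)) (fun _ => 1)); try lra.
      * fold Bc Bs. ring.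
      * intros. now apply (Hpar (fun x y => cos (b x y))).
      * intros. now apply (Hpar (fun x y => sin (b x y))).
      * intros. apply continuous_const.
    + intros y. rewrite (RInt_congr _ (fun x => cos (a z) * cos (b x y) + - sin (a z) * sin (b x y) + 0 * 1)).
      * rewrite (RInt_lin3 (fun x => cos (b x y)) (fun x => sin (b x y)) (fun _ => 1)); try lra.
        -- intros x _. apply (continuity_2d_pt_slice1 (fun x y => cos (b x y))), Cc.
        -- intros x _. apply (continuity_2d_pt_slice1 (fun x y => sin (b x y))), Cs.
        -- intros. apply continuous_const.
      * intros x. rewrite cos_plus. ring.
Qed.

(** * Fourier representation of the propagator *)

Lemma admissible_ext F G :
  (forall x y z, F x y z = G x y z) -> admissible F -> admissible G.
Proof.
  intros E [H1 [M H2] [L H3]]. split.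
  - intros x y z. apply (continuity_2d_pt_ext (fun x y => F x y z)); auto.
  - exists M. intros. now rewrite <- E.
  - exists L. intros. now rewrite <- !E.
Qed.

Lemma admissible_cos_lin a b c d : admissible (fun x y z => cos (a * x + b * y + c * z + d)).
Proof.
  apply (admissible_cos _ (Rabs c)).
  - intros x y z. repeat apply continuity_2d_pt_plus; try apply continuity_2d_pt_const;
      apply continuity_2d_pt_mult; try apply continuity_2d_pt_const;
      [apply continuity_2d_pt_id1 | apply continuity_2d_pt_id2].
  - intros x y z z'. rewrite <- Rabs_mult. apply Req_le. f_equal. ring.
Qed.

(** The Fourier multiplier of the Laplacian: 10 of the 11 counts the neighbours and 1 completes the
    product [king x * king y]. *)
Definition symbol (x y z : R) : R := 2 * cos z + king x * king y - 11.

Lemma admissible_symbol : admissible symbol.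
Proof.
  apply (admissible_ext (fun x y z => 2 * cos (0 * x + 0 * y + 1 * z + 0)
    + (1 + 2 * cos (1 * x + 0 * y + 0 * z + 0)) * (1 + 2 * cos (0 * x + 1 * y + 0 * z + 0)) + - 11)).
  - intros x y z. unfold symbol, king, Rminus. repeat (f_equal; try ring).
  - repeat (apply (admissible_plus (fun x y z => _)) || apply (admissible_mult (fun x y z => _))
      || apply admissible_const || apply admissible_cos_lin).
Qed.

Lemma symbol_bound x y z : Rabs (symbol x y z) <= 22.
Proof.
  unfold symbol, king. pose proof (COS_bound x). pose proof (COS_bound y). pose proof (COS_bound z).
  apply Rabs_le. nra.
Qed.

Definition dot (n : Z3) (x y z : R) : R :=
  let '(n1, n2, n3) := n in IZR n1 * x + IZR n2 * y + IZR n3 * z.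

Lemma admissible_cos_dot n : admissible (fun x y z => cos (dot n x y z)).
Proof.
  destruct n as [[n1 n2] n3].
  apply (admissible_ext (fun x y z => cos (IZR n1 * x + IZR n2 * y + IZR n3 * z + 0))).
  - intros. unfold dot. f_equal. ring.
  - apply admissible_cos_lin.
Qed.

Lemma RInt_cos_int (n : Z) c :
  RInt (fun x => cos (IZR n * x + c)) 0 (2 * PI) = if Z.eq_dec n 0 then 2 * PI * cos c else 0.
Proof.
  pose proof two_PI_pos as HP. destruct (Z.eq_dec n 0) as [->|Hn].
  - rewrite (RInt_congr _ (fun _ => cos c)) by (intros; f_equal; ring).
    rewrite (RInt_const (V := R_CompleteNormedModule)).
    change ((2 * PI - 0) * cos c = 2 * PI * cos c). ring.
  - assert (Hn' : IZR n <> 0) by now apply not_0_IZR.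
    rewrite (RInt_derive_cont (fun x => / IZR n * sin (IZR n * x + c))); try lra.
    + rewrite Rmult_0_r, Rplus_0_l.
      replace (sin (IZR n * (2 * PI) + c)) with (sin c).
      * change (/ IZR n * sin c - / IZR n * sin c = 0). ring.
      * rewrite !sin_as_cos. rewrite <- (cos_period_IZR (c + - (PI / 2)) n). f_equal. ring.
    + intros x _. auto_derive; auto. field. auto.
    + intros x _. apply continuous_cos_comp.
      apply (is_derive_cont _ _ (IZR n)). auto_derive; auto. ring.
Qed.

Lemma RInt_sin_int (n : Z) c :
  RInt (fun x => sin (IZR n * x + c)) 0 (2 * PI) = if Z.eq_dec n 0 then 2 * PI * sin c else 0.
Proof.
  rewrite (RInt_congr _ (fun x => cos (IZR n * x + (c + - (PI / 2))))).
  - rewrite RInt_cos_int, <- sin_as_cos. reflexivity.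
  - intros x. rewrite sin_as_cos. f_equal. ring.
Qed.

Definition Z3_eq_dec (n m : Z3) : {n = m} + {n <> m}.
Proof. repeat decide equality. Defined.

Lemma torus_integral_cos_dot n :
  torus_integral (fun x y z => cos (dot n x y z)) = if Z3_eq_dec n (0, 0, 0)%Z then (2 * PI) ^ 3 else 0.
Proof.
  destruct n as [[n1 n2] n3].
  rewrite (torus_integral_ext _ (fun x y z => cos ((IZR n3 * z + 0) + (IZR n1 * x + (IZR n2 * y + 0)))))
    by (intros; unfold dot; f_equal; ring).
  rewrite (torus_integral_split (fun z => IZR n3 * z + 0) (fun x y => IZR n1 * x + (IZR n2 * y + 0))).
  2: { intros z. apply (is_derive_cont _ _ (IZR n3)). auto_derive; auto. ring. }
  2: { intros x y. repeat apply continuity_2d_pt_plus; try apply continuity_2d_pt_const;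
      apply continuity_2d_pt_mult; try apply continuity_2d_pt_const;
      [apply continuity_2d_pt_id1 | apply continuity_2d_pt_id2]. }
  rewrite RInt_cos_int, RInt_sin_int, sin_0, cos_0.
  set (G := (fun y => if Z.eq_dec n1 0 then 2 * PI * cos (IZR n2 * y + 0) else 0) : R -> R).
  rewrite (RInt_congr _ G) by (intros; apply RInt_cos_int).
  assert (E : RInt G 0 (2 * PI)
    = if Z.eq_dec n1 0 then if Z.eq_dec n2 0 then (2 * PI) ^ 2 else 0 else 0).
  { unfold G. destruct (Z.eq_dec n1 0).
    - transitivity (2 * PI * RInt (fun y => cos (IZR n2 * y + 0)) 0 (2 * PI)).
      + apply RInt_Rscal.
        apply ex_RInt_cont; [pose proof two_PI_pos; lra|]. intros y _. apply continuous_cos_comp.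
        apply (is_derive_cont _ _ (IZR n2)). auto_derive; auto. ring.
      + rewrite RInt_cos_int, cos_0. destruct (Z.eq_dec n2 0); ring_R.
    - apply RInt_zero. }
  rewrite E.
  destruct (Z3_eq_dec (n1, n2, n3) (0, 0, 0)%Z) as [En|En].
  - injection En as -> -> ->. simpl. ring_R.
  - destruct (Z.eq_dec n1 0), (Z.eq_dec n2 0), (Z.eq_dec n3 0); subst; try congruence; ring_R.
Qed.

Lemma lkg_lap_ext f g n : (forall m, f m = g m) -> lkg_lap f n = lkg_lap g n.
Proof.
  intros H. unfold lkg_lap. f_equal. apply map_ext. intros m. now rewrite !H.
Qed.

Lemma lkg_lap_RtoC (g : Z3 -> R) n :
  lkg_lap (fun m => RtoC (g m)) n
  = RtoC (fold_right Rplus 0 (map (fun m => g m - g n) (lkg_neighbours n))).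
Proof.
  unfold lkg_lap. induction (lkg_neighbours n) as [|m l IH]; [reflexivity|].
  simpl. rewrite IH, RtoC_plus, RtoC_minus. reflexivity.
Qed.

(** Both parts are proved in one induction, since linearity of the integral needs the partial sums
    to be admissible. *)
Lemma torus_integral_sum_minus (G : Z3 -> R -> R -> R -> R) (H : R -> R -> R -> R) (l : list Z3) :
  (forall m, admissible (G m)) -> admissible H ->
  admissible (fun x y z => fold_right Rplus 0 (map (fun m => G m x y z - H x y z) l)) /\
  fold_right Rplus 0 (map (fun m => torus_integral (G m) - torus_integral H) l)
  = torus_integral (fun x y z => fold_right Rplus 0 (map (fun m => G m x y z - H x y z) l)).
Proof.
  intros HG HH.
  assert (Hm : admissible (fun x y z => -1 * H x y z))
    by (apply (admissible_mult (fun _ _ _ => -1)); auto using admissible_const).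
  induction l as [|m l [IH1 IH2]]; simpl.
  - split; [apply admissible_const|]. unfold torus_integral.
    rewrite (RInt_congr _ (fun _ => 0)).
    + symmetry. apply RInt_zero.
    + intros z. rewrite (RInt_congr _ (fun _ => 0)).
      * apply RInt_zero.
      * intros y. apply RInt_zero.
  - assert (HD : admissible (fun x y z => G m x y z - H x y z)).
    { apply (admissible_ext (fun x y z => G m x y z + -1 * H x y z)); [intros; ring|].
      now apply admissible_plus. }
    split.
    + now apply (admissible_plus (fun x y z => G m x y z - H x y z)).
    + rewrite IH2. rewrite (torus_integral_plus (fun x y z => G m x y z - H x y z)) by auto.
      f_equal. rewrite (torus_integral_ext (fun x y z => G m x y z - H x y z) (fun x y z => G m x y z + -1 * H x y z))
        by (intros; ring).
      rewrite torus_integral_plus, torus_integral_scal by auto. ring.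
Qed.

(** Plane waves are eigenfunctions of the Laplacian. The real form holds because the steps come in
    opposite pairs, so the sine terms of the addition formulas cancel. *)
Lemma symbol_step n p q x y z :
  fold_right Rplus 0 (map (fun m => q * cos (dot (Z3sub m p) x y z) - q * cos (dot (Z3sub n p) x y z))
    (lkg_neighbours n)) = symbol x y z * q * cos (dot (Z3sub n p) x y z).
Proof.
  destruct n as [[n1 n2] n3], p as [[p1 p2] p3].
  unfold lkg_neighbours, lkg_steps, Z3sub, dot. cbn [map fold_right]. rewrite !minus_IZR.
  set (A := (IZR n1 - IZR p1) * x + (IZR n2 - IZR p2) * y + (IZR n3 - IZR p3) * z).
  assert (E : forall a b c, cos ((IZR n1 - a - IZR p1) * x + (IZR n2 - b - IZR p2) * y + (IZR n3 - c - IZR p3) * z)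
    = cos (A - (a * x + b * y + c * z))) by (intros; unfold A; f_equal; ring).
  rewrite !E. unfold symbol, king. rewrite !cos_minus, !cos_plus, !sin_plus, !cos_plus.
  replace (-1 * x) with (- x) by ring. replace (-1 * y) with (- y) by ring.
  replace (-1 * z) with (- z) by ring.
  rewrite !Rmult_1_l, !Rmult_0_l, !cos_neg, !sin_neg, cos_0, sin_0. ring.
Qed.

Definition delta3 (p n : Z3) : C := if Z3_eq_dec n p then RtoC 1 else RtoC 0.

Lemma admissible_symbol_pow_cos k n : admissible (fun x y z => symbol x y z ^ k * cos (dot n x y z)).
Proof.
  apply (admissible_mult (fun x y z => symbol x y z ^ k)).
  - apply admissible_pow, admissible_symbol. - apply admissible_cos_dot.
Qed.

(** Orthogonality of the characters settles [k = 0], and each further Laplacian multiplies the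
    integrand by [symbol]. Since [symbol] is even, cosines replace the complex characters. *)
Lemma iter_lkg_lap_delta3 k p n :
  Nat.iter k lkg_lap (delta3 p) n
  = RtoC (/ (2 * PI) ^ 3 * torus_integral (fun x y z => symbol x y z ^ k * cos (dot (Z3sub n p) x y z))).
Proof.
  pose proof two_PI_pos as HP.
  revert n. induction k as [|k IH]; intros n; simpl Nat.iter.
  - rewrite (torus_integral_ext _ (fun x y z => cos (dot (Z3sub n p) x y z))) by (intros; simpl; ring).
    rewrite torus_integral_cos_dot. unfold delta3.
    destruct n as [[n1 n2] n3], p as [[p1 p2] p3]. unfold Z3sub.
    destruct (Z3_eq_dec (n1, n2, n3) (p1, p2, p3)) as [E|E];
    destruct (Z3_eq_dec (n1 - p1, n2 - p2, n3 - p3)%Z (0, 0, 0)%Z) as [E'|E'].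
    + f_equal. field. lra.
    + exfalso. apply E'. injection E as -> -> ->. rewrite !Z.sub_diag. reflexivity.
    + exfalso. apply E. injection E' as E1 E2 E3.
      replace n1 with p1 by lia. replace n2 with p2 by lia. replace n3 with p3 by lia. reflexivity.
    + f_equal. ring.
  - set (g := fun n => / (2 * PI) ^ 3 * torus_integral (fun x y z => symbol x y z ^ k * cos (dot (Z3sub n p) x y z))).
    rewrite (lkg_lap_ext _ (fun m => RtoC (g m))) by apply IH.
    rewrite lkg_lap_RtoC. f_equal. unfold g.
    destruct (torus_integral_sum_minus (fun m x y z => symbol x y z ^ k * cos (dot (Z3sub m p) x y z))
      (fun x y z => symbol x y z ^ k * cos (dot (Z3sub n p) x y z)) (lkg_neighbours n)
      (fun m => admissible_symbol_pow_cos k _) (admissible_symbol_pow_cos k _)) as [_ E].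
    rewrite (torus_integral_ext _ _ (fun x y z => symbol_step n p (symbol x y z ^ k) x y z)) in E.
    rewrite (torus_integral_ext (fun x y z => symbol x y z ^ S k * cos (dot (Z3sub n p) x y z)) _
      (fun x y z => eq_refl (symbol x y z * symbol x y z ^ k * cos (dot (Z3sub n p) x y z)))).
    rewrite <- E.
    clear E. induction (lkg_neighbours n) as [|m l IHl]; cbn [map fold_right]; [ring|].
    rewrite Rmult_plus_distr_l, IHl. ring.
Qed.

(** The Taylor polynomial at 0, of degree below [N], of the function [y -> cos (y + th)]. Writing
    derivatives as phase shifts treats cosine and sine together and keeps the family closed under
    differentiation. *)
Fixpoint taylor_cos (th : R) (N : nat) (y : R) : R :=
  match N with
  | O => 0
  | S N => taylor_cos th N y + cos (th + INR N * (PI / 2)) * (y ^ N / INR (fact N))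
  end.

Lemma taylor_cos_0 th N : taylor_cos th (S N) 0 = cos th.
Proof.
  induction N as [|N IH].
  - simpl. replace (th + 0 * (PI / 2)) with th by ring. field.
  - change (taylor_cos th (S N) 0 + cos (th + INR (S N) * (PI / 2)) * (0 ^ S N / INR (fact (S N))) = cos th).
    rewrite IH. simpl pow. unfold Rdiv. ring.
Qed.

Lemma is_derive_pow_fact N y :
  is_derive (fun y => y ^ S N / INR (fact (S N))) y (y ^ N / INR (fact N)).
Proof.
  apply (is_derive_ext (fun y => / INR (fact (S N)) * y ^ S N)).
  { intros x. apply Rmult_comm. }
  replace (y ^ N / INR (fact N)) with (/ INR (fact (S N)) * (INR (S N) * y ^ N)).
  - apply is_derive_scal, is_derive_Reals, (derivable_pt_lim_pow y (S N)).
  - rewrite fact_simpl, mult_INR. field. split; [apply INR_fact_neq_0 | now apply not_0_INR].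
Qed.

Lemma is_derive_taylor_cos th N y :
  is_derive (taylor_cos th (S N)) y (taylor_cos (th + PI / 2) N y).
Proof.
  induction N as [|N IH].
  - simpl. auto_derive; auto.
  - apply (is_derive_Rplus (taylor_cos th (S N))
      (fun y => cos (th + INR (S N) * (PI / 2)) * (y ^ S N / INR (fact (S N))))); [exact IH|].
    replace (th + PI / 2 + INR N * (PI / 2)) with (th + INR (S N) * (PI / 2)) by (rewrite S_INR; ring).
    apply (is_derive_scal (fun y => y ^ S N / INR (fact (S N)))).
    apply is_derive_pow_fact.
Qed.

(** Each sign [(-1)^N] is absorbed by a shift through half turns and the evenness of cosine; this
    reduces negative [y] to positive [y]. *)
Lemma taylor_cos_opp th N y : taylor_cos th N (- y) = taylor_cos (- th) N y.
Proof.
  induction N as [|N IH]; [reflexivity|]. simpl. rewrite IH. f_equal.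
  replace (- y) with (-1 * y) by ring. rewrite Rpow_mult_distr.
  assert (E : forall th, cos (th + INR N * (PI / 2)) * (-1) ^ N = cos (- th + INR N * (PI / 2))).
  { clear. induction N as [|N IH]; intros th.
    - simpl. rewrite !Rmult_0_l, Rmult_1_r, !Rplus_0_r. symmetry. apply cos_neg.
    - rewrite S_INR. change ((-1) ^ S N) with (-1 * (-1) ^ N).
      replace (th + (INR N + 1) * (PI / 2)) with (th + PI / 2 + INR N * (PI / 2)) by ring.
      replace (cos (th + PI / 2 + INR N * (PI / 2)) * (-1 * (-1) ^ N))
        with (- (cos (th + PI / 2 + INR N * (PI / 2)) * (-1) ^ N)) by ring.
      rewrite IH, <- neg_cos. f_equal. field. }
  rewrite <- E. unfold Rdiv. ring.
Qed.

(** The derivative of the remainder of order [N + 1] is the remainder of order [N] at phase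
    [th + PI / 2]. For [y >= 0] the induction hypothesis makes [y^(N+1) / (N+1)!] minus either sign
    of the remainder nondecreasing from 0. *)
Lemma taylor_cos_remainder N th y :
  Rabs (cos (y + th) - taylor_cos th N y) <= Rabs y ^ N / INR (fact N).
Proof.
  assert (Hpos : forall th y, 0 <= y -> Rabs (cos (y + th) - taylor_cos th N y) <= y ^ N / INR (fact N)).
  { clear. induction N as [|N IH]; intros th y Hy.
    { simpl. rewrite Rminus_0_r. pose proof (Rabs_cos_le (y + th)). lra. }
    set (D := fun y => cos (y + th) - taylor_cos th (S N) y).
    set (D' := fun y => cos (y + (th + PI / 2)) - taylor_cos (th + PI / 2) N y).
    assert (HD : forall x, is_derive D x (D' x)).
    { intros x. apply (is_derive_Rminus (fun y => cos (y + th))); [|apply is_derive_taylor_cos].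
      rewrite <- Rplus_assoc, cos_plus, cos_PI2, sin_PI2. auto_derive; auto. ring_R. }
    assert (HD0 : D 0 = 0) by (unfold D; rewrite taylor_cos_0, Rplus_0_l; ring).
    assert (HE : forall e, e = 1 \/ e = -1 -> e * D y <= y ^ S N / INR (fact (S N))).
    { intros e He.
      pose proof (slope_lower_bound (fun x => x ^ S N / INR (fact (S N)) - e * D x)
        (fun x => x ^ N / INR (fact N) - e * D' x) 0 y 0
        (fun x _ => is_derive_Rminus _ _ _ _ _ (is_derive_pow_fact N x) (is_derive_scal D x e _ (HD x)))) as H.
      assert (Hp : forall x, 0 <= x <= y -> 0 <= x ^ N / INR (fact N) - e * D' x).
      { intros x Hx. pose proof (IH (th + PI / 2) x (proj1 Hx)) as Hr. fold (D' x) in Hr.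
        apply Rabs_le_between in Hr. destruct He; subst e; lra. }
      specialize (H Hp 0 y ltac:(lra) Hy ltac:(lra)). cbv beta in H.
      rewrite HD0 in H. simpl pow in H at 2. unfold Rdiv in *. lra. }
    change (Rabs (D y) <= y ^ S N / INR (fact (S N))).
    apply Rabs_le. pose proof (HE 1 (or_introl eq_refl)). pose proof (HE (-1) (or_intror eq_refl)). lra. }
  destruct (Rle_lt_dec 0 y) as [Hy|Hy].
  - rewrite (Rabs_right y) by lra. auto.
  - rewrite (Rabs_left y) by lra. rewrite <- (Ropp_involutive th) at 2.
    rewrite <- taylor_cos_opp, <- cos_neg. replace (- (y + th)) with (- y + - th) by ring.
    apply Hpos. lra.
Qed.

Lemma continuity_2d_pt_symbol x y z : continuity_2d_pt (fun x y => symbol x y z) x y.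
Proof. apply (adm_cont symbol admissible_symbol). Qed.

Lemma admissible_cos_symbol t th : admissible (fun x y z => cos (t * symbol x y z + th)).
Proof.
  destruct (adm_lip _ admissible_symbol) as [L HL].
  apply (admissible_cos (fun x y z => t * symbol x y z + th) (Rabs t * L)).
  - intros x y z. apply continuity_2d_pt_plus; [apply continuity_2d_pt_mult|];
      try apply continuity_2d_pt_const. apply continuity_2d_pt_symbol.
  - intros x y z z'. replace (t * symbol x y z + th - (t * symbol x y z' + th))
      with (t * (symbol x y z - symbol x y z')) by ring.
    rewrite Rabs_mult, Rmult_assoc. apply Rmult_le_compat_l; [apply Rabs_pos | apply HL].
Qed.

(** Partial sums are torus integrals of Taylor polynomials. As [symbol] is bounded by 22, the
    remainder tends to 0 uniformly on the torus, which justifies exchanging sum and integral. *)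
Lemma is_series_torus_integral t th n :
  is_series (fun k => cos (th + INR k * (PI / 2)) * (t ^ k / INR (fact k)) *
      torus_integral (fun x y z => symbol x y z ^ k * cos (dot n x y z)))
    (torus_integral (fun x y z => cos (t * symbol x y z + th) * cos (dot n x y z))).
Proof.
  set (a := fun k => cos (th + INR k * (PI / 2)) * (t ^ k / INR (fact k)) *
      torus_integral (fun x y z => symbol x y z ^ k * cos (dot n x y z))).
  assert (Hp : forall N, admissible (fun x y z => taylor_cos th (S N) (t * symbol x y z) * cos (dot n x y z)) /\
     sum_n a N = torus_integral (fun x y z => taylor_cos th (S N) (t * symbol x y z) * cos (dot n x y z))).
  { assert (Hterm : forall k, admissible (fun x y z => cos (th + INR k * (PI / 2)) * (t ^ k / INR (fact k)) *
        (symbol x y z ^ k * cos (dot n x y z)))).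
    { intros k. apply (admissible_mult (fun _ _ _ => _)); [apply admissible_const | apply admissible_symbol_pow_cos]. }
    assert (Hone : forall k, a k = torus_integral (fun x y z => cos (th + INR k * (PI / 2)) * (t ^ k / INR (fact k)) *
        (symbol x y z ^ k * cos (dot n x y z)))).
    { intros k. symmetry. apply torus_integral_scal, admissible_symbol_pow_cos. }
    induction N as [|N [IH1 IH2]].
    - split.
      + apply (admissible_ext (fun x y z => cos (th + INR 0 * (PI / 2)) * (t ^ 0 / INR (fact 0)) *
          (symbol x y z ^ 0 * cos (dot n x y z)))); [|apply Hterm].
        intros; simpl. field.
      + rewrite sum_O, Hone. apply torus_integral_ext. intros; simpl. field.
    - assert (E : forall x y z, taylor_cos th (S N) (t * symbol x y z) * cos (dot n x y z) +
          cos (th + INR (S N) * (PI / 2)) * (t ^ S N / INR (fact (S N))) * (symbol x y z ^ S N * cos (dot n x y z))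
          = taylor_cos th (S (S N)) (t * symbol x y z) * cos (dot n x y z)).
      { intros x y z. change (taylor_cos th (S (S N)) (t * symbol x y z)) with
          (taylor_cos th (S N) (t * symbol x y z) + cos (th + INR (S N) * (PI / 2)) * ((t * symbol x y z) ^ S N / INR (fact (S N)))).
        rewrite Rpow_mult_distr. unfold Rdiv. ring. }
      split.
      + apply (admissible_ext _ _ E). apply admissible_plus; [exact IH1 | apply Hterm].
      + rewrite sum_Sn, IH2, Hone. rewrite <- (torus_integral_ext _ _ E). symmetry.
        apply torus_integral_plus; [exact IH1 | apply Hterm]. }
  set (lim := torus_integral (fun x y z => cos (t * symbol x y z + th) * cos (dot n x y z))).
  assert (HL : admissible (fun x y z => cos (t * symbol x y z + th) * cos (dot n x y z)))
    by (apply admissible_mult; [apply admissible_cos_symbol | apply admissible_cos_dot]).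
  set (X := Rabs t * 22).
  assert (Hb : forall N, Rabs (sum_n a N - lim) <= (2 * PI) ^ 3 * (X ^ S N / INR (fact (S N)))).
  { intros N. destruct (Hp N) as [H1 H2]. rewrite H2. unfold lim.
    assert (HLm : admissible (fun x y z => -1 * (cos (t * symbol x y z + th) * cos (dot n x y z))))
      by (apply (admissible_mult (fun _ _ _ => -1)); auto using admissible_const).
    replace (torus_integral (fun x y z => taylor_cos th (S N) (t * symbol x y z) * cos (dot n x y z)) -
      torus_integral (fun x y z => cos (t * symbol x y z + th) * cos (dot n x y z)))
    with (torus_integral (fun x y z => taylor_cos th (S N) (t * symbol x y z) * cos (dot n x y z) +
      -1 * (cos (t * symbol x y z + th) * cos (dot n x y z))))
    by (rewrite torus_integral_plus, torus_integral_scal by auto; ring).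
    apply torus_integral_bound; [now apply admissible_plus|]. intros x y z.
    replace (taylor_cos th (S N) (t * symbol x y z) * cos (dot n x y z) +
      -1 * (cos (t * symbol x y z + th) * cos (dot n x y z)))
    with (- (cos (t * symbol x y z + th) - taylor_cos th (S N) (t * symbol x y z)) * cos (dot n x y z)) by ring.
    replace (X ^ S N / INR (fact (S N))) with (X ^ S N / INR (fact (S N)) * 1) by ring.
    apply Rabs_mult_le; [|apply Rabs_cos_le]. rewrite Rabs_Ropp.
    eapply Rle_trans; [apply taylor_cos_remainder|].
    apply Rmult_le_compat_r; [apply Rlt_le, Rinv_0_lt_compat, INR_fact_lt_0|].
    apply pow_incr. split; [apply Rabs_pos|]. unfold X. rewrite Rabs_mult.
    apply Rmult_le_compat_l; [apply Rabs_pos | apply symbol_bound]. }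
  assert (Hz : is_lim_seq (fun N => (2 * PI) ^ 3 * (X ^ S N / INR (fact (S N)))) 0).
  { replace (Finite 0) with (Rbar_mult ((2 * PI) ^ 3) 0) by (simpl; f_equal; ring).
    apply is_lim_seq_scal_l. apply (is_lim_seq_incr_1 (fun N => X ^ N / INR (fact N))).
    apply is_lim_seq_Reals, cv_speed_pow_fact. }
  change (is_lim_seq (sum_n a) (Finite lim)).
  apply is_lim_seq_ext with (fun N => (sum_n a N - lim) + lim); [intros; ring_R|].
  replace (Finite lim) with (Finite (0 + lim)) by (f_equal; ring).
  apply is_lim_seq_plus'; [|apply is_lim_seq_const].
  apply is_lim_seq_abs_0.
  apply (is_lim_seq_le_le (fun _ => 0) _ (fun N => (2 * PI) ^ 3 * (X ^ S N / INR (fact (S N))))).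
  - intros N. split; [apply Rabs_pos | apply Hb].
  - apply is_lim_seq_const. - exact Hz.
Qed.

(** * Dispersive estimate *)

(** The product of cosines is the half-sum of two cosines with frequencies [n] and [-n]. Each has a
    phase separated between [z] and [(x, y)], hence splits into two products of a chain integral and
    a planar one; 168 is twice 84. *)
Lemma torus_integral_cos_cos_decay :
  exists K, 0 < K /\ forall (t th eta1 eta2 : R) (n : Z3),
  0 < eta1 <= 1 -> 0 < eta2 <= 1 -> t * eta1 ^ 3 = 1 -> t * eta2 ^ 4 = 1 ->
  Rabs (torus_integral (fun x y z => cos (t * symbol x y z + th) * cos (dot n x y z))) <= K * (eta1 * eta2 ^ 3).
Proof.
  destruct king_kernel_decay as [K [HK H2]].
  exists (168 * K). split; [lra|]. intros t th eta1 eta2 [[n1 n2] n3] He1 He2 Ht1 Ht2.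
  assert (Hone : forall m1 m2 m3 : Z, Rabs (torus_integral (fun x y z =>
     cos ((2 * t * cos z + IZR m3 * z + (th - 11 * t))
       + (t * (king x * king y) + IZR m1 * x + IZR m2 * y + 0)))) <= 168 * K * (eta1 * eta2 ^ 3)).
  { intros m1 m2 m3.
    rewrite (torus_integral_split (fun z => 2 * t * cos z + IZR m3 * z + (th - 11 * t))
      (fun x y => t * (king x * king y) + IZR m1 * x + IZR m2 * y + 0)).
    2: { intros z. apply (is_derive_cont _ _ (- (2 * t * sin z) + IZR m3)). auto_derive; auto. ring. }
    2: { intros x y. repeat apply continuity_2d_pt_plus; repeat apply continuity_2d_pt_mult;
         try apply continuity_2d_pt_const; try apply continuity_2d_pt_id1; try apply continuity_2d_pt_id2.
         - apply continuity_2d_pt_fst, continuous_king. - apply continuity_2d_pt_snd, continuous_king. }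
    assert (C1 := chain_kernel_decay t (IZR m3) (th - 11 * t) eta1 He1 Ht1).
    assert (C2 : Rabs (RInt (fun z => sin (2 * t * cos z + IZR m3 * z + (th - 11 * t))) 0 (2 * PI)) <= 84 * eta1).
    { rewrite (RInt_congr _ (fun z => cos (2 * t * cos z + IZR m3 * z + (th - 11 * t + - (PI / 2))))).
      - now apply chain_kernel_decay.
      - intros z. rewrite sin_as_cos. f_equal. ring. }
    assert (D1 := H2 t 0 eta2 m1 m2 He2 Ht2). unfold wave in D1.
    assert (D2 : Rabs (RInt (fun y => RInt (fun x =>
        sin (t * (king x * king y) + IZR m1 * x + IZR m2 * y + 0)) 0 (2 * PI)) 0 (2 * PI)) <= K * eta2 ^ 3).
    { rewrite (RInt_congr _ (fun y => RInt (fun x =>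
        cos (t * (king x * king y) + IZR m1 * x + IZR m2 * y + (0 + - (PI / 2)))) 0 (2 * PI))).
      - now apply (H2 t (0 + - (PI / 2))).
      - intros y. apply RInt_congr. intros x. rewrite sin_as_cos. f_equal. ring. }
    assert (B1 := Rabs_mult_le _ _ _ _ C1 D1). assert (B2 := Rabs_mult_le _ _ _ _ C2 D2).
    unfold Rminus at 1. eapply Rle_trans; [apply Rabs_triang|]. rewrite Rabs_Ropp. lra. }
  set (P := fun x y z => cos ((2 * t * cos z + IZR n3 * z + (th - 11 * t))
       + (t * (king x * king y) + IZR n1 * x + IZR n2 * y + 0))).
  set (M := fun x y z => cos ((2 * t * cos z + IZR (- n3) * z + (th - 11 * t))
       + (t * (king x * king y) + IZR (- n1) * x + IZR (- n2) * y + 0))).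
  assert (Hadm : forall m1 m2 m3 : Z, admissible (fun x y z => cos ((2 * t * cos z + IZR m3 * z + (th - 11 * t))
       + (t * (king x * king y) + IZR m1 * x + IZR m2 * y + 0)))).
  { intros m1 m2 m3. destruct (adm_lip _ admissible_symbol) as [L HL].
    apply (admissible_cos (fun x y z => (2 * t * cos z + IZR m3 * z + (th - 11 * t))
       + (t * (king x * king y) + IZR m1 * x + IZR m2 * y + 0)) (Rabs t * L + Rabs (IZR m3))).
    - intros x y z. apply continuity_2d_pt_plus; [apply continuity_2d_pt_const|].
      repeat apply continuity_2d_pt_plus; repeat apply continuity_2d_pt_mult;
         try apply continuity_2d_pt_const; try apply continuity_2d_pt_id1; try apply continuity_2d_pt_id2.
      + apply continuity_2d_pt_fst, continuous_king. + apply continuity_2d_pt_snd, continuous_king.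
    - intros x y z z'.
      replace ((2 * t * cos z + IZR m3 * z + (th - 11 * t)) + (t * (king x * king y) + IZR m1 * x + IZR m2 * y + 0) -
        ((2 * t * cos z' + IZR m3 * z' + (th - 11 * t)) + (t * (king x * king y) + IZR m1 * x + IZR m2 * y + 0)))
        with (t * (symbol x y z - symbol x y z') + IZR m3 * (z - z')) by (unfold symbol; ring).
      eapply Rle_trans; [apply Rabs_triang|]. rewrite !Rabs_mult, Rmult_plus_distr_r.
      apply Rplus_le_compat_r. rewrite Rmult_assoc. apply Rmult_le_compat_l; [apply Rabs_pos | apply HL]. }
  rewrite (torus_integral_ext _ (fun x y z => / 2 * P x y z + / 2 * M x y z)).
  2: { intros x y z. unfold P, M, symbol, dot. rewrite !opp_IZR.
       replace (2 * t * cos z + IZR n3 * z + (th - 11 * t) + (t * (king x * king y) + IZR n1 * x + IZR n2 * y + 0))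
         with ((t * (2 * cos z + king x * king y - 11) + th) + (IZR n1 * x + IZR n2 * y + IZR n3 * z)) by ring.
       replace (2 * t * cos z + - IZR n3 * z + (th - 11 * t) + (t * (king x * king y) + - IZR n1 * x + - IZR n2 * y + 0))
         with ((t * (2 * cos z + king x * king y - 11) + th) - (IZR n1 * x + IZR n2 * y + IZR n3 * z)) by ring.
       set (X := t * (2 * cos z + king x * king y - 11) + th).
       rewrite (cos_plus X), (cos_minus X). field. }
  assert (HP : admissible P) by apply Hadm. assert (HM : admissible M) by apply Hadm.
  rewrite torus_integral_plus, !torus_integral_scal; auto;
    try (apply (admissible_mult (fun _ _ _ => / 2)); auto using admissible_const).
  assert (B1 : Rabs (torus_integral P) <= 168 * K * (eta1 * eta2 ^ 3)) by apply Hone.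
  assert (B2 : Rabs (torus_integral M) <= 168 * K * (eta1 * eta2 ^ 3)) by apply Hone.
  apply Rabs_le_between in B1, B2. apply Rabs_le. lra.
Qed.

(** * Complex exponential series of the Laplacian on bounded data *)

Lemma Cmod_le_Rabs z : Cmod z <= Rabs (Re z) + Rabs (Im z).
Proof.
  destruct z as [x y]. unfold Cmod, Re, Im; simpl fst; simpl snd.
  pose proof (Rabs_pos x). pose proof (Rabs_pos y).
  rewrite <- (sqrt_pow2 (Rabs x + Rabs y)) by lra. apply sqrt_le_1_alt.
  rewrite <- (pow2_abs x), <- (pow2_abs y). nra.
Qed.

Lemma Rabs_Re_le z : Rabs (Re z) <= Cmod z.
Proof. eapply Rle_trans; [apply Rmax_l | apply Rmax_Cmod]. Qed.

Lemma Rabs_Im_le z : Rabs (Im z) <= Cmod z.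
Proof. eapply Rle_trans; [apply Rmax_r | apply Rmax_Cmod]. Qed.

Definition ex_CSeries (a : nat -> C) : Prop :=
  ex_series (fun k => Re (a k)) /\ ex_series (fun k => Im (a k)).

Lemma CSeries_ext a b : (forall k, a k = b k) -> CSeries a = CSeries b.
Proof. intros H. unfold CSeries. f_equal; apply Series_ext; intros k; now rewrite H. Qed.

Lemma CSeries_plus a b : ex_CSeries a -> ex_CSeries b ->
  ex_CSeries (fun k => (a k + b k)%C) /\ CSeries (fun k => (a k + b k)%C) = (CSeries a + CSeries b)%C.
Proof.
  intros [A1 A2] [B1 B2]. split.
  - split.
    + apply (ex_series_plus (V := R_NormedModule) (fun k => Re (a k))); auto.
    + apply (ex_series_plus (V := R_NormedModule) (fun k => Im (a k))); auto.
  - unfold CSeries, Cplus; simpl. f_equal.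
    + apply (Series_plus (fun k => Re (a k))); auto.
    + apply (Series_plus (fun k => Im (a k))); auto.
Qed.

Lemma CSeries_scal c a : ex_CSeries a ->
  ex_CSeries (fun k => (c * a k)%C) /\ CSeries (fun k => (c * a k)%C) = (c * CSeries a)%C.
Proof.
  intros [A1 A2].
  assert (S : forall r (f : nat -> R), ex_series f -> ex_series (fun k => r * f k))
    by (intros; now apply (ex_series_scal (K := R_AbsRing) (V := R_NormedModule))).
  split.
  - split.
    + apply (ex_series_minus (V := R_NormedModule) (fun k => fst c * Re (a k)) (fun k => snd c * Im (a k))); auto.
    + apply (ex_series_plus (V := R_NormedModule) (fun k => fst c * Im (a k)) (fun k => snd c * Re (a k))); auto.
  - unfold CSeries, Cmult; simpl. rewrite <- !Series_scal_l. f_equal.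
    + apply (Series_minus (fun k => fst c * Re (a k)) (fun k => snd c * Im (a k))); auto.
    + apply (Series_plus (fun k => fst c * Im (a k)) (fun k => snd c * Re (a k))); auto.
Qed.

Lemma is_series_exp x : is_series (fun k => x ^ k / INR (fact k)) (exp x).
Proof.
  pose proof (is_exp_Reals x) as H. unfold is_pseries in H.
  revert H. apply is_series_ext. intros k.
  change (pow_n x k * / INR (fact k) = x ^ k / INR (fact k)). rewrite pow_n_pow. reflexivity.
Qed.

(** Comparison with the exponential series, separately for real and imaginary parts; this accounts
    for the factor 2. *)
Lemma CSeries_exp_bound (a : nat -> C) (B x : R) :
  (forall k, Cmod (a k) <= B * (x ^ k / INR (fact k))) ->
  ex_CSeries a /\ Cmod (CSeries a) <= 2 * (B * exp x).
Proof.
  intros H.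
  assert (HS : is_series (fun k => B * (x ^ k / INR (fact k))) (B * exp x)).
  { apply (is_series_scal (K := R_AbsRing) (V := R_NormedModule) B), is_series_exp. }
  assert (Hc : forall f : nat -> R, (forall k, Rabs (f k) <= Cmod (a k)) ->
    ex_series f /\ Rabs (Series f) <= B * exp x).
  { intros f Hf.
    assert (Habs : ex_series (fun k => Rabs (f k))).
    { apply (ex_series_le (K := R_AbsRing) (V := R_CompleteNormedModule) _ (fun k => B * (x ^ k / INR (fact k)))).
      - intros k. change (Rabs (Rabs (f k)) <= B * (x ^ k / INR (fact k))).
        rewrite Rabs_Rabsolu. eapply Rle_trans; [apply Hf | apply H].
      - eexists; apply HS. }
    split; [now apply ex_series_Rabs|].
    eapply Rle_trans; [now apply Series_Rabs|].
    rewrite <- (is_series_unique _ _ HS). apply Series_le; [|eexists; apply HS].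
    intros k. split; [apply Rabs_pos|]. eapply Rle_trans; [apply Hf | apply H]. }
  destruct (Hc (fun k => Re (a k)) (fun k => Rabs_Re_le _)) as [E1 B1].
  destruct (Hc (fun k => Im (a k)) (fun k => Rabs_Im_le _)) as [E2 B2].
  split; [now split|]. eapply Rle_trans; [apply Cmod_le_Rabs|].
  unfold CSeries, Re, Im in *; simpl in *. lra.
Qed.

Lemma Cmod_lkg_lap_le f B n : (forall m, Cmod (f m) <= B) -> Cmod (lkg_lap f n) <= 20 * B.
Proof.
  intros H. unfold lkg_lap.
  assert (Hl : forall l, Cmod (fold_right Cplus (RtoC 0) (map (fun m => (f m - f n)%C) l)) <= INR (length l) * (2 * B)).
  { induction l as [|m l IH]; [simpl; rewrite Cmod_0; lra|].
    cbn [map fold_right length]. rewrite S_INR.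
    eapply Rle_trans; [apply Cmod_triangle|].
    assert (Cmod (f m - f n) <= 2 * B).
    { eapply Rle_trans; [apply Cmod_triangle|]. rewrite Cmod_opp. pose proof (H m). pose proof (H n). lra. }
    lra. }
  eapply Rle_trans; [apply Hl|]. unfold lkg_neighbours. rewrite length_map. simpl. lra.
Qed.

Lemma Cmod_iter_lkg_lap_le f B k n :
  (forall m, Cmod (f m) <= B) -> Cmod (Nat.iter k lkg_lap f n) <= B * 20 ^ k.
Proof.
  intros H. revert n. induction k as [|k IH]; intros n.
  - simpl. rewrite Rmult_1_r. apply H.
  - simpl Nat.iter. eapply Rle_trans; [apply (Cmod_lkg_lap_le _ (B * 20 ^ k)); exact IH|]. simpl. lra.
Qed.

Definition exp_coef (t : R) (k : nat) : C := ((Ci * RtoC t) ^ k / RtoC (INR (fact k)))%C.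

Lemma Cmod_pow z k : Cmod (z ^ k)%C = Cmod z ^ k.
Proof.
  induction k as [|k IH]; [apply Cmod_1|].
  change (Cmod (z * z ^ k)%C = Cmod z * Cmod z ^ k). now rewrite Cmod_mult, IH.
Qed.

Lemma Cmod_Ci : Cmod Ci = 1.
Proof. unfold Cmod, Ci; simpl. replace (0 * (0 * 1) + 1 * (1 * 1)) with 1 by ring. apply sqrt_1. Qed.

Lemma RtoC_fact_neq_0 k : RtoC (INR (fact k)) <> RtoC 0.
Proof. intros E. apply RtoC_inj in E. now apply (INR_fact_neq_0 k). Qed.

Lemma Cmod_exp_coef t k : Cmod (exp_coef t k) = Rabs t ^ k / INR (fact k).
Proof.
  unfold exp_coef. rewrite Cmod_div by apply RtoC_fact_neq_0.
  rewrite Cmod_pow, Cmod_mult, Cmod_Ci, !Cmod_R, Rmult_1_l.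
  rewrite (Rabs_right (INR (fact k))); [reflexivity|]. apply Rle_ge, Rlt_le, INR_fact_lt_0.
Qed.

Section BoundedData.

Variables (f : Z3 -> C) (B : R).
Hypothesis Hf : forall m, Cmod (f m) <= B.

Lemma Cmod_exp_term_le t k n :
  Cmod (exp_coef t k * Nat.iter k lkg_lap f n)%C <= B * ((20 * Rabs t) ^ k / INR (fact k)).
Proof.
  rewrite Cmod_mult, Cmod_exp_coef, Rpow_mult_distr.
  pose proof (Cmod_iter_lkg_lap_le f B k n Hf) as H.
  replace (B * (20 ^ k * Rabs t ^ k / INR (fact k))) with (Rabs t ^ k / INR (fact k) * (B * 20 ^ k))
    by (unfold Rdiv; ring).
  apply Rmult_le_compat_l; [|exact H].
  apply Rmult_le_pos; [apply pow_le, Rabs_pos | apply Rlt_le, Rinv_0_lt_compat, INR_fact_lt_0].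
Qed.

Lemma ex_CSeries_exp_term t n : ex_CSeries (fun k => (exp_coef t k * Nat.iter k lkg_lap f n)%C).
Proof. eapply CSeries_exp_bound. intros k. apply Cmod_exp_term_le. Qed.

Lemma Cmod_exp_it_lap_le t n : Cmod (exp_it_lap t f n) <= 2 * (B * exp (20 * Rabs t)).
Proof. apply CSeries_exp_bound. intros k. apply Cmod_exp_term_le. Qed.

(** The Laplacian is a finite sum, so it passes through the series by induction on the list of
    neighbours. *)
Lemma lkg_lap_exp_it_lap t n :
  ex_CSeries (fun k => (exp_coef t k * lkg_lap (Nat.iter k lkg_lap f) n)%C) /\
  CSeries (fun k => (exp_coef t k * lkg_lap (Nat.iter k lkg_lap f) n)%C) = lkg_lap (exp_it_lap t f) n.
Proof.
  unfold lkg_lap at 1 3 5.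
  induction (lkg_neighbours n) as [|m l [IH1 IH2]]; cbn [map fold_right].
  -
    assert (Ez : ex_CSeries (fun k => (exp_coef t k * RtoC 0)%C) /\ Cmod (CSeries (fun k => (exp_coef t k * RtoC 0)%C)) <= 2 * (0 * exp 0)).
    { apply CSeries_exp_bound. intros k. rewrite Cmult_0_r, Cmod_0. lra. }
    destruct Ez as [E1 E2]. split; [exact E1|].
    apply Cmod_eq_0. pose proof (Cmod_ge_0 (CSeries (fun k => (exp_coef t k * RtoC 0)%C))). lra.
  - destruct (CSeries_scal (RtoC (-1)) _ (ex_CSeries_exp_term t n)) as [N1 N2].
    destruct (CSeries_plus _ _ (ex_CSeries_exp_term t m) N1) as [P1 P2].
    destruct (CSeries_plus _ _ P1 IH1) as [Q1 Q2].
    assert (E : forall k, (exp_coef t k * Nat.iter k lkg_lap f m + RtoC (-1) * (exp_coef t k * Nat.iter k lkg_lap f n) +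
      exp_coef t k * fold_right Cplus (RtoC 0) (map (fun m0 => Nat.iter k lkg_lap f m0 - Nat.iter k lkg_lap f n) l))%C
      = (exp_coef t k * (Nat.iter k lkg_lap f m - Nat.iter k lkg_lap f n +
        fold_right Cplus (RtoC 0) (map (fun m0 => Nat.iter k lkg_lap f m0 - Nat.iter k lkg_lap f n) l)))%C).
    { intros k. replace (RtoC (-1)) with (- RtoC 1)%C by (rewrite <- RtoC_opp; f_equal; ring). ring. }
    split.
    + destruct Q1 as [R1 R2]. split.
      * revert R1. apply ex_series_ext. intros k. apply (f_equal Re), E.
      * revert R2. apply ex_series_ext. intros k. apply (f_equal Im), E.
    + rewrite <- (CSeries_ext _ _ E), Q2, P2, N2, IH2.
      change (CSeries (fun k => (exp_coef t k * Nat.iter k lkg_lap f m)%C)) with (exp_it_lap t f m).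
      change (CSeries (fun k => (exp_coef t k * Nat.iter k lkg_lap f n)%C)) with (exp_it_lap t f n).
      replace (RtoC (-1)) with (- RtoC 1)%C by (rewrite <- RtoC_opp; f_equal; ring). ring.
Qed.

End BoundedData.

(** Powers of the imaginary unit as rotations by [PI / 2], the form in which they match the
    coefficients of [taylor_cos]. *)
Lemma Ci_pow_mul t k :
  ((Ci * RtoC t) ^ k)%C = (cos (INR k * (PI / 2)) * t ^ k, sin (INR k * (PI / 2)) * t ^ k).
Proof.
  induction k as [|k IH].
  - simpl. rewrite Rmult_0_l, cos_0, sin_0. unfold RtoC. f_equal; ring.
  - change ((Ci * RtoC t) ^ S k)%C with (Ci * RtoC t * (Ci * RtoC t) ^ k)%C. rewrite IH, S_INR.
    rewrite Rmult_plus_distr_r, Rmult_1_l, cos_plus, sin_plus, cos_PI2, sin_PI2.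
    unfold Cmult, Ci, RtoC; simpl. f_equal; ring.
Qed.

Lemma exp_coef_eq t k :
  exp_coef t k = (cos (0 + INR k * (PI / 2)) * (t ^ k / INR (fact k)),
                  cos (- (PI / 2) + INR k * (PI / 2)) * (t ^ k / INR (fact k))).
Proof.
  unfold exp_coef. rewrite Ci_pow_mul. unfold Cdiv. rewrite <- RtoC_inv by apply INR_fact_neq_0.
  rewrite (Rplus_comm (- (PI / 2))), <- sin_as_cos, Rplus_0_l.
  unfold Cmult, RtoC, Rdiv; simpl. f_equal; ring.
Qed.

(** Fourier representation of the kernel. The phase [- PI / 2] turns the cosine into the sine that
    makes up the imaginary part. *)
Lemma exp_it_lap_delta3 t p n :
  exp_it_lap t (delta3 p) n
  = (/ (2 * PI) ^ 3 * torus_integral (fun x y z => cos (t * symbol x y z + 0) * cos (dot (Z3sub n p) x y z)),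
     / (2 * PI) ^ 3 * torus_integral (fun x y z => cos (t * symbol x y z + - (PI / 2)) * cos (dot (Z3sub n p) x y z))).
Proof.
  set (g := fun k => torus_integral (fun x y z => symbol x y z ^ k * cos (dot (Z3sub n p) x y z))).
  assert (Hs : forall th, Series (fun k => cos (th + INR k * (PI / 2)) * (t ^ k / INR (fact k)) * (/ (2 * PI) ^ 3 * g k))
    = / (2 * PI) ^ 3 * torus_integral (fun x y z => cos (t * symbol x y z + th) * cos (dot (Z3sub n p) x y z))).
  { intros th. rewrite <- (is_series_unique _ _ (is_series_torus_integral t th (Z3sub n p))), <- Series_scal_l.
    apply Series_ext. intros k. unfold g. ring. }
  assert (Ht : forall k, (exp_coef t k * Nat.iter k lkg_lap (delta3 p) n)%C
    = (cos (0 + INR k * (PI / 2)) * (t ^ k / INR (fact k)) * (/ (2 * PI) ^ 3 * g k),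
       cos (- (PI / 2) + INR k * (PI / 2)) * (t ^ k / INR (fact k)) * (/ (2 * PI) ^ 3 * g k))).
  { intros k. rewrite iter_lkg_lap_delta3, exp_coef_eq. fold (g k).
    unfold Cmult, RtoC; cbn [fst snd]. f_equal; ring. }
  change (exp_it_lap t (delta3 p) n)
    with (CSeries (fun k => (exp_coef t k * Nat.iter k lkg_lap (delta3 p) n)%C)).
  rewrite (CSeries_ext _ _ Ht), <- !Hs. reflexivity.
Qed.

Lemma delta3_kernel_bound :
  exists K, 0 < K /\ forall t p n, 0 <= t ->
    Cmod (exp_it_lap t (delta3 p) n) <= K * Rpower (japanese_bracket t) (- (13 / 12)).
Proof.
  destruct torus_integral_cos_cos_decay as [K [HK H]].
  pose proof two_PI_pos as HP.
  set (c := / (2 * PI) ^ 3).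
  assert (Hc : 0 < c) by (apply Rinv_0_lt_compat, pow_lt, HP).
  assert (Hcc : c * (2 * PI) ^ 3 = 1) by (apply Rinv_l, pow_nonzero; lra).
  (* In both summands 8 is 2, for the real and imaginary parts, times 4 from [Hcmp]. The first
     serves [t <= 1], where the normalisation [Hcc] reduces the trivial bound to 2; the second
     serves [t > 1]. *)
  exists (8 + 8 * (c * K)). split; [assert (0 < c * K) by (apply Rmult_lt_0_compat; lra); lra|].
  intros t p n Ht.
  assert (HcK : 0 < c * K) by (apply Rmult_lt_0_compat; lra).
  set (J := fun th => torus_integral (fun x y z => cos (t * symbol x y z + th) * cos (dot (Z3sub n p) x y z))).
  assert (HJ : forall A, (forall th, Rabs (J th) <= A) -> Cmod (exp_it_lap t (delta3 p) n) <= 2 * (c * A)).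
  { intros A HA. rewrite exp_it_lap_delta3. fold c.
    eapply Rle_trans; [apply Cmod_le_Rabs|]. cbn [Re Im fst snd].
    assert (E : forall th, Rabs (c * J th) <= c * A).
    { intros th. rewrite Rabs_mult, (Rabs_right c) by lra. apply Rmult_le_compat_l; [lra | apply HA]. }
    pose proof (E 0). pose proof (E (- (PI / 2))). unfold J, Re, Im in *. simpl in *. lra. }
  set (jb := japanese_bracket t).
  assert (Hjb1 : 1 <= jb).
  { unfold jb, japanese_bracket. rewrite <- sqrt_1 at 1. apply sqrt_le_1_alt. nra. }
  assert (Hpos : 0 < Rpower jb (- (13 / 12))) by apply exp_pos.
  (* Used with [x = 1] and [x = t]: the bracket is at most twice the larger of these, and
     [2^(13/12) <= 4]. *)
  assert (Hcmp : forall x, 0 < x -> jb <= 2 * x -> Rpower x (- (13 / 12)) <= 4 * Rpower jb (- (13 / 12))).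
  { intros x Hx Hle.
    assert (H1 : Rpower (2 * x) (- (13 / 12)) <= Rpower jb (- (13 / 12))).
    { rewrite !Rpower_Ropp. apply Rinv_le_contravar; [apply exp_pos|].
      apply Rle_Rpower_l; lra. }
    rewrite <- Rpower_mult_distr in H1 by lra.
    assert (H2 : / 4 <= Rpower 2 (- (13 / 12))).
    { rewrite Rpower_Ropp. apply Rinv_le_contravar; [apply exp_pos|].
      apply Rle_trans with (Rpower 2 2); [apply Rle_Rpower; lra|].
      replace 2 with (INR 2) at 2 by (simpl; ring). rewrite Rpower_pow by lra. simpl. lra. }
    nra. }
  destruct (Rle_lt_dec t 1) as [Ht1|Ht1].
  - assert (H1 : Cmod (exp_it_lap t (delta3 p) n) <= 2 * (c * (2 * PI) ^ 3)).
    { apply HJ. intros th. rewrite <- (Rmult_1_r ((2 * PI) ^ 3)). apply torus_integral_bound.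
      - apply admissible_mult; [apply admissible_cos_symbol | apply admissible_cos_dot].
      - intros x y z. rewrite <- (Rmult_1_r 1). apply Rabs_mult_le; apply Rabs_cos_le. }
    rewrite Hcc in H1.
    assert (H2 : Rpower 1 (- (13 / 12)) <= 4 * Rpower jb (- (13 / 12))).
    { apply Hcmp; [lra|]. unfold jb, japanese_bracket.
      rewrite <- (sqrt_pow2 (2 * 1)) by lra. apply sqrt_le_1_alt. nra. }
    rewrite Rpower_1_l in H2 || (unfold Rpower in H2 at 1; rewrite ln_1, Rmult_0_r, exp_0 in H2).
    nra.
  - assert (Hr : forall a, 0 < a -> 0 < Rpower t (- a) <= 1).
    { intros a Ha. split; [apply exp_pos|]. rewrite <- (Rpower_O t) by lra. apply Rle_Rpower; lra. }
    assert (E1 : t * Rpower t (- (1 / 3)) ^ 3 = 1).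
    { rewrite <- Rpower_pow by apply exp_pos. rewrite Rpower_mult.
      rewrite <- (Rpower_1 t) at 1 by lra. rewrite <- Rpower_plus.
      replace (1 + - (1 / 3) * INR 3) with 0 by (simpl; field). apply Rpower_O; lra. }
    assert (E2 : t * Rpower t (- (1 / 4)) ^ 4 = 1).
    { rewrite <- Rpower_pow by apply exp_pos. rewrite Rpower_mult.
      rewrite <- (Rpower_1 t) at 1 by lra. rewrite <- Rpower_plus.
      replace (1 + - (1 / 4) * INR 4) with 0 by (simpl; field). apply Rpower_O; lra. }
    assert (E3 : Rpower t (- (1 / 3)) * Rpower t (- (1 / 4)) ^ 3 = Rpower t (- (13 / 12))).
    { rewrite <- Rpower_pow by apply exp_pos. rewrite Rpower_mult, <- Rpower_plus. f_equal. simpl. field. }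
    assert (H1 : Cmod (exp_it_lap t (delta3 p) n) <= 2 * (c * (K * Rpower t (- (13 / 12))))).
    { apply HJ. intros th. rewrite <- E3. apply H; auto; apply Hr; lra. }
    assert (H2 : Rpower t (- (13 / 12)) <= 4 * Rpower jb (- (13 / 12))).
    { apply Hcmp; [lra|]. unfold jb, japanese_bracket.
      rewrite <- (sqrt_pow2 (2 * t)) by lra. apply sqrt_le_1_alt. nra. }
    apply (Rmult_le_compat_l (c * K)) in H2; [|lra]. lra.
Qed.

(** * From point masses to summable data *)

Lemma iter_lkg_lap_linear c g h k n :
  Nat.iter k lkg_lap (fun m => (c * g m + h m)%C) n
  = (c * Nat.iter k lkg_lap g n + Nat.iter k lkg_lap h n)%C.
Proof.
  revert n. induction k as [|k IH]; intros n; [reflexivity|]. simpl Nat.iter.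
  rewrite (lkg_lap_ext _ _ n IH). unfold lkg_lap.
  induction (lkg_neighbours n) as [|m l IHl]; cbn [map fold_right]; [ring|].
  rewrite IHl. ring.
Qed.

Lemma iter_lkg_lap_ext f g k n : (forall m, f m = g m) -> Nat.iter k lkg_lap f n = Nat.iter k lkg_lap g n.
Proof.
  intros H. revert n. induction k as [|k IH]; intros n; [apply H|]. simpl. now apply lkg_lap_ext.
Qed.

Lemma exp_it_lap_linear t c f g h B n :
  (forall m, f m = (c * g m + h m)%C) -> (forall m, Cmod (g m) <= B) -> (forall m, Cmod (h m) <= B) ->
  exp_it_lap t f n = (c * exp_it_lap t g n + exp_it_lap t h n)%C.
Proof.
  intros E Hg Hh.
  destruct (CSeries_scal c _ (ex_CSeries_exp_term g B Hg t n)) as [G1 G2].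
  destruct (CSeries_plus _ _ G1 (ex_CSeries_exp_term h B Hh t n)) as [_ S2].
  change (exp_it_lap t f n) with (CSeries (fun k => (exp_coef t k * Nat.iter k lkg_lap f n)%C)).
  rewrite (CSeries_ext _ (fun k => (c * (exp_coef t k * Nat.iter k lkg_lap g n) + exp_coef t k * Nat.iter k lkg_lap h n)%C)).
  - rewrite S2, G2. reflexivity.
  - intros k. rewrite (iter_lkg_lap_ext _ _ k n E), iter_lkg_lap_linear. ring.
Qed.

(* Peeling off the sites of [F] one at a time, the part of [f] outside [F] is
   only estimated by the trivial exponential bound. *)
Lemma Cmod_exp_it_lap_finite t A (F : list Z3) : 0 <= A ->
  (forall p n, Cmod (exp_it_lap t (delta3 p) n) <= A) ->
  NoDup F -> forall (f : Z3 -> C) (B d : R) (n : Z3), 0 <= d ->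
  (forall m, Cmod (f m) <= B) -> (forall m, ~ In m F -> Cmod (f m) <= d) ->
  Cmod (exp_it_lap t f n) <= A * fold_right Rplus 0 (map (fun m => Cmod (f m)) F)
    + 2 * (d * exp (20 * Rabs t)).
Proof.
  intros HA HK. induction F as [|p F IH]; intros HF f B d n Hd0 HB Hd.
  - simpl. rewrite Rmult_0_r, Rplus_0_l. apply Cmod_exp_it_lap_le. intros m. apply Hd. auto.
  - inversion HF as [|? ? Hp HF']; subst.
    set (h := fun m => if Z3_eq_dec m p then RtoC 0 else f m).
    assert (HB0 : 0 <= B) by (eapply Rle_trans; [apply Cmod_ge_0 | apply (HB p)]).
    assert (Hh : forall m, Cmod (h m) <= B + 1).
    { intros m. unfold h. destruct Z3_eq_dec; [rewrite Cmod_0; lra|]. pose proof (HB m). lra. }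
    assert (Hdel : forall m, Cmod (delta3 p m) <= B + 1).
    { intros m. unfold delta3. destruct Z3_eq_dec; rewrite ?Cmod_1, ?Cmod_0; lra. }
    rewrite (exp_it_lap_linear t (f p) f (delta3 p) h (B + 1) n); auto.
    2: { intros m. unfold delta3, h. destruct (Z3_eq_dec m p) as [->|]; ring. }
    eapply Rle_trans; [apply Cmod_triangle|]. rewrite Cmod_mult. cbn [map fold_right].
    assert (H1 : Cmod (f p) * Cmod (exp_it_lap t (delta3 p) n) <= Cmod (f p) * A)
      by (apply Rmult_le_compat_l; [apply Cmod_ge_0 | apply HK]).
    assert (Hdh : forall m, ~ In m F -> Cmod (h m) <= d).
    { intros m Hm. unfold h. destruct (Z3_eq_dec m p) as [->|Hn]; [now rewrite Cmod_0|].
      apply Hd. intros [E|E]; [now apply Hn | auto]. }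
    specialize (IH HF' h (B + 1) d n Hd0 Hh Hdh).
    rewrite (map_ext_in (fun m => Cmod (h m)) (fun m => Cmod (f m))) in IH.
    + lra.
    + intros m Hm. unfold h. destruct (Z3_eq_dec m p) as [->|]; [contradiction | reflexivity].
Qed.

Lemma l1_norm_partial_sum u0 F : in_l1 u0 -> NoDup F ->
  fold_right Rplus 0 (map (fun n => Cmod (u0 n)) F) <= real (l1_norm u0).
Proof.
  intros H HF. unfold in_l1, is_finite in H.
  destruct (Lub_Rbar_correct (fun s => exists F, NoDup F /\
    s = fold_right Rplus 0 (map (fun n => Cmod (u0 n)) F))) as [Hub _].
  fold (l1_norm u0) in Hub. rewrite <- H in Hub.
  apply (Hub (fold_right Rplus 0 (map (fun n => Cmod (u0 n)) F))). now exists F.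
Qed.

Lemma l1_norm_approx u0 d : in_l1 u0 -> 0 < d ->
  exists F, NoDup F /\ real (l1_norm u0) - d <= fold_right Rplus 0 (map (fun n => Cmod (u0 n)) F).
Proof.
  intros H Hd. unfold in_l1, is_finite in H.
  destruct (Lub_Rbar_correct (fun s => exists F, NoDup F /\
    s = fold_right Rplus 0 (map (fun n => Cmod (u0 n)) F))) as [_ Hlub].
  fold (l1_norm u0) in Hlub. rewrite <- H in Hlub.
  apply NNPP. intros Hn.
  specialize (Hlub (Finite (real (l1_norm u0) - d))).
  assert (Hle : Rbar_le (real (l1_norm u0)) (Finite (real (l1_norm u0) - d))).
  { apply Hlub. intros s [F [HF ->]]. simpl.
    apply Rnot_lt_le. intros Hlt. apply Hn. exists F. split; auto. lra. }
  simpl in Hle. lra.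
Qed.

(** At fixed [t] the factor [exp (20 * |t|)] on the tail is just a number, which a large enough
    finite set of sites makes harmless; only the kernel bound [A] remains in the limit. *)
Lemma Cmod_exp_it_lap_l1 t A u0 n : 0 <= A -> in_l1 u0 ->
  (forall p n, Cmod (exp_it_lap t (delta3 p) n) <= A) ->
  Cmod (exp_it_lap t u0 n) <= A * real (l1_norm u0).
Proof.
  intros HA Hu HK. set (L := real (l1_norm u0)).
  assert (HB : forall m, Cmod (u0 m) <= L).
  { intros m. pose proof (l1_norm_partial_sum u0 [m] Hu) as H. simpl in H.
    rewrite Rplus_0_r in H. apply H. constructor; [auto | constructor]. }
  apply le_epsilon. intros eps Heps.
  pose proof (exp_pos (20 * Rabs t)) as HE.
  set (d := eps / (2 * exp (20 * Rabs t))).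
  assert (Hd : 0 < d) by (apply Rdiv_lt_0_compat; lra).
  destruct (l1_norm_approx u0 d Hu Hd) as [F [HF HFd]]. fold L in HFd.
  pose proof (l1_norm_partial_sum u0 F Hu HF) as HFL. fold L in HFL.
  (* A single site outside [F] weighs at most [d], because adding it to [F] cannot push the partial
     sum above the norm. *)
  assert (Htail : forall m, ~ In m F -> Cmod (u0 m) <= d).
  { intros m Hm. pose proof (l1_norm_partial_sum u0 (m :: F) Hu) as H.
    fold L in H. cbn [map fold_right] in H.
    assert (NoDup (m :: F)) by now constructor. specialize (H H0). lra. }
  pose proof (Cmod_exp_it_lap_finite t A F HA HK HF u0 L d n (Rlt_le _ _ Hd) HB Htail) as H.
  assert (E : 2 * (d * exp (20 * Rabs t)) = eps) by (unfold d; field; lra).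
  rewrite E in H. apply (Rmult_le_compat_l A) in HFL; lra.
Qed.

(** * The differential equation and the initial value *)

Section Solution.

Variables (f : Z3 -> C) (B : R).
Hypothesis Hf : forall m, Cmod (f m) <= B.

(** The exponential term stripped of [t^k], so that real and imaginary parts become real power
    series in [t], differentiable term by term. *)
Definition exp_power_coef (n : Z3) (k : nat) : C :=
  (Ci ^ k / RtoC (INR (fact k)) * Nat.iter k lkg_lap f n)%C.

Lemma exp_term_power n t k :
  (exp_coef t k * Nat.iter k lkg_lap f n)%C = (RtoC (t ^ k) * exp_power_coef n k)%C.
Proof.
  unfold exp_coef, exp_power_coef. rewrite Cpow_mult_l, RtoC_pow. field. apply RtoC_fact_neq_0.
Qed.

Lemma exp_it_lap_PSeries n t :
  exp_it_lap t f n = (PSeries (fun k => Re (exp_power_coef n k)) t, PSeries (fun k => Im (exp_power_coef n k)) t).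
Proof.
  change (exp_it_lap t f n) with (CSeries (fun k => (exp_coef t k * Nat.iter k lkg_lap f n)%C)).
  rewrite (CSeries_ext _ _ (exp_term_power n t)). unfold CSeries, PSeries.
  f_equal; apply Series_ext; intros k; unfold Cmult, Re, Im, RtoC; cbn [fst snd]; ring.
Qed.

(** [pr] stands for [Re] or [Im]. The terms are dominated by those of [B * exp (20 * |x|)] at every
    [x], which excludes a finite radius. *)
Lemma CV_radius_exp_power (n : Z3) (pr : C -> R) :
  (forall z, Rabs (pr z) <= Cmod z) ->
  CV_radius (fun k => pr (exp_power_coef n k)) = p_infty.
Proof.
  intros Hpr.
  assert (H : forall x, 0 <= x -> CV_disk (fun k => pr (exp_power_coef n k)) x).
  { intros x Hx. unfold CV_disk.
    apply (ex_series_le (K := R_AbsRing) (V := R_CompleteNormedModule) _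
      (fun k => B * ((20 * Rabs x) ^ k / INR (fact k)))).
    - intros k. change (Rabs (Rabs (pr (exp_power_coef n k) * x ^ k)) <= B * ((20 * Rabs x) ^ k / INR (fact k))).
      rewrite Rabs_Rabsolu, Rabs_mult.
      eapply Rle_trans; [|apply (Cmod_exp_term_le f B Hf x k n)].
      rewrite exp_term_power, Cmod_mult, Cmod_R, Rmult_comm.
      apply Rmult_le_compat_l; [apply Rabs_pos | apply Hpr].
    - eexists. apply (is_series_scal (K := R_AbsRing) (V := R_NormedModule) B), is_series_exp. }
  destruct (Lub_Rbar_correct (CV_disk (fun k => pr (exp_power_coef n k)))) as [Hub _].
  fold (CV_radius (fun k => pr (exp_power_coef n k))) in Hub.
  destruct (CV_radius (fun k => pr (exp_power_coef n k))) as [r| |]; auto; exfalso.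
  - pose proof (Rabs_pos r). pose proof (Rle_abs r).
    specialize (Hub (Rabs r + 1) (H (Rabs r + 1) ltac:(lra))). simpl in Hub. lra.
  - exact (Hub 0 (H 0 ltac:(lra))).
Qed.

Lemma is_derive_C_pair (a b : R -> R) (t da db : R) :
  is_derive a t da -> is_derive b t db ->
  is_derive (V := C_R_NormedModule) (fun s => (a s, b s) : C) t ((da, db) : C).
Proof.
  intros Ha Hb.
  apply (is_derive_ext (V := C_R_NormedModule)
    (fun s => plus (scal (a s) ((1, 0) : C_R_NormedModule)) (scal (b s) ((0, 1) : C_R_NormedModule)))).
  - intros s. unfold plus, scal; simpl. unfold prod_plus, prod_scal, plus, scal; simpl. unfold mult; simpl.
    f_equal; ring_R.
  - replace ((da, db) : C) with
      (plus (scal da ((1, 0) : C_R_NormedModule)) (scal db ((0, 1) : C_R_NormedModule))).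
    + apply (is_derive_plus (V := C_R_NormedModule)); apply (is_derive_scal_l (V := C_R_NormedModule)); auto.
    + unfold plus, scal; simpl. unfold prod_plus, prod_scal, plus, scal; simpl. unfold mult; simpl.
      f_equal; ring_R.
Qed.

(** The factor [k + 1] from differentiation lowers the factorial, leaving one [Ci] and one Laplacian
    in excess in each term; [lkg_lap_exp_it_lap] takes the Laplacian out of the series. *)
Lemma is_derive_exp_it_lap n t :
  is_derive (V := C_R_NormedModule) (fun s => exp_it_lap s f n) t (Ci * lkg_lap (exp_it_lap t f) n)%C.
Proof.
  destruct (lkg_lap_exp_it_lap f B Hf t n) as [E1 E2].
  destruct (CSeries_scal Ci _ E1) as [_ E3]. rewrite <- E2, <- E3.
  assert (E4 : forall k, (Ci * (exp_coef t k * lkg_lap (Nat.iter k lkg_lap f) n))%C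
    = (RtoC (t ^ k) * (RtoC (INR (S k)) * exp_power_coef n (S k)))%C).
  { intros k. unfold exp_coef, exp_power_coef.
    change (Nat.iter (S k) lkg_lap f n) with (lkg_lap (Nat.iter k lkg_lap f) n). rewrite Cpow_mult_l, RtoC_pow.
    rewrite fact_simpl, mult_INR, RtoC_mult.
    change (Ci ^ S k)%C with (Ci * Ci ^ k)%C. field. split; [apply RtoC_fact_neq_0|].
    intros Z. apply RtoC_inj in Z. now apply (not_0_INR (S k)) in Z. }
  rewrite (CSeries_ext _ _ E4).
  apply (is_derive_ext (V := C_R_NormedModule) (fun s => (PSeries (fun k => Re (exp_power_coef n k)) s,
    PSeries (fun k => Im (exp_power_coef n k)) s) : C)).
  { intros s. symmetry. apply exp_it_lap_PSeries. }
  replace (CSeries (fun k => (RtoC (t ^ k) * (RtoC (INR (S k)) * exp_power_coef n (S k)))%C))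
    with ((PSeries (PS_derive (fun k => Re (exp_power_coef n k))) t,
      PSeries (PS_derive (fun k => Im (exp_power_coef n k))) t) : C).
  - apply is_derive_C_pair; apply is_derive_PSeries; rewrite CV_radius_exp_power;
      try exact I; [apply Rabs_Re_le | apply Rabs_Im_le].
  - unfold CSeries, PSeries, PS_derive.
    f_equal; apply Series_ext; intros k; unfold Cmult, Re, Im, RtoC; cbn [fst snd]; ring.
Qed.

Lemma exp_it_lap_0 n : exp_it_lap 0 f n = f n.
Proof.
  rewrite exp_it_lap_PSeries, !PSeries_0.
  assert (E : exp_power_coef n 0 = f n).
  { unfold exp_power_coef. simpl. unfold Cdiv.
    rewrite <- RtoC_inv, Rinv_1 by lra. ring. }
  rewrite E. symmetry. apply surjective_pairing.
Qed.

End Solution.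

Theorem theorem1p1 :
  exists K : R, (0 < K)%R /\
    forall (u0 : Z3 -> C) (u : R -> Z3 -> C),
      in_l1 u0 ->
      (forall (t : R) (n : Z3), (0 <= t)%R -> u t n = exp_it_lap t u0 n) ->
      solves_discrete_schrodinger u0 u /\
      forall t : R, (0 <= t)%R ->
        Rbar_le (linf_norm (u t))
          (Rbar_mult (Finite (K * Rpower (japanese_bracket t) (- (13 / 12))))
             (l1_norm u0)).
Proof.
  destruct delta3_kernel_bound as [K [HK Hdisp]].
  exists K. split; [exact HK|]. intros u0 u Hu0 Hu.
  assert (HB : forall m, Cmod (u0 m) <= real (l1_norm u0)).
  { intros m. pose proof (l1_norm_partial_sum u0 [m] Hu0) as H. simpl in H.
    rewrite Rplus_0_r in H. apply H. constructor; [auto | constructor]. }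
  split.
  - split.
    + intros t n Ht. exists (Ci * lkg_lap (exp_it_lap t u0) n)%C. split.
      * apply (is_derive_ext_loc (V := C_R_NormedModule) (fun s => exp_it_lap s u0 n)).
        (* [u] is prescribed only for nonnegative times, so it agrees with the exponential on the
           neighbourhood of radius [t] of the positive time [t]. *)
        -- exists (mkposreal t Ht). intros s Hs. symmetry. apply Hu.
           change (Rabs (s - t) < t) in Hs. apply Rabs_def2 in Hs. lra.
        -- now apply (is_derive_exp_it_lap u0 _ HB).
      * rewrite (lkg_lap_ext (u t) (exp_it_lap t u0)); [ring|]. intros m. apply Hu. lra.
    + intros n. rewrite Hu by lra. apply exp_it_lap_0.
  - intros t Ht.
    destruct (Lub_Rbar_correct (fun s => exists n, s = Cmod (u t n))) as [_ Hlub].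
    apply Hlub. intros s [n ->].
    (* Finiteness of the norm turns the product in the extended reals into a real one. *)
    rewrite <- Hu0. simpl. rewrite Hu by exact Ht.
    apply Cmod_exp_it_lap_l1; auto.
    apply Rmult_le_pos; [lra | apply Rlt_le, exp_pos].
Qed.
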